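(* Let $n\ge 2$ be even, let $H_0=\mathrm{diag}(n,-1,\dots,-1)\in\mathfrak{sl}(n+1,\mathbb{C})$, let $\mathcal{O}(H_0)$ be its adjoint orbit under $\mathrm{SL}(n+1,\mathbb{C})$, let $H=\mathrm{diag}(h_1,\dots,h_{n+1})$ with $h_1>\dots>h_{n+1}$ real and $\sum_k h_k=0$, and let $f_H\colon\mathcal{O}(H_0)\to\mathbb{C}$, $f_H(x)=\langle H,x\rangle$. For $1\le j\le n+1$ let $$m_j^{\pm}=\mp(-1)^j\,\mathrm{diag}(1,\dots,1,\pm1_j,-1,\dots,-1)$$ (the entries before position $j$ are $1$, the entry in position $j$ is $\pm1$, the entries after position $j$ are $-1$). Then the stable and unstable manifolds of $\mathrm{grad}(\mathrm{Re}\,f_H)$ at the critical point $[e_j]$ are open in the graphs $\Gamma(m_j^{\pm}\circ R_{w_0})$: the stable manifold is an open subset of $\Gamma(m_j^{-}\circ R_{w_0})$ and the unstable manifold is an open subset of $\Gamma(m_j^{+}\circ R_{w_0})$. The real Lagrangian thimbles at $[e_j]$ are closed balls contained in the graphs $\Gamma(m_j^{\pm}\circ R_{w_0})$ (sign $-$ for those in the stable manifold, sign $+$ for those in the unstable manifold).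
   Context: $\langle\cdot,\cdot\rangle$ is the Cartan–Killing form of $\mathfrak{sl}(n+1,\mathbb{C})$. Let $\tau(X)=-X^{*}$ be the conjugation with respect to $\mathfrak{su}(n+1)$ and $\mathcal{H}_\tau(X,Y)=-\langle X,\tau Y\rangle$. The complex manifold $\mathcal{O}(H_0)$ carries the Riemannian metric and the symplectic form $\Omega$ obtained by restricting the real and the imaginary part of $\mathcal{H}_\tau$; gradients are with respect to this metric, and Lagrangian is with respect to $\Omega$. Let $\mathbb{P}^n$ be the space of lines in $\mathbb{C}^{n+1}$ and $\mathbb{P}^{n*}$ the space of hyperplanes. To a pair $(V,W)\in\mathbb{P}^n\times\mathbb{P}^{n*}$ with $V\cap W=\{0\}$ one associates the linear map $\Phi(V,W)$ with $\Phi(V,W)v=nv$ for $v\in V$ and $\Phi(V,W)w=-w$ for $w\in W$; this is a diffeomorphism from the open set of transversal pairs onto $\mathcal{O}(H_0)$, used as an identification. $R_{w_0}\colon\mathbb{P}^n\to\mathbb{P}^{n*}$ sends a line to its orthogonal complement for the canonical Hermitian form of $\mathbb{C}^{n+1}$. For a diagonal unitary $m$ of determinant $1$, $\Gamma(m\circ R_{w_0})=\{(V,mV^{\perp})\}$ is the graph of $m\circ R_{w_0}$; regarded in $\mathcal{O}(H_0)$, it means its part in the open set of transversal pairs, i.e. $\{\Phi(V,mV^\perp): V\in\mathbb{P}^n,\ V\not\subset mV^\perp\}$. The critical points of $f_H$ are the $n+1$ points of $\mathcal{O}(H_0)$ corresponding to the coordinate lines $[e_j]$, i.e. $\Phi([e_j],[e_j]^\perp)$,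 the diagonal matrix with $n$ in position $j$ and $-1$ in the other positions. Since $n$ is even, $\det m_j^\pm=1$. Write $f_1=\mathrm{Re}\,f_H$. A thimble at a critical point $x$ is the disc swept by a sphere in a regular fibre of $f_H$ which is parallel transported along a path in $\mathbb{C}$ to the critical value $f_H(x)$, collapsing to $x$; parallel transport is for the connection given by the $\Omega$-orthogonals of the fibres. A real Lagrangian thimble at $x$ is a thimble which is a Lagrangian submanifold, contained in the stable (resp. unstable) manifold of $\mathrm{grad}f_1$ at $x$, and constructed as follows: one takes a Lagrangian submanifold $V\ni x$ on which $\mathrm{Im}f_H$ is constant and such that the Hessian of $f_H$ at $x$ is negative (resp. positive) definite on $T_xV$, and for $c$ near $f_1(x)$ with $c<f_1(x)$ (resp. $c>f_1(x)$) one takes, in a small neighborhood of $x$ in $V$, the set $f_1^{-1}[c,f_1(x)]\cap V$ (resp. $f_1^{-1}[f_1(x),c]\cap V$). *)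

(* Defs.v *)
From HB Require Import structures.
From mathcomp Require Import all_boot all_order all_algebra.
From mathcomp Require Import complex.
From mathcomp Require Import all_classical all_reals all_analysis.
Import Order.TTheory GRing.Theory Num.Theory numFieldNormedType.Exports.

Set Implicit Arguments.
Unset Strict Implicit.
Unset Printing Implicit Defensive.

Local Open Scope classical_set_scope.
Local Open Scope ring_scope.
Local Open Scope complex_scope.

(* The usual topology of R[i], hence of complex matrices. *)
HB.instance Definition _ (R : realType) := NormedModule.copy R[i] R[i]^o.

Section Calculus.
Variable R : realType.

(* A complex matrix as a vector of a real normed space: derivatives of
   matrix-valued maps of real variables are taken through this isomorphism. *)
Definition realify {m n : nat} (X : 'M[R[i]]_(m, n)) : 'M[R]_(m, n) * 'M[R]_(m, n) :=
  (map_mx (@complex.Re R) X, map_mx (@complex.Im R) X).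

(* For V finite-dimensional and A open this is the usual notion of a C^k map. *)
Fixpoint Ck_on (V W : normedModType R) (k : nat) (A : set V) (f : V -> W)
    : Prop :=
  (forall x, A x -> {for x, continuous f}) /\
  if k is k'.+1 then
    forall v : V, (forall x, A x -> derivable f x v) /\
                  Ck_on k' A (fun x => 'D_v f x)
  else True.

Definition smooth_on (V W : normedModType R) (A : set V) (f : V -> W) : Prop :=
  forall k, Ck_on k A f.

(* Euclidean: the library norm of 'rV[R]_k is the sup norm. *)
Definition unit_sphere k : set 'rV[R]_k := [set u | \sum_i u 0 i ^+ 2 = 1].
Definition unit_ball k : set 'rV[R]_k := [set u | \sum_i u 0 i ^+ 2 <= 1].

Variable N : nat.
Local Notation E := 'M[R[i]]_N.

Definition embedding_on k (W : set 'rV[R]_k) (phi : 'rV[R]_k -> E) : Prop :=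
  [/\ open W,
      smooth_on W (realify \o phi),
      (forall w c : 'rV[R]_k, W w -> 'D_c (realify \o phi) w = 0 -> c = 0) &
      exists psi : E -> 'rV[R]_k,
        {in W, cancel phi psi} /\ {within phi @` W, continuous psi}].

(* Embedded submanifolds of the real vector space E. The model Q is the whole
   space for manifolds without boundary and half_space for manifolds with
   (possibly empty) boundary. *)
Definition half_space k : set 'rV[R]_k :=
  [set u | forall i : 'I_k, i = 0%N :> nat -> 0 <= u 0 i].

Definition local_param k (Q : set 'rV[R]_k) (M : set E)
    (W : set 'rV[R]_k) (phi : 'rV[R]_k -> E) : Prop :=
  embedding_on W phi /\
  exists U : set E, open U /\ M `&` U = phi @` (W `&` Q).

Definition submanifold k (Q : set 'rV[R]_k) (M : set E) : Prop :=
  forall p, M p ->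
    exists W phi, local_param Q M W phi /\ exists2 w, (W `&` Q) w & phi w = p.

(* At a boundary point this is the full tangent space, not the tangent space
   of the boundary. *)
Definition tangent k (Q : set 'rV[R]_k) (M : set E) (p v : E) : Prop :=
  exists W phi, local_param Q M W phi /\
    exists w c, [/\ (W `&` Q) w, phi w = p &
                    realify v = 'D_c (realify \o phi) w].

Definition closed_ball_of_dim k (D : set E) : Prop :=
  exists W (phi : 'rV[R]_k -> E),
    [/\ embedding_on W phi, @unit_ball k `<=` W & D = phi @` @unit_ball k].

Definition embedded_sphere k (sigma : 'rV[R]_k -> E) : Prop :=
  exists W : set 'rV[R]_k,
    [/\ open W, @unit_sphere k `<=` W, smooth_on W (realify \o sigma),
        {in @unit_sphere k &, injective sigma} &
        forall u c : 'rV[R]_k, unit_sphere u -> \sum_i u 0 i * c 0 i = 0 ->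
          'D_c (realify \o sigma) u = 0 -> c = 0].

Definition relatively_open (G S : set E) : Prop :=
  exists U : set E, open U /\ S = G `&` U.

End Calculus.

Arguments realify {R m n} X.

Section Orbit.
Variables (R : realType) (n : nat).
Local Notation C := R[i].
Local Notation E := 'M[C]_n.+1.

Definition adjmx p q (A : 'M[C]_(p, q)) : 'M[C]_(q, p) := (map_mx (@conjc R) A)^T.

Definition bracket (X Y : E) : E := X *m Y - Y *m X.

(* The trace of ad X \o ad Y is taken over gl(n+1); for X, Y in sl(n+1) it is
   the trace over sl(n+1), since ad X \o ad Y maps gl(n+1) into sl(n+1). *)
Definition killing (X Y : E) : C := \tr (lin_mx (bracket X \o bracket Y)).

Definition tau (X : E) : E := - adjmx X.
Definition herm_tau (X Y : E) : C := - killing X (tau Y).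
Definition metric (X Y : E) : R := complex.Re (herm_tau X Y).
Definition Omega (X Y : E) : R := complex.Im (herm_tau X Y).

(* crit_pt j is the point of the orbit corresponding to the line [e_j], with
   j counted from 0. *)
Definition crit_pt (j : 'I_n.+1) : E :=
  diag_mx (\row_i (if i == j then n%:R else -1)).

Definition H0 : E := crit_pt ord0.

Definition orbit_H0 : set E :=
  [set x | exists2 g : E, \det g = 1 & x = g *m H0 *m invmx g].

Definition tangent_orbit (x v : E) : Prop :=
  exists2 A : E, \tr A = 0 & v = bracket A x.

Definition diagH (h : 'I_n.+1 -> R) : E := diag_mx (\row_i (h i)%:C).

Variable h : 'I_n.+1 -> R.

(* The formula defining f_H makes sense on all matrices; f_H itself is its
   restriction to the orbit, whose differential at x is therefore the
   restriction of the differential to tangent_orbit x. *)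
Definition fH (x : E) : C := killing (diagH h) x.
Definition f1 (x : E) : R := complex.Re (fH x).

Definition critical (y : E) : Prop :=
  orbit_H0 y /\ forall v, tangent_orbit y v -> 'D_v fH y = 0.

Definition is_gradient (f : E -> R) (x G : E) : Prop :=
  tangent_orbit x G /\
  forall v, tangent_orbit x v ->
    is_derive (0 : R) 1 (fun s : R => f (x + s%:C *: v)) (metric G v).

Definition integral_curve (I : set R) (gamma : R -> E) : Prop :=
  forall t, I t ->
    orbit_H0 (gamma t) /\
    exists2 G, is_gradient f1 (gamma t) G &
      is_derive t 1 (realify \o gamma) (realify G).

Definition stable (x : E) : set E :=
  [set y | exists gamma : R -> E,
    [/\ exists2 e : R, 0 < e & integral_curve [set t | - e < t] gamma,
        gamma 0 = y & gamma t @[t --> +oo] --> x]].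

Definition unstable (x : E) : set E :=
  [set y | exists gamma : R -> E,
    [/\ exists2 e : R, 0 < e & integral_curve [set t | t < e] gamma,
        gamma 0 = y & gamma t @[t --> -oo] --> x]].

(* The orbit has real dimension 4n, so Lagrangian submanifolds have dimension
   2n. *)
Definition lagrangian (Q : set 'rV[R]_(n.*2)) (L : set E) : Prop :=
  [/\ L `<=` orbit_H0, submanifold Q L &
      forall p u v, L p -> tangent Q L p u -> tangent Q L p v -> Omega u v = 0].

(* q is the value Hess(f_H)(v, v) at the critical point x: the second
   derivative of f_H along a curve of the orbit with velocity v (independent
   of the curve since x is critical). *)
Definition hessian_val (x v : E) (q : C) : Prop :=
  exists gamma : R -> E,
    [/\ smooth_on [set: R] (realify \o gamma), forall s, orbit_H0 (gamma s),
        gamma 0 = x, is_derive (0 : R) 1 (realify \o gamma) (realify v) &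
        q = derive1n 2 (fun s => complex.Re (fH (gamma s))) 0
            +i* derive1n 2 (fun s => complex.Im (fH (gamma s))) 0].

Definition horizontal (y u : E) : Prop :=
  tangent_orbit y u /\
  forall v, tangent_orbit y v -> 'D_v fH y = 0 -> Omega u v = 0.

(* A path from a regular value to the critical value f_H(x), meeting critical
   values only at its end. *)
Definition vanishing_path (x : E) (alpha : R -> C) : Prop :=
  [/\ {within `[0, 1], continuous alpha},
      smooth_on [set t : R | 0 < t < 1] (fun t => complex.Re (alpha t)) /\
      smooth_on [set t : R | 0 < t < 1] (fun t => complex.Im (alpha t)),
      (forall s t, 0 <= s <= 1 -> 0 <= t <= 1 -> alpha s = alpha t -> s = t),
      (forall t y, 0 <= t < 1 -> fH y = alpha t -> ~ critical y) &
      alpha 1 = fH x].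

Definition horizontal_lift (alpha : R -> C) (gamma : R -> E) : Prop :=
  [/\ {within [set t : R | 0 <= t < 1], continuous gamma},
      (forall t, 0 <= t < 1 ->
         orbit_H0 (gamma t) /\ fH (gamma t) = alpha t) &
      (forall t, 0 < t < 1 ->
         exists2 u, horizontal (gamma t) u &
           is_derive t 1 (realify \o gamma) (realify u))].

(* P u t is the parallel transport along alpha, from time 0 to time t, of the
   point sigma u of a sphere in the fibre over alpha 0; the sphere has the
   middle dimension 2n - 1. *)
Definition thimble (x : E) (D : set E) : Prop :=
  exists (alpha : R -> C) (sigma : 'rV[R]_(n.*2) -> E)
         (P : 'rV[R]_(n.*2) -> R -> E),
    [/\ vanishing_path x alpha,
        embedded_sphere sigma,
        (forall u, unit_sphere u ->
           P u 0 = sigma u /\ horizontal_lift alpha (P u)),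
        (forall B, nbhs x B ->
           \forall t \near (1 : R)^'-, forall u, unit_sphere u -> B (P u t)) &
        D = [set y | y = x \/
               exists u t, [/\ unit_sphere u, 0 <= t < 1 & y = P u t]]].

(* V is a manifold without boundary, U the small neighborhood of x; the order
   of C is used: q < 0 means that q is a negative real number. *)
Definition stable_real_thimble (x : E) (D : set E) : Prop :=
  [/\ thimble x D, lagrangian (@half_space R n.*2) D, D `<=` stable x &
      exists (V U : set E) (c : R),
        [/\ lagrangian setT V /\ V x,
            (forall y, V y -> complex.Im (fH y) = complex.Im (fH x)),
            (forall v q, tangent [set: 'rV[R]_(n.*2)] V x v -> v != 0 ->
               hessian_val x v q -> q < 0),
            open U /\ U x &
            c < f1 x /\ D = V `&` U `&` [set y | c <= f1 y <= f1 x]]].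

Definition unstable_real_thimble (x : E) (D : set E) : Prop :=
  [/\ thimble x D, lagrangian (@half_space R n.*2) D, D `<=` unstable x &
      exists (V U : set E) (c : R),
        [/\ lagrangian setT V /\ V x,
            (forall y, V y -> complex.Im (fH y) = complex.Im (fH x)),
            (forall v q, tangent [set: 'rV[R]_(n.*2)] V x v -> v != 0 ->
               hessian_val x v q -> 0 < q),
            open U /\ U x &
            f1 x < c /\ D = V `&` U `&` [set y | f1 x <= f1 y <= c]]].

End Orbit.

Section Graph.
Variables (R : realType) (n : nat).
Local Notation C := R[i].
Local Notation Cn := 'cV[C]_n.+1.

Definition is_Phi (V W : {vspace Cn}) (x : 'M[C]_n.+1) : Prop :=
  (forall v, v \in V -> x *m v = n%:R *: v) /\
  (forall w, w \in W -> x *m w = - w).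

(* The orthogonal complement of V for the canonical Hermitian form. *)
Definition R_w0 (V : {vspace Cn}) : {vspace Cn} :=
  (\bigcap_(v <- vbasis V) lker (linfun (mulmx (adjmx v) : Cn -> 'M[C]_1)))%VS.

(* The part of the graph of m \o R_w0 formed by transversal pairs, inside the
   orbit. *)
Definition Gamma (m : 'M[C]_n.+1) : set 'M[C]_n.+1 :=
  [set x | exists V : {vspace Cn},
    let W := (linfun (mulmx m : Cn -> Cn) @: R_w0 V)%VS in
    [/\ \dim V = 1%N, (V :&: W = 0)%VS & is_Phi V W x]].

(* For the sign eps = 1 or -1; the 1-based position of j is j.+1. *)
Definition m_mx (eps : C) (j : 'I_n.+1) : 'M[C]_n.+1 :=
  (- eps * (-1) ^+ j.+1) *:
  diag_mx (\row_(i < n.+1)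
             (if (i < j)%N then 1 else if i == j then eps else -1)).

End Graph.

(* Main.v *)
Require Import Defs.
From mathcomp Require Import all_boot all_order all_algebra.
From mathcomp Require Import perm complex ring lra.
From mathcomp Require Import all_classical all_reals all_analysis.
Import Order.TTheory GRing.Theory Num.Theory numFieldNormedType.Exports.
Local Open Scope classical_set_scope.
Local Open Scope ring_scope.

Set Implicit Arguments.
Unset Strict Implicit.
Unset Printing Implicit Defensive.
Local Notation Re := complex.Re.
Local Notation Im := complex.Im.

(** * Derivatives of real, complex and matrix valued maps *)

Section RealDerivatives.
Variables (R : realType) (V : normedModType R).
Implicit Types (f g : V -> R) (a v : V).

Lemma is_derive_mul f g a v df dg :
  is_derive a v f df -> is_derive a v g dg ->
  is_derive a v (fun x => f x * g x) (df * g a + f a * dg).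
Proof.
move=> hf hg; have := is_deriveM hf hg; rewrite /GRing.scale /=.
by rewrite addrC [g a * df]mulrC.
Qed.

Lemma is_derive_scal (c : R) f a v df :
  is_derive a v f df -> is_derive a v (fun x => c * f x) (c * df).
Proof.
move=> hf; apply: is_derive_eq (is_derive_mul (is_derive_cst c a v) hf) _.
by rewrite mul0r add0r.
Qed.

Lemma is_derive_inv f a v df : f a != 0 -> is_derive a v f df ->
  is_derive a v (fun x => (f x)^-1) (- df / f a ^+ 2).
Proof.
move=> fa [hf hd]; apply: DeriveDef; first exact: derivableV.
by rewrite deriveV// hd /GRing.scale /= mulNr mulNr mulrC.
Qed.

Lemma is_derive_div f g a v df dg : g a != 0 ->
  is_derive a v f df -> is_derive a v g dg ->
  is_derive a v (fun x => f x / g x) ((df * g a - f a * dg) / g a ^+ 2).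
Proof.
move=> ga hf hg; apply: is_derive_eq (is_derive_mul hf (is_derive_inv ga hg)) _.
by field.
Qed.

Lemma is_derive_big (I : finType) (P : pred I) (F : I -> V -> R) a v
    (dF : I -> R) :
  (forall i, is_derive a v (F i) (dF i)) ->
  is_derive a v (fun x => \sum_(i | P i) F i x) (\sum_(i | P i) dF i).
Proof.
move=> h; rewrite unlock; elim: (index_enum I) => [|i s ih] /=.
  exact: is_derive_cst.
by case: ifP => // _; apply: is_deriveD.
Qed.

End RealDerivatives.

Section PairMatrixDerivatives.
Variables (R : realType) (V : normedModType R).

Lemma is_derive_pairP (W1 W2 : normedModType R) (f : V -> W1 * W2) a v d :
  is_derive a v f d <->
  is_derive a v (fun x => (f x).1) d.1 /\ is_derive a v (fun x => (f x).2) d.2.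
Proof.
split=> [[hf <-]|[[h1 e1] [h2 e2]]].
  have c : h^-1 *: ((f \o shift a) (h *: v) - f a) @[h --> 0^'] -->
      'D_v f a := hf.
  split; apply: DeriveDef.
  - apply/cvg_ex; exists ('D_v f a).1.
    exact: (cvg_comp _ _ c (@cvg_fst _ _ _ _ _)).
  - apply/cvg_lim => //.
    exact: (cvg_comp _ _ c (@cvg_fst _ _ _ _ _)).
  - apply/cvg_ex; exists ('D_v f a).2.
    exact: (cvg_comp _ _ c (@cvg_snd _ _ _ _ _)).
  - apply/cvg_lim => //.
    exact: (cvg_comp _ _ c (@cvg_snd _ _ _ _ _)).
have c : h^-1 *: ((f \o shift a) (h *: v) - f a) @[h --> 0^'] --> d.
  have -> : d = ('D_v (fun x => (f x).1) a, 'D_v (fun x => (f x).2) a).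
    by rewrite e1 e2 -surjective_pairing.
  exact: (cvg_pair h1 h2).
by apply: DeriveDef; [apply/cvg_ex; exists d|apply/cvg_lim].
Qed.

Lemma is_derive_mxP p q (M : V -> 'M[R]_(p, q)) a v D :
  is_derive a v M D <->
  forall i j, is_derive a v (fun x => M x i j) (D i j).
Proof.
split=> [[hM <-] i j|h].
  move/derivable_mxP: (hM) => /(_ i j) hd.
  by apply: DeriveDef => //; rewrite derive_mx// mxE.
have hM : derivable M a v by apply/derivable_mxP => i j; case: (h i j).
apply: DeriveDef => //; rewrite derive_mx//; apply/matrixP => i j.
by rewrite mxE; case: (h i j).
Qed.

(** The derivative of a complex valued map of real variables, as opposed to
    the complex derivative that the norm of [R[i]] over itself would give. *)
Definition cderive (z : V -> R[i]%C) (a v : V) (d : R[i]%C) : Prop :=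
  is_derive a v (fun x => Re (z x)) (Re d) /\
  is_derive a v (fun x => Im (z x)) (Im d).

Lemma realify_is_deriveP p q (M : V -> 'M[R[i]%C]_(p, q)) a v D :
  is_derive a v (realify \o M) (realify D) <->
  forall i j, cderive (fun x => M x i j) a v (D i j).
Proof.
rewrite is_derive_pairP /= !is_derive_mxP; split.
  move=> [h1 h2] i j; split.
    by have := h1 i j; rewrite mxE; under eq_fun do rewrite mxE.
  by have := h2 i j; rewrite mxE; under eq_fun do rewrite mxE.
move=> h; split=> i j; have [h1 h2] := h i j; rewrite mxE;
  by under eq_fun do rewrite mxE.
Qed.

End PairMatrixDerivatives.

Section ComplexDerivatives.
Variables (R : realType) (V : normedModType R).
Local Notation C := R[i]%C.
Implicit Types (z w : V -> C) (a v : V).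

Lemma cderive_eq z a v d d' : cderive z a v d -> d = d' -> cderive z a v d'.
Proof. by move=> h <-. Qed.

Lemma cderive_real (f : V -> R) a v d :
  is_derive a v f d -> cderive (fun x => (f x)%:C%C) a v d%:C%C.
Proof. by move=> h; split=> //=; exact: is_derive_cst. Qed.

Lemma cderive_cst (c : C) a v : cderive (fun _ => c) a v 0.
Proof. by split; exact: is_derive_cst. Qed.

Lemma cderiveD z w a v dz dw : cderive z a v dz -> cderive w a v dw ->
  cderive (fun x => z x + w x) a v (dz + dw).
Proof.
move=> [h1 h2] [k1 k2]; split; rewrite raddfD /=;
  under eq_fun do rewrite raddfD /=; exact: is_deriveD.
Qed.

Lemma ReD (x y : C) : Re (x + y) = Re x + Re y.
Proof. by case: x y => [? ?] [? ?]. Qed.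

Lemma ImD (x y : C) : Im (x + y) = Im x + Im y.
Proof. by case: x y => [? ?] [? ?]. Qed.

Lemma ReM (x y : C) : Re (x * y) = Re x * Re y - Im x * Im y.
Proof. by case: x y => [? ?] [? ?]. Qed.

Lemma ImM (x y : C) : Im (x * y) = Re x * Im y + Im x * Re y.
Proof. by case: x y => [? ?] [? ?]. Qed.

Lemma cderiveM z w a v dz dw : cderive z a v dz -> cderive w a v dw ->
  cderive (fun x => z x * w x) a v (dz * w a + z a * dw).
Proof.
move=> [h1 h2] [k1 k2]; split.
  under eq_fun do rewrite ReM.
  apply: is_derive_eq (is_deriveB (is_derive_mul h1 k1) (is_derive_mul h2 k2)) _.
  by rewrite ReD !ReM; ring.
under eq_fun do rewrite ImM.
apply: is_derive_eq (is_deriveD (is_derive_mul h1 k2) (is_derive_mul h2 k1)) _.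
by rewrite ImD !ImM; ring.
Qed.

Lemma ReJ (x : C) : Re (conjc x) = Re x.
Proof. by case: x. Qed.

Lemma ImJ (x : C) : Im (conjc x) = - Im x.
Proof. by case: x. Qed.

Lemma cderiveJ z a v dz : cderive z a v dz ->
  cderive (fun x => conjc (z x)) a v (conjc dz).
Proof.
move=> [h1 h2]; split; first by rewrite ReJ; under eq_fun do rewrite ReJ.
by rewrite ImJ; under eq_fun do rewrite ImJ; exact: is_deriveN.
Qed.

Lemma cderive_sum (I : finType) (P : pred I) (F : I -> V -> C) a v dF :
  (forall i, cderive (F i) a v (dF i)) ->
  cderive (fun x => \sum_(i | P i) F i x) a v (\sum_(i | P i) dF i).
Proof.
move=> h; rewrite unlock; elim: (index_enum I) => [|i s ih] /=.
  exact: cderive_cst.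
by case: ifP => // _; apply: cderiveD.
Qed.

Lemma cderiveZ (c : C) z a v d :
  cderive z a v d -> cderive (fun x => c * z x) a v (c * d).
Proof.
move=> h; apply: cderive_eq (cderiveM (cderive_cst c a v) h) _.
by rewrite mul0r add0r.
Qed.

End ComplexDerivatives.

(** * Consequences of the mean value theorem *)

Section MeanValue.
Variable R : realType.
Implicit Types (f w : R -> R) (a b t : R).

Lemma continuous_on_seg f (df : R -> R) a b :
  (forall t, a <= t <= b -> is_derive t 1 f (df t)) ->
  {within `[a, b], continuous f}.
Proof.
move=> h; apply: derivable_within_continuous => t.
by rewrite in_itv /= => /h [].
Qed.

Lemma mvt_seg f (df : R -> R) a b : a <= b ->
  (forall t, a <= t <= b -> is_derive t 1 f (df t)) ->
  exists2 c, a <= c <= b & f b - f a = df c * (b - a).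
Proof.
move=> ab h; have h' t : t \in `]a, b[%R -> is_derive t 1 f (df t).
  by rewrite in_itv /= => /andP[/ltW a_t /ltW t_b]; apply: h; rewrite a_t.
have [c + e] := MVT_segment ab h' (continuous_on_seg h).
by rewrite in_itv /= => hc; exists c.
Qed.

Lemma is_derive_le0 f (df : R -> R) a b : a <= b ->
  (forall t, a <= t <= b -> is_derive t 1 f (df t)) ->
  (forall t, a <= t <= b -> df t <= 0) -> f b <= f a.
Proof.
move=> ab h h0; have [c hc e] := mvt_seg ab h.
by rewrite -subr_le0 e mulr_le0_ge0 ?h0 ?subr_ge0.
Qed.

Lemma is_derive_ge0 f (df : R -> R) a b : a <= b ->
  (forall t, a <= t <= b -> is_derive t 1 f (df t)) ->
  (forall t, a <= t <= b -> 0 <= df t) -> f a <= f b.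
Proof.
move=> ab h h0; have [c hc e] := mvt_seg ab h.
by rewrite -subr_ge0 e mulr_ge0 ?h0 ?subr_ge0.
Qed.

Lemma is_derive_0 f a b : a <= b ->
  (forall t, a <= t <= b -> is_derive t 1 f (0 : R)) -> f a = f b.
Proof.
move=> ab h; have [c hc e] := mvt_seg ab h.
by apply/esym/eqP; rewrite -subr_eq0 e mul0r.
Qed.

Lemma is_derive_expM (M t : R) :
  is_derive t 1 (fun s => expR (M * s)) (M * expR (M * t)).
Proof.
have h : is_derive t 1 (fun s : R => M * s) M.
  apply: is_derive_eq (is_derive_mul (is_derive_cst M t 1) (is_derive_id t 1)) _.
  by rewrite mul0r add0r mulr1.
by apply: is_derive_eq (is_derive1_comp (is_derive_expR (M * t)) h) _; rewrite mulrC.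
Qed.

(** Grönwall: a function with [|w'| <= M w] is trapped between two
    exponentials, so it cannot leave or reach zero. *)
Lemma gronwall_zero w (dw : R -> R) (M a b : R) :
  (forall t, a <= t <= b -> is_derive t 1 w (dw t)) ->
  (forall t, a <= t <= b -> `|dw t| <= M * w t) ->
  (forall t, a <= t <= b -> 0 <= w t) ->
  forall s t, a <= s <= b -> a <= t <= b -> w s = 0 -> w t = 0.
Proof.
move=> hw hM w0 s t sab tab ws; apply/eqP; rewrite eq_le w0// andbT.
have D k r : a <= r <= b ->
    is_derive r 1 (fun x => w x * expR (k * x)) ((dw r + k * w r) * expR (k * r)).
  move=> hr; apply: is_derive_eq (is_derive_mul (hw r hr) (is_derive_expM k r)) _.
  by ring.
have [st|/ltW ts] := leP s t.
  have : w t * expR (- M * t) <= w s * expR (- M * s).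
    apply: (@is_derive_le0 (fun r => w r * expR (- M * r))
      (fun r => (dw r + - M * w r) * expR (- M * r)) _ _ st).
      by move=> r hr; apply: D; lra.
    move=> r hr; apply: mulr_le0_ge0; last exact: expR_ge0.
    have : `|dw r| <= M * w r by apply: hM; lra.
    by rewrite ler_norml => /andP[]; lra.
  by rewrite ws mul0r pmulr_lle0// expR_gt0.
have : w t * expR (M * t) <= w s * expR (M * s).
  apply: (@is_derive_ge0 (fun r => w r * expR (M * r))
    (fun r => (dw r + M * w r) * expR (M * r)) _ _ ts).
    by move=> r hr; apply: D; lra.
  move=> r hr; apply: mulr_ge0; last exact: expR_ge0.
  have : `|dw r| <= M * w r by apply: hM; lra.
  by rewrite ler_norml => /andP[]; lra.
by rewrite ws mul0r pmulr_lle0// expR_gt0.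
Qed.

End MeanValue.

(** * Limits of complex and matrix valued maps *)

Section ComplexLimits.
Variable R : realType.
Local Notation C := R[i]%C.

Lemma normc_Re_Im (z : C) : `|z| = (Num.sqrt (Re z ^+ 2 + Im z ^+ 2))%:C%C.
Proof. exact: normc_def. Qed.

Lemma abs_Re_le (z : C) : `|Re z|%:C%C <= `|z|.
Proof. exact: normc_ge_Re. Qed.

Lemma abs_Im_le (z : C) : `|Im z|%:C%C <= `|z|.
Proof.
rewrite normc_Re_Im lecR -sqrtr_sqr ler_sqrt ?addr_ge0 ?sqr_ge0//.
by rewrite lerDr sqr_ge0.
Qed.

Lemma norm_le_Re_Im (z : C) : `|z| <= (`|Re z| + `|Im z|)%:C%C.
Proof.
rewrite normc_Re_Im lecR -[leRHS]ger0_norm ?addr_ge0// -sqrtr_sqr ler_sqrt ?sqr_ge0//.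
by rewrite sqrrD !real_normK ?num_real// lerD2r lerDl mulrn_wge0.
Qed.

Lemma complex_cvgP (T : Type) (F : set_system T) {FF : Filter F} (f : T -> C)
    (w : C) :
  f t @[t --> F] --> w <->
  Re (f t) @[t --> F] --> Re w /\ Im (f t) @[t --> F] --> Im w.
Proof.
split=> [/cvgrPdist_lt h|[/cvgrPdist_lt h1 /cvgrPdist_lt h2]].
  split; apply/cvgrPdist_lt => e e0.
    have e0' : 0 < e%:C%C :> C by rewrite ltcR.
    near=> t; rewrite -ltcR; apply: le_lt_trans (_ : `|w - f t| < _); last first.
      by near: t; exact: h.
    by apply: le_trans (abs_Re_le _); case: (w) (f t) => [? ?] [? ?].
  have e0' : 0 < e%:C%C :> C by rewrite ltcR.
  near=> t; rewrite -ltcR; apply: le_lt_trans (_ : `|w - f t| < _); last first.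
    by near: t; exact: h.
  by apply: le_trans (abs_Im_le _); case: (w) (f t) => [? ?] [? ?].
apply/cvgrPdist_lt => -[e e'] /=; rewrite ltcE /= => /andP[/eqP -> e0].
have e2 : 0 < e / 2 by rewrite divr_gt0.
near=> t; apply: le_lt_trans (norm_le_Re_Im _) _.
rewrite ltcE /= eqxx /= [ltRHS](splitr e).
have -> : Re (w - f t) = Re w - Re (f t) by case: (w) (f t) => [? ?] [? ?].
have -> : Im (w - f t) = Im w - Im (f t) by case: (w) (f t) => [? ?] [? ?].
apply: ltrD; near: t; [exact: h1|exact: h2].
Unshelve. all: by end_near. Qed.

Lemma mx_cvgP (T : Type) (F : set_system T) {FF : Filter F} p q
    (f : T -> 'M[C]_(p, q)) (w : 'M[C]_(p, q)) :
  f t @[t --> F] --> w <->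
  forall i j, Re (f t i j) @[t --> F] --> Re (w i j) /\
              Im (f t i j) @[t --> F] --> Im (w i j).
Proof.
split=> [h i j|h].
  apply/(complex_cvgP (fun t => f t i j) (w i j)).
  apply: (@continuous_cvg _ _ _ F _ f (fun M : 'M[C]_(p, q) => M i j) w) => //.
  exact: coord_continuous.
apply/cvg_ballP => e e0; rewrite near_simpl.
apply: filterS (_ : F [set t | forall i j, ball (w i j) e (f t i j)]).
  by move=> t ht; split.
apply: filter_forall => i; apply: filter_forall => j.
have /(complex_cvgP (fun t => f t i j) (w i j))/cvg_ballP/(_ e e0) := h i j.
by rewrite near_simpl.
Qed.

End ComplexLimits.

Section SignPersistence.
Variable R : realType.

(** A function with [|w'| <= M |w|] cannot change sign. *)
Lemma sign_persist (w dw : R -> R) (M a b : R) :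
  (forall t, a <= t <= b -> is_derive t 1 w (dw t)) ->
  (forall t, a <= t <= b -> `|dw t| <= M * `|w t|) ->
  forall s t, a <= s <= b -> a <= t <= b -> 0 < w s -> 0 < w t.
Proof.
move=> hw hM s t sab tab ws; rewrite ltNge; apply/negP => wt.
have [c cab wc] : exists2 c, a <= c <= b & w c = 0.
  have cont u v : a <= u -> v <= b -> {within `[u, v], continuous w}.
    by move=> au vb; apply: (continuous_on_seg (df := dw)) => r hr; apply: hw; lra.
  have [st|/ltW ts] := leP s t.
    have [||c] := @IVT _ w s t 0 st.
    - by apply: cont; lra.
    - by rewrite ge_min wt orbT le_max (ltW ws).
    by rewrite in_itv /= => hc e; exists c => //; lra.
  have [||c] := @IVT _ w t s 0 ts.
  - by apply: cont; lra.
  - by rewrite ge_min wt le_max (ltW ws) orbT.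
  by rewrite in_itv /= => hc e; exists c => //; lra.
have := @gronwall_zero R (fun t => w t ^+ 2) (fun t => 2 * w t * dw t) (2 * M) a b.
move=> /(_ _ _ _ c s cab sab) H; have : w s ^+ 2 = 0.
  apply: H; last by rewrite wc expr0n.
  - move=> r hr; apply: is_derive_eq (is_derive_mul (hw r hr) (hw r hr)) _.
    by ring.
  - move=> r hr; rewrite -mulrA normrM ger0_norm// -[2 * M * _]mulrA ler_pM2l//.
    rewrite normrM -[w r ^+ 2]real_normK ?num_real// expr2 mulrA mulrC.
    by rewrite ler_wpM2r// hM.
  - by move=> r _; exact: sqr_ge0.
by move/eqP; rewrite sqrf_eq0 gt_eqF.
Qed.

End SignPersistence.

(** * Change of time *)

Section TimeChange.
Variable R : realType.
Implicit Types (t u x : R).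

Lemma primitive (f : R -> R) (a : R) : continuous f ->
  exists F : R -> R, forall x, a < x -> is_derive x 1 F (f x).
Proof.
move=> cf.
exists (fun x => \int[lebesgue_measure]_(t in `[a, x]) f t)%R => x ax.
have xx : x < x + 1 by rewrite ltrDl.
have int : lebesgue_measure.-integrable `[a, x + 1] (EFin \o f).
  apply: continuous_compact_integrable; first exact: segment_compact.
  by apply: continuous_subspaceT => y; exact: cf.
have [d e] := continuous_FTC1_closed xx int ax (cf x).
by rewrite derive1E in e; exact: DeriveDef d e.
Qed.

(** The inverse of a primitive of [f] solves [theta' = 1 / f theta]; it is
    defined for all positive times because [f] has a primitive on a half-line,
    and it is unbounded for the same reason. *)
Lemma time_change (f : R -> R) : continuous f -> (forall x, 1 <= f x) ->
  exists2 e : R, 0 < e & exists theta : R -> R,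
    [/\ theta 0 = 0,
        forall t, - e < t -> is_derive t 1 theta (f (theta t))^-1 &
        forall M, exists T, forall t, T < t -> M < theta t].
Proof.
move=> cf f1; have [F dF] := primitive (-1) cf.
have F_lip x y : - 1 < x -> x <= y -> y - x <= F y - F x.
  move=> x1 xy; have [c hc ->] : exists2 c, x <= c <= y & F y - F x = f c * (y - x).
    apply: mvt_seg => // u /andP[xu _]; apply: dF.
    exact: lt_le_trans x1 xu.
  by rewrite -[leLHS]mul1r ler_wpM2r// subr_ge0.
have F_mono x y : - 1 < x -> x < y -> F x < F y.
  move=> x1 xy; rewrite -subr_gt0; apply: lt_le_trans (F_lip x y x1 (ltW xy)).
  by rewrite subr_gt0.
have F_inj x y : - 1 < x -> - 1 < y -> F x = F y -> x = y.
  move=> x1 y1 e; apply/eqP; case: ltgtP => // xy.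
    by have := F_mono _ _ x1 xy; rewrite e ltxx.
  by have := F_mono _ _ y1 xy; rewrite e ltxx.
pose b : R := - 2^-1.
have b1 : -1 < b by rewrite /b; lra.
have b0 : b < 0 by rewrite /b; lra.
have F_cont u v : -1 < u -> {within `[u, v], continuous F}.
  move=> u1; apply: (continuous_on_seg (df := f)) => x /andP[ux _].
  by apply: dF; exact: lt_le_trans u1 ux.
have F_onto t : F b < t -> exists2 x, b < x & F x = t.
  move=> bt; pose c := Num.max b (b + (t - F b)).
  have bc : b <= c by rewrite le_max lexx.
  have tc : t <= F c.
    have := F_lip b c b1 bc; have : b + (t - F b) <= c by rewrite le_max lexx orbT.
    lra.
  have [|x] := @IVT _ F b c t bc (F_cont b c b1).
    by rewrite ge_min (ltW bt) le_max tc orbT.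
  rewrite in_itv /= => /andP[bx xc] Fx; exists x => //.
  by rewrite lt_neqAle bx andbT; apply: contraTneq bt => ->; rewrite Fx ltxx.
pose G t : R := xget 0 [set x | b < x /\ F x = t].
have GP t : F b < t -> b < G t /\ F (G t) = t.
  move=> /F_onto[x bx Fx]; rewrite /G.
  by apply: (@xgetPex _ 0 [set x | b < x /\ F x = t]); exists x.
have GF x : b < x -> G (F x) = x.
  move=> bx; have [g1 g2] := GP (F x) (F_mono _ _ b1 bx).
  by apply: F_inj => //; exact: lt_trans b1 _.
have dG x : b < x -> is_derive (F x) 1 G (f x)^-1.
  move=> bx; apply: is_derive_inverse.
  - near=> y; apply: GF; near: y; exact: lt_nbhsr.
  - near=> y; have y1 : - 1 < y.
      by apply: lt_trans b1 _; near: y; exact: lt_nbhsr.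
    have [d _] := dF y y1.
    by apply: differentiable_continuous; exact/derivable1_diffP.
  - by apply: dF; exact: lt_trans b1 bx.
  - by rewrite gt_eqF// (lt_le_trans ltr01).
exists (F 0 - F b); first by rewrite subr_gt0 F_mono.
exists (fun t => G (F 0 + t)); split.
- by rewrite addr0 GF.
- move=> t ht; have ht' : F b < F 0 + t by lra.
  have [g1 g2] := GP _ ht'.
  have d1 : is_derive t 1 (fun t => F 0 + t) (1 : R).
    apply: is_derive_eq (is_deriveD (is_derive_cst (F 0) t 1) (is_derive_id t 1)) _.
    by rewrite add0r.
  have d2 := dG _ g1; rewrite g2 in d2.
  by apply: is_derive_eq (is_derive1_comp d2 d1) _; rewrite mulr1.
- move=> M; pose M' := Num.max M 0.
  have M'b : b < M' by apply: lt_le_trans b0 _; rewrite le_max lexx orbT.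
  exists (F M' - F 0) => t ht; have ht' : F M' < F 0 + t by lra.
  have [g1 g2] := GP _ (lt_trans (F_mono _ _ b1 M'b) ht').
  apply: le_lt_trans (_ : M <= M') _; first by rewrite le_max lexx.
  rewrite ltNge; apply/negP; rewrite le_eqVlt => /orP[/eqP e|lt].
    by move: ht'; rewrite -g2 e ltxx.
  have := F_mono _ _ (lt_trans b1 g1) lt; rewrite g2; lra.
Unshelve. all: by end_near. Qed.

End TimeChange.

(** * Matrices: adjoint, Killing form, orbit *)

Section ComplexNumbers.
Variable R : realType.
Local Notation C := R[i]%C.

Definition nsq (z : C) : R := Re z ^+ 2 + Im z ^+ 2.

Lemma nsqE (z : C) : (nsq z)%:C%C = z * conjc z.
Proof.
by case: z => a b; rewrite /nsq /=; simpc; congr (_ +i* _)%C; ring.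
Qed.

Lemma nsq_ge0 z : 0 <= nsq z.
Proof. by rewrite addr_ge0 ?sqr_ge0. Qed.

Lemma nsq_eq0 z : (nsq z == 0) = (z == 0).
Proof.
rewrite /nsq paddr_eq0 ?sqr_ge0// !sqrf_eq0; case: z => a b /=.
by rewrite eq_complex.
Qed.

Lemma nsq0 : nsq 0 = 0. Proof. by apply/eqP; rewrite nsq_eq0. Qed.

Lemma nsqM z w : nsq (z * w) = nsq z * nsq w.
Proof. by rewrite /nsq ReM ImM; ring. Qed.

Lemma nsq_real (r : R) : nsq r%:C%C = r ^+ 2.
Proof. by rewrite /nsq /= expr0n addr0. Qed.

Lemma nsqJ z : nsq (conjc z) = nsq z.
Proof. by rewrite /nsq ReJ ImJ sqrrN. Qed.

Lemma conjcM (x y : C) : conjc (x * y) = conjc x * conjc y.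
Proof. exact: rmorphM. Qed.

Lemma conjcB (x y : C) : conjc (x - y) = conjc x - conjc y.
Proof. exact: rmorphB. Qed.

Lemma conjc_sum (I : finType) (P : pred I) (F : I -> C) :
  conjc (\sum_(i | P i) F i) = \sum_(i | P i) conjc (F i).
Proof. exact: rmorph_sum. Qed.

Lemma complex_ext (x y : C) : Re x = Re y -> Im x = Im y -> x = y.
Proof. by case: x y => [? ?] [? ?] /= -> ->. Qed.

Lemma Re_sum (I : finType) (P : pred I) (F : I -> C) :
  Re (\sum_(i | P i) F i) = \sum_(i | P i) Re (F i).
Proof. by rewrite (big_morph (@complex.Re R) (@ReD R) (erefl (complex.Re (0 : R[i]%C)))). Qed.

Lemma Im_sum (I : finType) (P : pred I) (F : I -> C) :
  Im (\sum_(i | P i) F i) = \sum_(i | P i) Im (F i).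
Proof. by rewrite (big_morph (@complex.Im R) (@ImD R) (erefl (complex.Im (0 : R[i]%C)))). Qed.

Lemma real_sum (I : finType) (P : pred I) (F : I -> R) :
  (\sum_(i | P i) F i)%:C%C = \sum_(i | P i) (F i)%:C%C :> C.
Proof. exact: rmorph_sum. Qed.

Lemma Re_real (r : R) (z : C) : Re (r%:C%C * z) = r * Re z.
Proof. by rewrite ReM /= mul0r subr0. Qed.

Lemma Im_real (r : R) (z : C) : Im (r%:C%C * z) = r * Im z.
Proof. by rewrite ImM /= mul0r addr0. Qed.

Lemma real_complexM (x y : R) : (x * y)%:C%C = x%:C%C * y%:C%C :> C.
Proof. exact: rmorphM. Qed.

Lemma real_complexD (x y : R) : (x + y)%:C%C = x%:C%C + y%:C%C :> C.
Proof. exact: rmorphD. Qed.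

Lemma real_complexB (x y : R) : (x - y)%:C%C = x%:C%C - y%:C%C :> C.
Proof. exact: rmorphB. Qed.

Lemma real_complexV (x : R) : (x^-1)%:C%C = x%:C%C^-1 :> C.
Proof. exact: fmorphV. Qed.

Lemma real_complex_nat (m : nat) : (m%:R : R)%:C%C = m%:R :> C.
Proof. exact: rmorph_nat. Qed.

Lemma real_complex_eq0 (x : R) : (x%:C%C == 0 :> C) = (x == 0).
Proof. exact: fmorph_eq0. Qed.

End ComplexNumbers.

Section Adjoint.
Variable R : realType.
Local Notation C := R[i]%C.

Lemma adjmxE p q (A : 'M[C]_(p, q)) i j : adjmx A i j = conjc (A j i).
Proof. by rewrite !mxE. Qed.

Lemma adjmxM p q r (A : 'M[C]_(p, q)) (B : 'M[C]_(q, r)) :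
  adjmx (A *m B) = adjmx B *m adjmx A.
Proof. by rewrite /adjmx map_mxM trmx_mul. Qed.

Lemma adjmxK p q (A : 'M[C]_(p, q)) : adjmx (adjmx A) = A.
Proof. by apply/matrixP => i j; rewrite !adjmxE conjcK. Qed.

Lemma adjmxB p q (A B : 'M[C]_(p, q)) : adjmx (A - B) = adjmx A - adjmx B.
Proof. by apply/matrixP => i j; rewrite !(adjmxE, mxE) conjcB. Qed.

Lemma adjmxZ p q (c : C) (A : 'M[C]_(p, q)) :
  adjmx (c *: A) = conjc c *: adjmx A.
Proof. by apply/matrixP => i j; rewrite !(adjmxE, mxE) conjcM. Qed.

Lemma mxtrace_adj p (A : 'M[C]_p) : \tr (adjmx A) = conjc (\tr A).
Proof. by rewrite /mxtrace conjc_sum; apply: eq_bigr => i _; rewrite adjmxE. Qed.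

Lemma mxtrace_adjM p (A B : 'M[C]_p) : \tr (A *m adjmx B) = conjc (\tr (adjmx A *m B)).
Proof. by rewrite -mxtrace_adj adjmxM adjmxK mxtrace_mulC. Qed.

End Adjoint.

Section Killing.
Variables (R : realType) (n : nat).
Local Notation C := R[i]%C.
Local Notation E := 'M[C]_n.+1.
Implicit Types X Y Z x v A P : E.

Lemma mxtrace_lin_mx (f : E -> E) :
  \tr (lin_mx f) = \sum_i \sum_j f (delta_mx i j) i j.
Proof.
rewrite /mxtrace pair_big /=.
rewrite (reindex _ (curry_mxvec_bij _ _)) /=.
by apply: eq_bigr => -[i j] _; rewrite !mxE /= vec_mx_delta mxvecE.
Qed.

Lemma mulmx_deltaE X Y i j : (X *m delta_mx i j *m Y) i j = X i i * Y j j.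
Proof.
rewrite mxE (bigD1 j)//= big1 ?addr0; last first.
  move=> k kj; rewrite mxE big1 ?mul0r// => l _.
  by rewrite mxE (negbTE kj) andbF mulr0.
congr (_ * _); rewrite mxE (bigD1 i)//= mxE !eqxx mulr1 big1 ?addr0//.
by move=> k ki; rewrite mxE (negbTE ki) mulr0.
Qed.

Lemma double_sum (a b c d e f : 'I_n.+1 -> C) :
  \sum_i \sum_j (a i + b j - c i * d j - e i * f j) =
  n.+1%:R * (\sum_i a i) + n.+1%:R * (\sum_i b i)
  - (\sum_i c i) * (\sum_i d i) - (\sum_i e i) * (\sum_i f i).
Proof.
have h i : \sum_j (a i + b j - c i * d j - e i * f j) =
    n.+1%:R * a i + \sum_j b j - c i * (\sum_j d j) - e i * (\sum_j f j).
  rewrite !sumrB big_split /= sumr_const card_ord -!mulr_sumr.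
  by rewrite mulr_natl.
rewrite (eq_bigr _ (fun i _ => h i)) !sumrB big_split /= sumr_const card_ord.
by rewrite -!mulr_suml -mulr_sumr !mulr_natl.
Qed.

Lemma killingE X Y :
  killing X Y = 2 * n.+1%:R * \tr (X *m Y) - 2 * \tr X * \tr Y.
Proof.
rewrite /killing mxtrace_lin_mx.
have e i j : (bracket X \o bracket Y) (delta_mx i j) i j =
    (X *m Y) i i + (Y *m X) j j - X i i * Y j j - Y i i * X j j.
  have -> : (bracket X \o bracket Y) (delta_mx i j) =
      (X *m Y) *m delta_mx i j *m 1%:M + 1%:M *m delta_mx i j *m (Y *m X)
      - X *m delta_mx i j *m Y - Y *m delta_mx i j *m X.
    rewrite /= /bracket !(mulmxBl, mulmxBr) !mulmxA mul1mx mulmx1.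
    move: (_ *m Y *m _) (_ *m _ *m Y) (Y *m _ *m X) (_ *m Y *m X) => a b c d.
    by apply/matrixP => k l; rewrite !mxE; ring.
  have addE (A B : E) : (A + B) i j = A i j + B i j by rewrite mxE.
  have oppE (A : E) : (- A) i j = - A i j by rewrite mxE.
  have oneE k : (1%:M : E) k k = 1 by rewrite mxE eqxx.
  by rewrite !(addE, oppE) !mulmx_deltaE !oneE mulr1 mul1r.
transitivity (\sum_i \sum_j ((X *m Y) i i + (Y *m X) j j
    - X i i * Y j j - Y i i * X j j)).
  by apply: eq_bigr => i _; apply: eq_bigr => j _; exact: e.
rewrite double_sum -/(\tr X) -/(\tr Y) -/(\tr (X *m Y)) -/(\tr (Y *m X)).
by rewrite (mxtrace_mulC Y X) [\tr Y * _]mulrC; ring.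
Qed.

End Killing.

Section Within.
Variable R : realType.
Implicit Types (a b c s t : R) (f g : R -> R).

Lemma within_dist (A : set R) f t (e : R) : {within A, continuous f} ->
  A t -> 0 < e ->
  exists2 d : R, 0 < d & forall s, A s -> `|s - t| < d -> `|f s - f t| < e.
Proof.
move=> cf At e0.
move/subspace_continuousP: cf => /(_ t At)/cvgrPdist_lt/(_ e e0); rewrite near_withinE => /nbhs_ballP[d /= d0 hd].
exists d => // s As sd; rewrite distrC; apply: hd => //.
by rewrite /ball /= distrC.
Qed.

Lemma const_on f a b : a <= b -> {within `[a, b], continuous f} ->
  (forall t, a < t < b -> is_derive t 1 f (0 : R)) -> f a = f b.
Proof.
move=> ab cf df.
have df' t : t \in `]a, b[%R -> is_derive t 1 f ((fun=> 0) t).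
  by rewrite in_itv /=; exact: df.
have [c _ e] := MVT_segment ab df' cf.
by apply/esym/eqP; rewrite -subr_eq0 e mul0r.
Qed.

Lemma first_zero g b : 0 <= b -> {within `[0, b], continuous g} ->
  (forall t, 0 <= t <= b -> 0 <= g t) -> 0 < g 0 -> g b = 0 ->
  exists c, [/\ 0 < c, c <= b, g c = 0 & forall t, 0 <= t < c -> 0 < g t].
Proof.
move=> b0 cg g0 g00 gb.
pose S := [set t | 0 <= t <= b /\ forall s, 0 <= s <= t -> 0 < g s].
have S0 : S 0.
  split=> [|s /andP[s0 s0']]; first by rewrite lexx.
  by have -> : s = 0 by lra.
have hS : has_sup S by split; [exists 0|exists b => t [/andP[]]].
pose c := sup S.
have c0 : 0 <= c by exact: (ub_le_sup hS.2 S0).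
have cb : c <= b by apply: ge_sup; [exists 0|move=> t [/andP[]]].
have lt_c t : 0 <= t < c -> 0 < g t.
  move=> /andP[t0 tc]; have e0 : 0 < c - t by rewrite subr_gt0.
  have [s Ss] := sup_adherent e0 hS; rewrite subKr => ts.
  by have [_] := Ss; apply; rewrite t0 ltW.
have cI : `[0, b]%classic c by rewrite /= in_itv /= c0 cb.
have gc : g c = 0.
  apply/eqP; rewrite eq_le g0 ?c0// andbT leNgt; apply/negP => gc.
  have [d d0 hd] := within_dist cg cI gc.
  have cltb : c < b.
    by rewrite lt_neqAle cb andbT; apply: contraTneq gc => ->; rewrite gb ltxx.
  pose t := Num.min b (c + d / 2).
  have d2 : 0 < d / 2 by rewrite divr_gt0.
  have ct : c < t by rewrite lt_min cltb ltrDl.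
  have tb : t <= b by rewrite ge_min lexx.
  have tcd : t <= c + d / 2 by rewrite ge_min lexx orbT.
  have St : S t.
    split=> [|s /andP[s0 st]]; first by rewrite tb (le_trans c0 (ltW ct)).
    have [sc|cs] := ltP s c; first by apply: lt_c; rewrite s0.
    have sI : `[0, b]%classic s by rewrite /= in_itv /= s0 (le_trans st tb).
    have : `|s - c| < d by rewrite ger0_norm ?subr_ge0//; lra.
    by move=> /(hd s sI); rewrite ltr_norml => /andP[+ _]; lra.
  by have := ub_le_sup hS.2 St; rewrite -/c leNgt ct.
exists c; split=> //.
rewrite lt_neqAle c0 andbT; apply: contraTneq g00 => /esym ec.
by move: gc; rewrite ec => ->; rewrite ltxx.
Qed.

End Within.

Section ComplexInverse.
Variables (R : realType) (V : normedModType R).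
Local Notation C := R[i]%C.

Lemma ReV (z : C) : Re z^-1 = Re z / nsq z.
Proof. by case: z. Qed.

Lemma ImV (z : C) : Im z^-1 = - Im z / nsq z.
Proof. by case: z => a b; rewrite mulNr. Qed.

Lemma cderiveV (z : V -> C) (a v : V) d : z a != 0 -> cderive z a v d ->
  cderive (fun x => (z x)^-1) a v (- d / z a ^+ 2).
Proof.
move=> z0 [d1 d2]; have n0 : nsq (z a) != 0 by rewrite nsq_eq0.
have dn : is_derive a v (fun x => nsq (z x))
    (2 * (Re d * Re (z a) + Im d * Im (z a))).
  apply: is_derive_eq (is_deriveD (is_derive_mul d1 d1) (is_derive_mul d2 d2)) _.
  by ring.
have eV : - d / z a ^+ 2 = - (d * (conjc (z a) * conjc (z a))) / (nsq (z a) ^+ 2)%:C%C.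
  rewrite real_complexM nsqE; have zc0 : conjc (z a) != 0 by rewrite conjc_eq0.
  by field; rewrite z0 zc0.
have sq (w : C) (r : R) : w / (r ^+ 2)%:C%C = (r ^+ 2)^-1%:C%C * w.
  by rewrite -real_complexV mulrC.
have ReN (w : C) : Re (- w) = - Re w by case: w.
have ImN (w : C) : Im (- w) = - Im w by case: w.
rewrite eV sq; split.
  under eq_fun do rewrite ReV.
  apply: is_derive_eq (is_derive_div (f := fun x => Re (z x)) n0 d1 dn) _.
  rewrite Re_real ReN !(ReM, ImM, ReJ, ImJ) /nsq; field; exact: n0.
under eq_fun do rewrite ImV.
apply: is_derive_eq (is_derive_div (f := fun x => - Im (z x)) n0 (is_deriveN d2) dn) _.
rewrite Im_real ImN !(ReM, ImM, ReJ, ImJ) /nsq; field; exact: n0.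
Qed.

End ComplexInverse.

Section Orbit.
Variables (R : realType) (n : nat).
Local Notation C := R[i]%C.
Local Notation E := 'M[C]_n.+1.
Local Notation orbit := (@orbit_H0 R n).
Implicit Types x v A P : E.

(** The spectral projector of [x] onto its eigenline for the eigenvalue [n]:
    on the orbit, [x] is an affine function of this rank-one idempotent. *)
Definition proj x : E := n.+1%:R^-1 *: (x + 1%:M).

Lemma projK x : x = n.+1%:R *: proj x - 1%:M.
Proof. by rewrite /proj scalerA divff ?pnatr_eq0// scale1r addrK. Qed.

Lemma proj_crit_pt j : proj (crit_pt R j) = delta_mx j j :> E.
Proof.
apply/matrixP => k l; rewrite !mxE.
case: (eqVneq k l) => [->|kl] /=; last first.
  rewrite !mulr0n addr0 mulr0; case: (eqVneq l j) => [lj|]; last by rewrite andbF.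
  by rewrite -lj (negbTE kl).
rewrite !mulr1n andbb; case: ifP => _; last by rewrite addNr mulr0.
by rewrite -natr1 mulVf// natr1 pnatr_eq0.
Qed.

Lemma proj_inj x y : proj x = proj y -> x = y.
Proof. by move=> e; rewrite (projK x) e -projK. Qed.

(** [g] carries the standard basis vector to [u] and the standard basis
    covector to [w]; the other columns of [g] are the projections along [u] onto
    the kernel of [w] of basis vectors other than one that [u] involves. *)
Lemma adapted_basis (u : 'cV[C]_n.+1) (w : 'rV[C]_n.+1) : w *m u = 1%:M ->
  exists2 g : E, g \in unitmx & u *m w *m g = g *m delta_mx ord0 ord0.
Proof.
move=> wu.
have [j uj] : exists j, u j 0 != 0.
  apply/existsP; rewrite -negb_forall; apply/negP => /forallP h.
  have : u = 0 by apply/colP => k; rewrite mxE; apply/eqP/h.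
  move=> u0; move: wu; rewrite u0 mulmx0 => /matrixP/(_ 0 0); rewrite !mxE /=.
  by move/eqP; rewrite eq_sym oner_eq0.
pose s : E := perm_mx (tperm ord0 j).
pose e0 : 'rV[C]_n.+1 := delta_mx 0 ord0.
pose T : E := s *m (1%:M - delta_mx ord0 ord0).
pose g : E := u *m e0 + (1%:M - u *m w) *m T.
have de : delta_mx ord0 ord0 = e0^T *m e0 :> E by rewrite trmx_delta mul_delta_mx.
have ee : e0 *m e0^T = 1%:M.
  rewrite trmx_delta mul_delta_mx; apply/matrixP => a b.
  by rewrite !ord1 !mxE eqxx.
have Te : T *m (delta_mx ord0 ord0 : E) = 0.
  by rewrite /T -mulmxA mulmxBl mul1mx mul_delta_mx subrr mulmx0.
have wg : w *m g = e0.
  have w0 : w *m (1%:M - u *m w) = 0.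
    by rewrite mulmxBr mulmx1 mulmxA wu mul1mx subrr.
  by rewrite /g mulmxDr mulmxA wu mul1mx mulmxA w0 mul0mx addr0.
have ge : g *m (delta_mx ord0 ord0 : E) = u *m e0.
  rewrite mulmxDl -[_ *m T *m _]mulmxA Te mulmx0 addr0 de !mulmxA.
  by rewrite -(mulmxA u) ee mulmx1.
exists g; last by rewrite ge -mulmxA wg.
rewrite -unitmx_tr -row_free_unit; apply/inj_row_free => v vg.
have gv : g *m v^T = 0 by apply: trmx_inj; rewrite trmx_mul trmxK vg trmx0.
have v0 : e0 *m v^T = 0 by rewrite -wg -mulmxA gv mulmx0.
have v00 : v 0 ord0 = 0.
  move/matrixP/(_ 0 0): v0; rewrite -rowE !mxE.
  by [].
have Tv : T *m v^T = s *m v^T.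
  by rewrite /T -mulmxA mulmxBl mul1mx de -mulmxA v0 mulmx0 subr0.
have sv : s *m v^T = u *m (w *m (s *m v^T)).
  move: gv; rewrite /g mulmxDl -mulmxA v0 mulmx0 add0r -mulmxA Tv.
  by rewrite mulmxBl mul1mx mulmxA => /eqP; rewrite subr_eq0 => /eqP {1}->.
have c0 : w *m (s *m v^T) = 0.
  apply/matrixP => a b; rewrite !ord1.
  have : (s *m v^T) j 0 = (u *m (w *m (s *m v^T))) j 0 by rewrite -sv.
  rewrite {1}/s -row_permE mxE tpermR mxE v00 mxE big_ord1 => /esym/eqP.
  by rewrite mulf_eq0 (negbTE uj) /= => /eqP ->; rewrite mxE.
have : s *m v^T = 0 by rewrite sv c0 mulmx0.
move/(congr1 (mulmx (invmx s))); rewrite mulmx0 mulKmx ?unitmx_perm// => h.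
by apply: trmx_inj; rewrite h trmx0.
Qed.

Lemma orbitP x :
  orbit x <-> exists (u : 'cV[C]_n.+1) (w : 'rV[C]_n.+1),
    proj x = u *m w /\ w *m u = 1%:M.
Proof.
split=> [[g detg ->]|[u [w [xuw wu]]]].
  have gu : g \in unitmx by rewrite unitmxE detg unitr1.
  have gV : proj (g *m H0 R n *m invmx g) = g *m delta_mx ord0 ord0 *m invmx g.
    rewrite -(proj_crit_pt ord0) /proj -scalemxAr -scalemxAl; congr (_ *: _).
    by rewrite mulmxDr mulmxDl mulmx1 mulmxV.
  exists (g *m delta_mx ord0 0), (delta_mx 0 ord0 *m invmx g); split.
    by rewrite gV !mulmxA -[in RHS](mulmxA g) mul_delta_mx.
  rewrite !mulmxA -(mulmxA _ _ g) mulVmx// mulmx1 mul_delta_mx.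
  by apply/matrixP => a b; rewrite !ord1 !mxE eqxx.
have [g gu ge] := adapted_basis wu.
have detg : \det g != 0 by rewrite -unitfE -unitmxE.
pose r : 'rV[C]_n.+1 := \row_i (if i == ord0 then (\det g)^-1 else 1).
have detr : \det (diag_mx r) = (\det g)^-1.
  rewrite det_diag (bigD1 ord0)//= mxE eqxx big1 ?mulr1// => i i0.
  by rewrite mxE (negbTE i0).
pose g' := g *m diag_mx r.
have detg' : \det g' = 1 by rewrite det_mulmx detr divff.
have g'u : g' \in unitmx by rewrite unitmxE detg' unitr1.
exists g' => //.
have xg : x *m g = g *m H0 R n.
  rewrite (projK x) mulmxBl -scalemxAl xuw ge mul1mx.
  by rewrite (projK (H0 R n)) /H0 proj_crit_pt mulmxBr mulmx1 scalemxAr.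
have comm : H0 R n *m diag_mx r = diag_mx r *m H0 R n.
  by rewrite /H0 /crit_pt; exact: diag_mxC.
have : x *m g' = g' *m H0 R n by rewrite /g' mulmxA xg -!mulmxA comm.
by move=> <-; rewrite mulmxK.
Qed.

Lemma rank1_sandwich (u : 'cV[C]_n.+1) (w : 'rV[C]_n.+1) A :
  w *m u = 1%:M -> u *m w *m A *m (u *m w) = \tr (A *m (u *m w)) *: (u *m w).
Proof.
move=> wu; have -> : \tr (A *m (u *m w)) = (w *m A *m u) 0 0.
  by rewrite mulmxA mxtrace_mulC mulmxA [LHS]big_ord1.
rewrite !mulmxA -[u *m w *m A](mulmxA) -[u *m (w *m A) *m u]mulmxA.
by rewrite {1}[w *m A *m u]mx11_scalar mul_mx_scalar -scalemxAl.
Qed.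

Lemma orbit_idem x : orbit x -> proj x *m proj x = proj x.
Proof.
move=> /orbitP [u [w [-> wu]]].
by rewrite mulmxA -(mulmxA u) wu mulmx1.
Qed.

Lemma bracket_proj A x : bracket A x = n.+1%:R *: bracket A (proj x).
Proof.
rewrite [in LHS](projK x) /bracket mulmxBr mulmxBl mul1mx mulmx1.
by rewrite scalerBr -scalemxAr -scalemxAl opprB addrA subrK.
Qed.

Lemma bracketZl (c : C) A x : bracket (c *: A) x = c *: bracket A x.
Proof. by rewrite /bracket -scalemxAl -scalemxAr scalerBr. Qed.

Lemma tangent_orbitP x v : orbit x ->
  tangent_orbit x v <-> proj x *m v + v *m proj x = v.
Proof.
move=> hx; have PP := orbit_idem hx; set P := proj x in PP *.
split=> [[A trA ->]|hv].
  rewrite bracket_proj -/P -scalemxAr -scalemxAl -scalerDr; congr (_ *: _).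
  rewrite /bracket mulmxBr mulmxBl !mulmxA PP -(mulmxA A P P) PP.
  by rewrite addrC addrA subrK.
exists (n.+1%:R^-1 *: bracket v P).
  by rewrite mxtraceZ /bracket raddfB /= mxtrace_mulC subrr mulr0.
have PvP : P *m v *m P = 0.
  have := congr1 (fun M => P *m M) hv; rewrite mulmxDr !mulmxA PP.
  by move=> /(canRL (addKr _)); rewrite addNr.
have e : bracket (bracket v P) P = v.
  rewrite /bracket mulmxBl mulmxBr !mulmxA PP PvP subr0 sub0r.
  by rewrite opprK -(mulmxA v) PP addrC.
by rewrite bracket_proj -/P bracketZl scalerA divff ?pnatr_eq0// scale1r e.
Qed.

Lemma tangent_orbit_bracket x A : tangent_orbit x (bracket A x).
Proof.
exists (A - (\tr A / n.+1%:R)%:M).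
  rewrite raddfB /= mxtrace_scalar -mulrnAr -[_^-1 *+ _]mulr_natl.
  by rewrite divff ?pnatr_eq0// mulr1 subrr.
by rewrite /bracket mulmxBl mulmxBr scalar_mxC opprB addrA subrK.
Qed.

Lemma tangent_orbitZ x v (c : C) : tangent_orbit x v -> tangent_orbit x (c *: v).
Proof.
move=> [A trA ->]; exists (c *: A); first by rewrite mxtraceZ trA mulr0.
by rewrite bracketZl.
Qed.

Lemma tangent_orbitD x v v' :
  tangent_orbit x v -> tangent_orbit x v' -> tangent_orbit x (v + v').
Proof.
move=> [A trA ->] [A' trA' ->]; exists (A + A').
  by rewrite mxtraceD trA trA' addr0.
by rewrite /bracket mulmxDl mulmxDr opprD addrACA.
Qed.

Lemma tangent_trace0 x v : tangent_orbit x v -> \tr v = 0.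
Proof. by move=> [A _ ->]; rewrite /bracket raddfB /= mxtrace_mulC subrr. Qed.

End Orbit.

(** * The gradient of the height function *)

Section Gradient.
Variables (R : realType) (n : nat).
Local Notation C := R[i]%C.
Local Notation E := 'M[C]_n.+1.
Local Notation orbit := (@orbit_H0 R n).
Variable h : 'I_n.+1 -> R.
Hypothesis h_sum : \sum_i h i = 0.
Local Notation H := (diagH h).
Implicit Types x v A P G : E.

Lemma mxtraceB A x : \tr (A - x) = \tr A - \tr x.
Proof. exact: raddfB. Qed.

Lemma mxBE A x i j : (A - x) i j = A i j - x i j.
Proof. by rewrite !mxE. Qed.

Lemma mxZE (c : C) x i j : (c *: x) i j = c * x i j.
Proof. by rewrite mxE. Qed.

Lemma diagH_mulmxE x i j : (H *m x) i j = (h i)%:C%C * x i j.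
Proof. by rewrite mul_diag_mx !mxE. Qed.

Lemma mulmx_diagHE x i j : (x *m H) i j = x i j * (h j)%:C%C.
Proof. by rewrite mul_mx_diag !mxE. Qed.

Lemma mxtrace_diagH x : \tr (H *m x) = \sum_k (h k)%:C%C * x k k.
Proof. by apply: eq_bigr => k _; rewrite mul_diag_mx !mxE. Qed.

Lemma fHE x : fH h x = 2 * n.+1%:R * \sum_k (h k)%:C%C * x k k.
Proof.
rewrite /fH killingE mxtrace_diagH [X in _ - 2 * X * _](_ : _ = 0).
  by rewrite mulr0 mul0r subr0.
rewrite /diagH mxtrace_diag -[RHS](_ : (0 : R)%:C%C = 0)// -h_sum real_sum.
by apply: eq_bigr => i _; rewrite mxE.
Qed.

Lemma real_2N : 2 * n.+1%:R = (2 * n.+1%:R : R)%:C%C :> C.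
Proof. by rewrite real_complexM !real_complex_nat. Qed.

Lemma fHD x y : fH h (x + y) = fH h x + fH h y.
Proof.
rewrite !fHE -mulrDr -big_split; congr (_ * _); apply: eq_bigr => k _ /=.
by rewrite mxE mulrDr.
Qed.

Lemma fHZ (c : C) x : fH h (c *: x) = c * fH h x.
Proof.
rewrite !fHE mulrCA; congr (_ * _); rewrite mulr_sumr; apply: eq_bigr => k _ /=.
by rewrite mxE mulrCA.
Qed.

Lemma metricE G v : \tr v = 0 ->
  metric G v = 2 * n.+1%:R * Re (\tr (adjmx G *m v)).
Proof.
move=> v0; rewrite /metric /herm_tau /tau killingE.
have -> : \tr (- adjmx v) = 0 by rewrite raddfN /= mxtrace_adj v0 conjc0 oppr0.
have -> : \tr (G *m - adjmx v) = - \tr (G *m adjmx v) by rewrite mulmxN raddfN.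
by rewrite mulr0 subr0 mulrN opprK mxtrace_adjM real_2N Re_real ReJ.
Qed.

Lemma mxtrace_adj_sq x : \tr (adjmx x *m x) = (\sum_k \sum_l nsq (x k l))%:C%C.
Proof.
rewrite exchange_big real_sum; apply: eq_bigr => k _ /=.
rewrite mxE real_sum; apply: eq_bigr => l _.
by rewrite adjmxE nsqE mulrC.
Qed.

Lemma mxtrace_adj_eq0 x : \tr (adjmx x *m x) = 0 -> x = 0.
Proof.
rewrite mxtrace_adj_sq => /eqP; rewrite real_complex_eq0 => /eqP e.
apply/matrixP => k l; rewrite mxE; apply/eqP; rewrite -nsq_eq0.
move/psumr_eq0P: e => /(_ (fun k _ => sumr_ge0 _ (fun l _ => nsq_ge0 _))).
move=> /(_ k isT)/psumr_eq0P => /(_ (fun l _ => nsq_ge0 _)) /(_ l isT) ->.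
exact: eqxx.
Qed.

Lemma is_derive_f1 x v :
  is_derive (0 : R) 1 (fun s : R => f1 h (x + s%:C%C *: v)) (f1 h v).
Proof.
have -> : (fun s : R => f1 h (x + s%:C%C *: v)) = fun s => f1 h x + s * f1 h v.
  by apply/funext => s; rewrite /f1 fHD fHZ ReD Re_real.
apply: is_derive_eq (is_deriveD (is_derive_cst _ _ _)
  (is_derive_mul (is_derive_id _ _) (is_derive_cst _ _ _))) _.
by rewrite mul1r mulr0 addr0 add0r.
Qed.

(** For [v] tangent, both the differential of the height and the metric pairing
    with [G] are real parts of traces against [v]; their difference is the
    trace of [H - adjmx G] times [v]. As [v] runs over the brackets with [x],
    this says that [H - adjmx G] commutes with [x]. *)
Lemma gradientP x G : orbit x -> is_gradient (f1 h) x G <->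
  proj x *m G + G *m proj x = G /\
  (H - adjmx G) *m proj x = proj x *m (H - adjmx G).
Proof.
move=> hx; rewrite /is_gradient tangent_orbitP//; set K := H - adjmx G.
have hK v : tangent_orbit x v ->
    is_derive (0 : R) 1 (fun s : R => f1 h (x + s%:C%C *: v)) (metric G v) <->
    Re (\tr (K *m v)) = 0.
  move=> tv; have e : Re (\tr (K *m v)) * (2 * n.+1%:R) = f1 h v - metric G v.
    rewrite (metricE _ (tangent_trace0 tv)) /f1 fHE -mxtrace_diagH real_2N.
    rewrite Re_real -mulrBr mulrC; congr (_ * _).
    by rewrite /K mulmxBl raddfB /= ReD; congr (_ + _); case: (\tr _).
  have N0 : 2 * n.+1%:R != 0 :> R by rewrite mulf_neq0 ?pnatr_eq0.
  split=> [[_ d]|K0].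
    apply/eqP; rewrite -(mulIr_eq0 _ (mulIf N0)) e.
    by have [_ d'] := is_derive_f1 x v; rewrite -d' d subrr.
  have -> : metric G v = f1 h v.
    by apply/eqP; rewrite eq_sym -subr_eq0 -e K0 mul0r.
  exact: is_derive_f1.
have KA A : \tr (K *m bracket A x) =
    n.+1%:R * \tr ((proj x *m K - K *m proj x) *m A).
  rewrite bracket_proj -scalemxAr mxtraceZ; congr (_ * _).
  rewrite /bracket [in LHS]mulmxBr [in RHS]mulmxBl !mxtraceB; congr (_ - _).
    by rewrite mulmxA mxtrace_mulC mulmxA.
  by rewrite mulmxA.
split=> [[tG dG]|[tG comm]]; split=> //.
  have K0 v : tangent_orbit x v -> \tr (K *m v) = 0.
    move=> tv; apply: complex_ext => /=; first by apply/(hK v tv)/dG.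
    have tiv := tangent_orbitZ 'i%C tv.
    have /(hK _ tiv) := dG _ tiv; rewrite -scalemxAr mxtraceZ ReM /= mul0r mul1r.
    by rewrite sub0r => /eqP; rewrite oppr_eq0 => /eqP.
  clearbody K; apply/esym/eqP; rewrite -subr_eq0; apply/eqP; set M := _ - _.
  apply: (can_inj (@adjmxK _ _ _)).
  have -> : adjmx (0 : E) = 0 by apply/matrixP => i j; rewrite adjmxE !mxE conjc0.
  apply: mxtrace_adj_eq0; rewrite adjmxK.
  have /eqP := KA (adjmx M); rewrite K0; last exact: tangent_orbit_bracket.
  by rewrite eq_sym mulf_eq0 pnatr_eq0 /= => /eqP.
move=> v tv; apply/(hK v tv); case: (tv) => A _ ->.
by rewrite KA comm subrr mul0mx raddf0 mulr0.
Qed.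

Section AtGradient.
Variables (x G : E).
Hypotheses (hx : orbit x) (hG : is_gradient (f1 h) x G).
Local Notation P := (proj x).

Lemma gradient_pairing v : tangent_orbit x v ->
  \tr (H *m v) = \tr (adjmx G *m v).
Proof.
move=> [A _ ->]; have [_ comm] := (gradientP G hx).1 hG.
apply/eqP; rewrite -subr_eq0 -raddfB /= -mulmxBl bracket_proj -scalemxAr mxtraceZ.
rewrite /bracket mulmxBr raddfB /= mulmxA mxtrace_mulC mulmxA -comm.
by rewrite -mulmxA subrr mulr0.
Qed.

Lemma gradient_norm : \sum_k (h k)%:C%C * G k k = (\sum_k \sum_l nsq (G k l))%:C%C.
Proof.
by rewrite -mxtrace_diagH gradient_pairing ?mxtrace_adj_sq//; case: hG.
Qed.

(** [H - adjmx G] commutes with the rank-one idempotent, hence acts on its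
    image and on its coimage by one scalar, the conjugate of the Lagrange
    multiplier [mu] below. *)
Lemma gradient_multiplier : exists mu : C,
  adjmx P *m G = adjmx P *m (H - mu%:M) /\
  G *m adjmx P = (H - mu%:M) *m adjmx P.
Proof.
have [tG comm] := (gradientP G hx).1 hG.
have [u [w [Puw wu]]] := (orbitP x).1 hx.
have PP := orbit_idem hx; set K := H - adjmx G in comm.
have hnu := rank1_sandwich K wu; rewrite -Puw in hnu.
set nu := \tr _ in hnu.
have KP : K *m P = nu *: P by rewrite -hnu -comm -mulmxA PP.
have PK : P *m K = nu *: P by rewrite -comm.
have adjH : adjmx H = H.
  apply/matrixP => i j; rewrite adjmxE !mxE eq_sym.
  by case: eqP => [->|]; rewrite ?mulr1n ?conjc_real// !mulr0n conjc0.
have adjK : adjmx K = H - G by rewrite /K adjmxB adjH adjmxK.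
have e1 : adjmx P *m (H - G) = conjc nu *: adjmx P.
  by rewrite -adjK -adjmxM KP adjmxZ.
have e2 : (H - G) *m adjmx P = conjc nu *: adjmx P.
  by rewrite -adjK -adjmxM PK adjmxZ.
exists (conjc nu); split.
  by rewrite mulmxBr mul_mx_scalar -e1 mulmxBr opprB addrC subrK.
by rewrite mulmxBl mul_scalar_mx -e2 mulmxBl opprB addrC subrK.
Qed.

(** Expanding [G = P G + G P] by the two multiplier equations and the sandwich
    rule for the rank-one matrices [P] and [adjmx P] expresses the gradient
    through [P] alone; taking traces determines the multiplier. *)
Lemma gradient_formula : exists mu : C, let K := H - mu%:M in
  [/\ adjmx P *m G = adjmx P *m K, G *m adjmx P = K *m adjmx P,
      \tr (adjmx P *m P) *: G = P *m adjmx P *m K + K *m adjmx P *m P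
        - \tr (K *m adjmx P) *: P &
      \tr (P *m adjmx P *m K) + \tr (K *m adjmx P *m P) = \tr (K *m adjmx P)].
Proof.
have [mu [e1 e2]] := gradient_multiplier; exists mu => K.
rewrite -/K in e1 e2.
have [tG _] := (gradientP G hx).1 hG.
have [u [w [Puw wu]]] := (orbitP x).1 hx.
have sw A : P *m A *m P = \tr (A *m P) *: P by rewrite Puw; exact: rank1_sandwich.
have swa A : adjmx P *m A *m adjmx P = \tr (A *m adjmx P) *: adjmx P.
  have := congr1 (@adjmx _ _ _) (sw (adjmx A)).
  by rewrite adjmxZ -mxtrace_adj !adjmxM adjmxK mulmxA mxtrace_mulC.
have trP : \tr P = 1.
  by rewrite Puw mxtrace_mulC wu mxtrace_scalar mulr1n.
pose S := \tr (adjmx P *m P).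
have S' : \tr (P *m adjmx P) = S by rewrite mxtrace_mulC.
have Pn0 : adjmx P != 0.
  apply: contraTneq isT => P0; move: (mxtrace_adj P).
  by rewrite P0 trP raddf0 conjc1 => /eqP; rewrite eq_sym oner_eq0.
have [c ec] : exists c : C,
    S *: G = P *m adjmx P *m K + K *m adjmx P *m P - c *: P.
  have f1 : P *m adjmx P *m K = S *: (P *m G) + \tr (adjmx P *m K *m P) *: P.
    rewrite -[in LHS]mulmxA -[in LHS]e1 -[in LHS]tG 2!mulmxDr.
    congr (_ + _); first by rewrite !mulmxA sw -scalemxAl.
    by rewrite -sw -e1 !mulmxA.
  have f2 : K *m adjmx P *m P = S *: (G *m P) + \tr (K *m adjmx P *m P) *: P.
    rewrite -[in LHS]e2 -[in LHS]tG mulmxDl mulmxDl addrC; congr (_ + _).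
      by rewrite -!mulmxA [P *m _]mulmxA sw -scalemxAr.
    by rewrite -sw -e2 !mulmxA.
  exists (\tr (adjmx P *m K *m P) + \tr (K *m adjmx P *m P)).
  move: (\tr (adjmx P *m K *m P)) (\tr (K *m adjmx P *m P)) f1 f2 => a b f1 f2.
  by rewrite f1 f2 scalerDl addrACA addrK -scalerDr tG.
have S0 : S != 0.
  apply: contra_neq Pn0 => S0; have := mxtrace_adj_eq0 (x := P) S0 => ->.
  by apply/matrixP => i j; rewrite adjmxE !mxE conjc0.
have cE : c = \tr (K *m adjmx P).
  pose t := \tr (K *m adjmx P).
  have aPa : adjmx P *m P *m adjmx P = S *: adjmx P by rewrite swa S'.
  have t1 : adjmx P *m (P *m adjmx P *m K) *m adjmx P = (S * t) *: adjmx P.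
    by rewrite !mulmxA aPa -!scalemxAl swa scalerA.
  have t2 : adjmx P *m (K *m adjmx P *m P) *m adjmx P = (S * t) *: adjmx P.
    by rewrite !mulmxA swa -!scalemxAl aPa scalerA mulrC.
  have t3 : adjmx P *m (c *: P) *m adjmx P = (S * c) *: adjmx P.
    by rewrite -scalemxAr -scalemxAl aPa scalerA mulrC.
  have : adjmx P *m (S *: G) *m adjmx P = (S * t) *: adjmx P.
    by rewrite -scalemxAr -scalemxAl e1 swa scalerA.
  rewrite ec mulmxBr mulmxDr mulmxBl mulmxDl t1 t2 t3 -scalerDl -scalerBl.
  move/eqP; rewrite -subr_eq0 -scalerBl scaler_eq0 (negbTE Pn0) orbF.
  have ring_id (a b d : C) : a * b + a * b - a * d - a * b = a * (b - d) by ring.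
  by rewrite ring_id mulf_eq0 (negbTE S0) /= subr_eq0 => /eqP <-.
split=> //; first by rewrite -cE.
move/(congr1 (@mxtrace _ _)): ec; rewrite mxtraceZ mxtraceB mxtraceD.
rewrite (tangent_trace0 (hG.1)) mulr0 mxtraceZ trP mulr1 cE => /eqP.
by rewrite eq_sym subr_eq0 => /eqP.
Qed.

End AtGradient.
End Gradient.

Section Entries.
Variables (R : realType) (n : nat).
Local Notation C := R[i]%C.
Local Notation E := 'M[C]_n.+1.
Local Notation orbit := (@orbit_H0 R n).
Implicit Types x G : E.

Definition rowsq x k : R := \sum_l nsq (proj x k l).
Definition colsq x k : R := \sum_l nsq (proj x l k).
Definition normsq x : R := \sum_k rowsq x k.

Lemma normsq_col x : normsq x = \sum_k colsq x k.
Proof. exact: exchange_big. Qed.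

Lemma rowsq_ge0 x k : 0 <= rowsq x k.
Proof. by apply: sumr_ge0 => l _; exact: nsq_ge0. Qed.

Section OnOrbit.
Variable x : E.
Hypothesis hx : orbit x.
Local Notation P := (proj x).

Lemma proj_trace : \sum_k P k k = 1.
Proof.
have [u [w [Puw wu]]] := (orbitP x).1 hx.
by rewrite -/(\tr P) Puw mxtrace_mulC wu mxtrace_scalar mulr1n.
Qed.

Lemma proj_minor i j k l : P i j * P k l = P i l * P k j.
Proof.
have [u [w [-> wu]]] := (orbitP x).1 hx.
by rewrite !mxE !big_ord1; ring.
Qed.

(** The squared distance from an idempotent of trace one to its adjoint is
    [2 * normsq x - 2]. *)
Lemma normsq_ge1 : 1 <= normsq x.
Proof.
have e : \sum_k \sum_l nsq (P k l - conjc (P l k)) = 2 * normsq x - 2.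
  have e1 (a b : C) : nsq (a - conjc b) = nsq a + nsq b - 2 * Re (a * b).
    by case: a b => [a1 a2] [b1 b2]; rewrite /nsq /=; ring.
  under eq_bigr do under eq_bigr do rewrite e1.
  under eq_bigr do rewrite sumrB big_split /= -mulr_sumr.
  rewrite sumrB big_split /= -mulr_sumr -[X in X + _ - _]/(normsq x).
  rewrite -[X in _ + X - _]/(\sum_k colsq x k) -normsq_col.
  have -> : \sum_i \sum_j Re (P i j * P j i) = 1.
    rewrite -[RHS]/(Re (1 : C)) -proj_trace Re_sum; apply: eq_bigr => k _.
    by rewrite -[in RHS](orbit_idem hx) mxE Re_sum.
  ring.
have : 0 <= 2 * normsq x - 2.
  by rewrite -e; apply: sumr_ge0 => k _; apply: sumr_ge0 => l _; exact: nsq_ge0.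
lra.
Qed.

Lemma nsq_proj k m : nsq (P k m) * normsq x = rowsq x k * colsq x m.
Proof.
rewrite /rowsq mulr_suml /normsq exchange_big /= mulr_sumr.
apply: eq_bigr => l _; rewrite /colsq !mulr_sumr; apply: eq_bigr => i _.
by rewrite -!nsqM proj_minor.
Qed.

Variable h : 'I_n.+1 -> R.
Hypothesis h_sum : \sum_i h i = 0.
Variable G : E.
Hypothesis hG : is_gradient (f1 h) x G.

Lemma gradient_moment k :
  \sum_l Re (G k l * conjc (P k l)) = \sum_l Re (G l k * conjc (P l k)).
Proof.
have [mu /= [e1 e2 _ _]] := gradient_formula h_sum hx hG.
have a1 : (G *m adjmx P) k k = ((h k)%:C%C - mu) * conjc (P k k).
  by rewrite e2 mulmxBl mxBE diagH_mulmxE mul_scalar_mx mxZE adjmxE mulrBl.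
have a2 : (adjmx P *m G) k k = ((h k)%:C%C - mu) * conjc (P k k).
  rewrite e1 mulmxBr mxBE mulmx_diagHE mul_mx_scalar mxZE adjmxE.
  by rewrite mulrBl [conjc _ * _]mulrC.
rewrite -!Re_sum; apply: (congr1 (@complex.Re R)).
transitivity ((G *m adjmx P) k k).
  by rewrite mxE; apply: eq_bigr => l _; rewrite adjmxE.
rewrite a1 -a2 mxE; apply: eq_bigr => l _.
by rewrite adjmxE mulrC.
Qed.

Hypothesis h_im : \sum_k h k * Im (P k k) = 0.

Definition multiplier : R :=
  (\sum_k h k * (rowsq x k + colsq x k) - \sum_k h k * Re (P k k))
    / (2 * normsq x - 1).

Local Notation mu := multiplier.

Definition height : R := \sum_k h k * Re (P k k).

Lemma gradient_entries k l :
  (normsq x)%:C%C * G k l =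
    (\sum_i P k i * conjc (P l i)) * (h l - mu)%:C%C
    + (h k - mu)%:C%C * (\sum_i conjc (P i k) * P i l)
    - (height - mu)%:C%C * P k l.
Proof.
have [m /= [e1 e2 e3 e4]] := gradient_formula h_sum hx hG.
have PaP i j : (P *m adjmx P) i j = \sum_a P i a * conjc (P j a).
  by rewrite mxE; apply: eq_bigr => a _; rewrite adjmxE.
have aPP i j : (adjmx P *m P) i j = \sum_a conjc (P a i) * P a j.
  by rewrite mxE; apply: eq_bigr => a _; rewrite adjmxE.
have rowE a : (P *m adjmx P) a a = (rowsq x a)%:C%C.
  by rewrite PaP real_sum; apply: eq_bigr => b _; rewrite nsqE.
have colE a : (adjmx P *m P) a a = (colsq x a)%:C%C.
  by rewrite aPP real_sum; apply: eq_bigr => b _; rewrite nsqE mulrC.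
have KE : \tr ((diagH h - m%:M) *m adjmx P) = (height)%:C%C - m.
  rewrite mulmxBl mul_scalar_mx mxtraceB mxtraceZ mxtrace_adj /mxtrace proj_trace.
  rewrite conjc1 mulr1; congr (_ - _); rewrite -/(mxtrace _) mxtrace_diagH.
  have -> : \sum_k (h k)%:C%C * adjmx P k k = conjc (\sum_k (h k)%:C%C * P k k).
    by rewrite conjc_sum; apply: eq_bigr => a _; rewrite adjmxE conjcM conjc_real.
  apply: complex_ext; first by rewrite ReJ Re_sum /=; apply: eq_bigr => a _; rewrite Re_real.
  rewrite ImJ Im_sum -[RHS]/(0 : R) -[RHS]oppr0; congr (- _).
  by rewrite -[RHS]h_im; apply: eq_bigr => a _; rewrite Im_real.
have SE : \tr (adjmx P *m P) = (normsq x)%:C%C by rewrite mxtrace_adj_sq.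
have S0 : 2 * normsq x - 1 != 0.
  by apply/lt0r_neq0; move: normsq_ge1; lra.
have mE : m = mu%:C%C.
  have i1 : \tr (P *m adjmx P *m (diagH h - m%:M)) =
      \sum_k (h k)%:C%C * (P *m adjmx P) k k - m * (normsq x)%:C%C.
    rewrite mulmxBr mxtraceB mul_mx_scalar mxtraceZ mxtrace_mulC mxtrace_diagH.
    by rewrite [\tr (P *m _)]mxtrace_mulC SE.
  have i2 : \tr ((diagH h - m%:M) *m adjmx P *m P) =
      \sum_k (h k)%:C%C * (adjmx P *m P) k k - m * (normsq x)%:C%C.
    rewrite -mulmxA mulmxBl mxtraceB mul_scalar_mx mxtraceZ mxtrace_diagH.
    by rewrite SE.
  move: e4; rewrite KE i1 i2 => e4.
  have : m * (2 * normsq x - 1)%:C%C = (mu * (2 * normsq x - 1))%:C%C.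
    rewrite divfK// real_complexB real_complexM real_complex_nat.
    rewrite real_complexB.
    have -> : (\sum_k h k * (rowsq x k + colsq x k))%:C%C =
       \sum_k (h k)%:C%C * (P *m adjmx P) k k +
       \sum_k (h k)%:C%C * (adjmx P *m P) k k :> C.
      rewrite real_sum -big_split; apply: eq_bigr => a _ /=.
      by rewrite rowE colE real_complexM real_complexD mulrDr.
    have e5 : \sum_k (h k)%:C%C * (P *m adjmx P) k k +
       \sum_k (h k)%:C%C * (adjmx P *m P) k k =
       height%:C%C - m + 2 * (normsq x)%:C%C * m by rewrite -e4; ring.
    by rewrite e5 /height; ring.
  rewrite real_complexM; apply: mulIf.
  by rewrite real_complex_eq0.
have := congr1 (fun M : E => M k l) e3.
rewrite /= SE mxBE KE mE !mxZE => ->.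
rewrite -real_complexB; congr (_ - _).
rewrite mxE; congr (_ + _).
  rewrite mulmxBr mxBE mulmx_diagHE mul_mx_scalar mxZE PaP.
  by rewrite real_complexB mulrBr [mu%:C%C * _]mulrC.
rewrite -mulmxA mulmxBl mxBE diagH_mulmxE mul_scalar_mx mxZE aPP.
by rewrite real_complexB mulrBl.
Qed.

Lemma gradient_diag k : (normsq x)%:C%C * G k k =
  ((h k - mu) * (rowsq x k + colsq x k))%:C%C - (height - mu)%:C%C * P k k.
Proof.
rewrite gradient_entries; congr (_ - _).
rewrite real_complexM [X in _ = _ * X]real_complexD mulrDr; congr (_ + _).
  by rewrite mulrC real_sum; congr (_ * _); apply: eq_bigr => i _; rewrite nsqE.
rewrite real_sum; congr (_ * _); apply: eq_bigr => i _.
by rewrite nsqE mulrC.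
Qed.

End OnOrbit.
End Entries.

(** * Trajectories converging to a critical point *)

Section Model.
Variables (R : realType) (n : nat).
Local Notation C := R[i]%C.
Local Notation E := 'M[C]_n.+1.

(** The orbit points whose projector is [q q^* diag(eps)] for a vector [q] with
    [q^* diag(eps) q = 1], normalised by the phase that makes its [j]-th entry
    positive. *)
Definition model (eps : 'I_n.+1 -> R) (j : 'I_n.+1) : set E :=
  [set x | exists q : 'I_n.+1 -> C,
    [/\ \sum_k eps k * nsq (q k) = 1, 0 < Re (q j), Im (q j) = 0 &
        forall k l, proj x k l = q k * conjc (q l) * (eps l)%:C%C]].

Lemma proj_mxE (x : E) k l : proj x k l = n.+1%:R^-1 * (x k l + (k == l)%:R).
Proof. by rewrite !mxE. Qed.

Lemma real_invN : n.+1%:R^-1 = (n.+1%:R^-1 : R)%:C%C :> C.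
Proof. by rewrite real_complexV real_complex_nat. Qed.

End Model.

Section StableInModel.
Variables (R : realType) (n : nat).
Local Notation C := R[i]%C.
Local Notation E := 'M[C]_n.+1.
Local Notation orbit := (@orbit_H0 R n).
Variable h : 'I_n.+1 -> R.
Hypothesis h_sum : \sum_i h i = 0.

Section AlongCurve.
Variable gamma : R -> E.
Hypothesis hgamma : forall t : R, 0 <= t -> orbit (gamma t) /\
  exists2 G, is_gradient (f1 h) (gamma t) G &
    is_derive t 1 (realify \o gamma) (realify G).
Local Notation N := (n.+1%:R : R).

Lemma curve_orbit t : 0 <= t -> orbit (gamma t).
Proof. by move=> /hgamma[]. Qed.

Lemma proj_cderive (t : R) (G : E) k l : is_derive t 1 (realify \o gamma) (realify G) ->
  cderive (fun s => proj (gamma s) k l) t 1 (n.+1%:R^-1 * G k l).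
Proof.
move=> /realify_is_deriveP/(_ k l) d.
have -> : (fun s => proj (gamma s) k l) =
    fun s => n.+1%:R^-1 * (gamma s k l + (k == l)%:R).
  by apply/funext => s; rewrite proj_mxE.
apply: cderiveZ; apply: cderive_eq (cderiveD d (cderive_cst _ _ _)) _.
by rewrite addr0.
Qed.

Lemma is_derive_nsq (z : R -> C) (t : R) (d : C) : cderive z t 1 d ->
  is_derive t 1 (fun s => nsq (z s)) (2 * Re (d * conjc (z t))).
Proof.
move=> [d1 d2].
apply: is_derive_eq (is_deriveD (is_derive_mul d1 d1) (is_derive_mul d2 d2)) _.
by rewrite ReM ReJ ImJ; ring.
Qed.

(** The functions [rowsq - colsq], diagonal entries of the commutator of the
    projector with its adjoint, are the moment map of the diagonal torus; the
    height is invariant under the torus, so its gradient flow preserves them. *)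
Lemma moment_const k t : 0 <= t ->
  rowsq (gamma t) k - colsq (gamma t) k = rowsq (gamma 0) k - colsq (gamma 0) k.
Proof.
move=> t0; apply/esym.
apply: (@is_derive_0 R (fun t => rowsq (gamma t) k - colsq (gamma t) k) 0 t t0) => s /andP[s0 _].
have [hs [G hG dG]] := hgamma s0.
have dr : is_derive s 1 (fun s => rowsq (gamma s) k)
    (\sum_l 2 * (N^-1 * Re (G k l * conjc (proj (gamma s) k l)))).
  apply: is_derive_big => l; apply: is_derive_eq (is_derive_nsq (proj_cderive k l dG)) _.
  by rewrite -mulrA real_invN Re_real.
have dc : is_derive s 1 (fun s => colsq (gamma s) k)
    (\sum_l 2 * (N^-1 * Re (G l k * conjc (proj (gamma s) l k)))).
  apply: is_derive_big => l; apply: is_derive_eq (is_derive_nsq (proj_cderive l k dG)) _.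
  by rewrite -mulrA real_invN Re_real.
apply: is_derive_eq (is_deriveB dr dc) _.
by rewrite -!mulr_sumr (gradient_moment hs h_sum hG) subrr.
Qed.

Lemma height_im_const t : 0 <= t ->
  \sum_k h k * Im (proj (gamma t) k k) = \sum_k h k * Im (proj (gamma 0) k k).
Proof.
move=> t0; apply/esym.
apply: (@is_derive_0 R (fun t => \sum_k h k * Im (proj (gamma t) k k)) 0 t t0) => s /andP[s0 _].
have [hs [G hG dG]] := hgamma s0.
have d : is_derive s 1 (fun s => \sum_k h k * Im (proj (gamma s) k k))
    (\sum_k h k * (N^-1 * Im (G k k))).
  apply: is_derive_big => k; have [_ d] := proj_cderive k k dG.
  apply: is_derive_eq (is_derive_mul (is_derive_cst _ _ _) d) _.
  by rewrite mul0r add0r real_invN Im_real.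
apply: is_derive_eq d _.
have -> : \sum_k h k * (N^-1 * Im (G k k)) = N^-1 * Im (\sum_k (h k)%:C%C * G k k).
  rewrite Im_sum mulr_sumr; apply: eq_bigr => k _; rewrite Im_real; ring.
by rewrite (gradient_norm h_sum hs hG) mulr0.
Qed.

Variable j : 'I_n.+1.
Hypothesis gamma_lim : gamma t @[t --> +oo] --> crit_pt R j.

Lemma proj_lim k l :
  Re (proj (gamma t) k l) @[t --> +oo] --> (((k == j) && (l == j))%:R : R) /\
  Im (proj (gamma t) k l) @[t --> +oo] --> (0 : R).
Proof.
have [c1 c2] := (mx_cvgP gamma (crit_pt R j)).1 gamma_lim k l.
have e : proj (crit_pt R j : E) k l = ((k == j) && (l == j))%:R.
  by rewrite proj_crit_pt mxE.
have eR : ((k == j) && (l == j))%:R = Re (proj (crit_pt R j : E) k l).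
  by rewrite e; case: (_ && _).
have eI : 0 = Im (proj (crit_pt R j : E) k l) by rewrite e; case: (_ && _).
have r (x : E) : Re (proj x k l) = N^-1 * (Re (x k l) + (k == l)%:R).
  rewrite proj_mxE real_invN Re_real ReD; congr (_ * (_ + _)).
  by case: (k == l).
have i (x : E) : Im (proj x k l) = N^-1 * Im (x k l).
  rewrite proj_mxE real_invN Im_real ImD; congr (_ * _).
  by case: (k == l); rewrite addr0.
split.
  rewrite eR r; under eq_fun do rewrite r.
  by apply: cvgMr; apply: cvgD c1 _; exact: cvg_cst.
by rewrite eI i; under eq_fun do rewrite i; apply: cvgMr.
Qed.

Lemma nsq_lim k l :
  nsq (proj (gamma t) k l) @[t --> +oo] --> (((k == j) && (l == j))%:R : R).
Proof.
have [c1 c2] := proj_lim k l.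
rewrite (_ : _%:R = ((k == j) && (l == j))%:R * ((k == j) && (l == j))%:R
    + 0 * 0 :> R).
  by apply: cvgD; apply: cvgM.
by case: (_ && _); rewrite ?mulr1 !mulr0 ?addr0.
Qed.

Lemma sum_lim (F : 'I_n.+1 -> R -> R) (L : 'I_n.+1 -> R) :
  (forall k, F k t @[t --> +oo] --> L k) ->
  \sum_k F k t @[t --> +oo] --> \sum_k L k.
Proof.
move=> c; rewrite unlock; elim: (index_enum _) => [|i s ih] /=.
  exact: cvg_cst.
by apply: cvgD (c i) ih.
Qed.

Lemma sum_delta_and k : \sum_(l < n.+1) ((k == j) && (l == j))%:R = (k == j)%:R :> R.
Proof.
rewrite (bigD1 j)//= eqxx andbT big1 ?addr0// => l lj.
by rewrite (negbTE lj) andbF.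
Qed.

Lemma rowsq_lim k : rowsq (gamma t) k @[t --> +oo] --> ((k == j)%:R : R).
Proof. by rewrite -(sum_delta_and k); apply: sum_lim => l; exact: nsq_lim. Qed.

Lemma colsq_lim k : colsq (gamma t) k @[t --> +oo] --> ((k == j)%:R : R).
Proof.
rewrite -(sum_delta_and k); apply: sum_lim => l.
by rewrite andbC; exact: nsq_lim.
Qed.

Lemma normsq_lim : normsq (gamma t) @[t --> +oo] --> (1 : R).
Proof.
rewrite (_ : 1 = \sum_(k < n.+1) (k == j)%:R); first by apply: sum_lim => k; exact: rowsq_lim.
by rewrite (bigD1 j)//= eqxx big1 ?addr0// => k kj; rewrite (negbTE kj).
Qed.

Lemma sum_h_delta (c : R) : \sum_k h k * (c *+ (k == j)) = h j * c.
Proof.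
rewrite (bigD1 j)//= eqxx big1 ?addr0// => k kj.
by rewrite (negbTE kj) mulr0n mulr0.
Qed.

Lemma height_lim : height (gamma t) h @[t --> +oo] --> h j.
Proof.
rewrite -[h j]mulr1 -sum_h_delta; apply: sum_lim => k.
apply: cvgMr; have [c _] := proj_lim k k.
by rewrite andbb in c.
Qed.

Lemma multiplier_lim : multiplier (gamma t) h @[t --> +oo] --> h j.
Proof.
have d1 : 2 * 1 - 1 = 1 :> R by ring.
rewrite (_ : h j = (h j * 2 - h j) / (2 * 1 - 1)); last first.
  by rewrite d1 divr1; ring.
apply: cvgM; last first.
  apply: cvgV; first by rewrite d1 oner_neq0.
  by apply: cvgB; [apply: cvgMr; exact: normsq_lim|exact: cvg_cst].
apply: cvgB; last exact: height_lim.
rewrite -sum_h_delta; apply: sum_lim => k; apply: cvgMr.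
rewrite (_ : 2 *+ (k == j) = (k == j)%:R + (k == j)%:R :> R).
  by apply: cvgD; [exact: rowsq_lim|exact: colsq_lim].
by case: (k == j); rewrite ?mulr1n ?mulr0n ?addr0.
Qed.

Lemma cst_lim (c l : R) (f : R -> R) : (forall t, 0 <= t -> f t = c) ->
  f t @[t --> +oo] --> l -> c = l.
Proof.
move=> fc fl; have cc : f t @[t --> +oo] --> c.
  apply: cvg_near_cst; near=> t; apply: fc; near: t.
  exact: nbhs_pinfty_ge.
by move/cvg_lim: fl => <- //; move/cvg_lim: cc => ->.
Unshelve. all: by end_near. Qed.

Lemma rowsq_colsq t k : 0 <= t -> rowsq (gamma t) k = colsq (gamma t) k.
Proof.
move=> t0; apply/eqP; rewrite -subr_eq0 moment_const//; apply/eqP.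
apply: (@cst_lim _ _ (fun t => rowsq (gamma t) k - colsq (gamma t) k)).
  by move=> s s0; exact: moment_const.
rewrite -[0](subrr ((k == j)%:R : R)).
by apply: cvgB; [exact: rowsq_lim|exact: colsq_lim].
Qed.

Lemma height_im t : 0 <= t -> \sum_k h k * Im (proj (gamma t) k k) = 0.
Proof.
move=> t0; rewrite height_im_const//.
apply: (@cst_lim _ _ (fun t => \sum_k h k * Im (proj (gamma t) k k))).
  by move=> s s0; exact: height_im_const.
have c : \sum_k h k * Im (proj (gamma t) k k) @[t --> +oo] -->
    \sum_(k < n.+1) h k * 0.
  by apply: sum_lim => k; apply: cvgMr; have [] := proj_lim k k.
by rewrite big1 in c => // k _; rewrite mulr0.
Qed.

End AlongCurve.
End StableInModel.

Section Asymptotics.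
Variables (R : realType) (n : nat).
Local Notation C := R[i]%C.
Local Notation E := 'M[C]_n.+1.
Local Notation orbit := (@orbit_H0 R n).
Variable h : 'I_n.+1 -> R.
Hypothesis h_sum : \sum_i h i = 0.
Variable gamma : R -> E.
Hypothesis hgamma : forall t : R, 0 <= t -> orbit (gamma t) /\
  exists2 G, is_gradient (f1 h) (gamma t) G &
    is_derive t 1 (realify \o gamma) (realify G).
Variables (j : 'I_n.+1) (eps : 'I_n.+1 -> R).
Hypothesis gamma_lim : gamma t @[t --> +oo] --> crit_pt R j.
Hypothesis eps_sign : forall k, eps k = 1 \/ eps k = -1.
Hypothesis eps_h : forall k, k != j -> eps k * (h k - h j) < 0.
Hypothesis eps_j : eps j = 1.
Local Notation N := (n.+1%:R : R).

Implicit Types (t u : R) (k : 'I_n.+1).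

Let y k t : C := proj (gamma t) k k.
Let row k t : R := rowsq (gamma t) k.
Let S t : R := normsq (gamma t).
Let mu t : R := multiplier (gamma t) h.
Let b t : R := N^-1 * ((height (gamma t) h - mu t) / S t).
Let source k t : R := N^-1 * (2 * (h k - mu t) * row k t / S t).

Lemma S_ge1 t : 0 <= t -> 1 <= S t.
Proof. by move=> t0; apply: normsq_ge1; exact: (curve_orbit hgamma). Qed.

Lemma diag_ode k t : 0 <= t ->
  is_derive t 1 (fun s => Re (y k s)) (source k t - b t * Re (y k t)) /\
  is_derive t 1 (fun s => Im (y k s)) (- b t * Im (y k t)).
Proof.
move=> t0; have [ht [G hG dG]] := hgamma t0.
have S0 : S t != 0 by apply/lt0r_neq0; have := S_ge1 t0; lra.
have := gradient_diag ht h_sum hG (height_im h_sum hgamma gamma_lim t0) k.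
rewrite -(rowsq_colsq h_sum hgamma gamma_lim k t0).
rewrite -/(row k t) -/(mu t) -/(S t) -/(y k t) => e.
have eR : S t * Re (G k k) = (h k - mu t) * (row k t + row k t) -
    (height (gamma t) h - mu t) * Re (y k t).
  have := congr1 (@complex.Re R) e.
  by rewrite Re_real ReD raddfN /= -/(Re _) => ->; congr (_ - _); case: (y k t) => a c /=; ring.
have eI : S t * Im (G k k) = - (height (gamma t) h - mu t) * Im (y k t).
  have := congr1 (@complex.Im R) e.
  by rewrite Im_real ImD raddfN /= => ->; case: (y k t) => a c /=; ring.
have [d1 d2] := proj_cderive k k dG; rewrite real_invN in d1 d2.
split.
  apply: is_derive_eq d1 _; rewrite Re_real.
  have -> : Re (G k k) = (S t * Re (G k k)) / S t by rewrite mulrC mulKf.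
  by rewrite eR /source /b; field; rewrite S0 /= addrC natr1 pnatr_eq0.
apply: is_derive_eq d2 _; rewrite Im_real.
have -> : Im (G k k) = (S t * Im (G k k)) / S t by rewrite mulrC mulKf.
by rewrite eI /b; field; rewrite S0 /= addrC natr1 pnatr_eq0.
Qed.

Lemma row_sq k t : 0 <= t -> row k t ^+ 2 = nsq (y k t) * S t.
Proof.
move=> t0; rewrite /S nsq_proj; last exact: (curve_orbit hgamma).
by rewrite -(rowsq_colsq h_sum hgamma gamma_lim k t0) expr2.
Qed.

Lemma Re_sq_nsq (z : C) : Re z ^+ 2 <= nsq z.
Proof. by rewrite lerDl sqr_ge0. Qed.

Lemma Im_sq_nsq (z : C) : Im z ^+ 2 <= nsq z.
Proof. by rewrite lerDr sqr_ge0. Qed.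

Lemma row_ge0 k t : 0 <= row k t.
Proof. exact: rowsq_ge0. Qed.

Lemma row_lower k t (v : R) : 0 <= t -> S t <= 4 -> v ^+ 2 <= nsq (y k t) ->
  `|v| / 2 <= row k t / S t.
Proof.
move=> t0 S4 hv; have S1 := S_ge1 t0; have S0 : 0 < S t by lra.
rewrite ler_pdivlMr// -(@ler_pXn2r _ 2) ?nnegrE ?row_ge0//; last first.
  by rewrite mulr_ge0 ?divr_ge0//; lra.
rewrite row_sq// exprMn expr2 [S t ^+ 2]expr2 mulrA; apply: ler_wpM2r; first lra.
have e : `|v| / 2 * (`|v| / 2) = v ^+ 2 / 4 by rewrite -real_normK ?num_real//; field.
rewrite e; have := sqr_ge0 v; nra.
Qed.

Lemma abs_Re_row k t : 0 <= t -> `|Re (y k t)| <= row k t.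
Proof.
move=> t0; rewrite -(@ler_pXn2r _ 2) ?nnegrE ?row_ge0// real_normK ?num_real//.
rewrite row_sq//; have := Re_sq_nsq (y k t); have := S_ge1 t0.
by have := nsq_ge0 (y k t); nra.
Qed.

Let hm : R := \sum_k `|h k|.

Lemma h_le k : `|h k| <= hm.
Proof. by rewrite /hm (bigD1 k)//= lerDl sumr_ge0. Qed.

Lemma sum_h_row_le (F : 'I_n.+1 -> R) t : (forall k, `|F k| <= row k t) ->
  `|\sum_k h k * F k| <= hm * S t.
Proof.
move=> hF; apply: le_trans (ler_norm_sum _ _ _) _.
rewrite /S /normsq mulr_sumr; apply: ler_sum => k _; rewrite normrM.
by apply: ler_pM => //; exact: h_le.
Qed.

Lemma multiplier_bounds t : 0 <= t -> `|mu t| <= 3 * hm /\ `|b t| <= 4 * hm.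
Proof.
move=> t0; have S1 := S_ge1 t0.
have hm0 : 0 <= hm by apply: sumr_ge0.
have b1 : `|\sum_k h k * row k t| <= hm * S t.
  by apply: sum_h_row_le => k; rewrite ger0_norm ?row_ge0.
have b2 : `|height (gamma t) h| <= hm * S t.
  by apply: sum_h_row_le => k; exact: abs_Re_row.
have mE : mu t * (2 * S t - 1) = 2 * (\sum_k h k * row k t) - height (gamma t) h.
  rewrite /mu /multiplier -/(S t) divfK; last by apply/lt0r_neq0; lra.
  congr (_ - _); rewrite mulr_sumr; apply: eq_bigr => k _.
  by rewrite -(rowsq_colsq h_sum hgamma gamma_lim k t0) /row; ring.
have m3 : `|mu t| <= 3 * hm.
  have : `|mu t| * S t <= 3 * hm * S t.
    apply: (@le_trans _ _ `|mu t * (2 * S t - 1)|).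
      rewrite (normrM (mu t)) ler_wpM2l//; have := ler_norm (2 * S t - 1); lra.
    rewrite mE; apply: le_trans (ler_normB _ _) _.
    by rewrite normrM ger0_norm//; lra.
  by rewrite ler_pM2r//; lra.
split=> //; rewrite /b normrM ger0_norm ?invr_ge0//.
have N1 : N^-1 <= 1 by rewrite invf_le1 ?ltr0n// ler1n.
apply: le_trans (_ : 1 * `|(height (gamma t) h - mu t) / S t| <= _).
  by apply: ler_wpM2r.
rewrite mul1r normrM normfV (@ger0_norm _ (S t)); last lra.
rewrite ler_pdivrMr; last lra.
apply: le_trans (ler_normB _ _) _; nra.
Qed.

Lemma eventually_ge0 (P : R -> Prop) : (\forall t \near +oo, P t) ->
  exists2 T : R, 0 <= T & forall t, T <= t -> P t.
Proof.
move=> [M [_ hM]]; exists (Num.max 0 (M + 1)); first by rewrite le_max lexx.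
by move=> t; rewrite ge_max => /andP[_ Mt]; apply: hM; lra.
Qed.

Lemma b_lim : b t @[t --> +oo] --> (0 : R).
Proof.
have c1 : height (gamma t) h - mu t @[t --> +oo] --> h j - h j.
  by apply: cvgB; [exact: height_lim gamma_lim|exact: multiplier_lim gamma_lim].
have c2 : (S t)^-1 @[t --> +oo] --> (1^-1 : R).
  by apply: cvgV (normsq_lim gamma_lim); exact: oner_neq0.
have c3 : b t @[t --> +oo] --> N^-1 * ((h j - h j) * 1^-1).
  by apply: cvgMr; exact: cvgM c1 c2.
by rewrite subrr mul0r mulr0 in c3.
Qed.

(** Near the critical point the linearised flow dominates: for [k] different
    from [j] the real part of the [k]-th diagonal entry moves monotonically,
    in the direction opposite to [eps k], while its imaginary part varies at an
    arbitrarily slow exponential rate. *)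
Lemma eventually_contracting k : k != j -> exists2 c : R, 0 < c &
  exists2 T : R, 0 <= T & forall t, T <= t ->
  [/\ c <= - (eps k * (N^-1 * (2 * (h k - mu t)))), S t <= 4 & `|b t| <= c / 4].
Proof.
move=> kj; have N0 : 0 < N^-1 by rewrite invr_gt0 ltr0n.
pose c : R := - (eps k * (N^-1 * (h k - h j))).
have c0 : 0 < c.
  have := eps_h kj; rewrite /c mulrCA -mulrN => e; rewrite mulr_gt0//; lra.
exists c => //; apply: eventually_ge0.
have l1 : - (eps k * (N^-1 * (2 * (h k - mu t)))) @[t --> +oo] -->
    - (eps k * (N^-1 * (2 * (h k - h j)))).
  apply: cvgN; do 3 apply: cvgMr; apply: cvgB; first exact: cvg_cst.
  exact: multiplier_lim.
have e : - (eps k * (N^-1 * (2 * (h k - h j)))) = 2 * c by rewrite /c; ring.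
rewrite e in l1.
have g1 : c < 2 * c by lra.
have g2 : (1 : R) < 4 by lra.
have g3 : `|0 : R| < c / 4 by rewrite normr0 divr_gt0.
have n1 := cvgr_ge _ l1 _ g1; have n2 := cvgr_le _ (normsq_lim gamma_lim) _ g2.
have n3 := cvgr_norm_le _ b_lim _ g3.
near=> t; split; near: t; [exact: n1|exact: n2|exact: n3].
Unshelve. all: by end_near. Qed.

Lemma real_part_sign k : k != j -> exists2 T : R, 0 <= T &
  forall t, T <= t -> 0 <= eps k * Re (y k t).
Proof.
move=> kj; have [c c0 [T T0 hT]] := eventually_contracting kj.
exists T => // t1 Tt1; rewrite leNgt; apply/negP => neg.
have mono t : t1 <= t -> eps k * Re (y k t) <= eps k * Re (y k t1).
  move=> t1t; apply: (@is_derive_le0 R (fun t => eps k * Re (y k t))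
    (fun t => eps k * (source k t - b t * Re (y k t))) t1 t t1t) => s /andP[s1 s2].
    have s0 : 0 <= s by lra.
    apply: is_derive_eq (is_derive_mul (is_derive_cst _ _ _) (diag_ode k s0).1) _.
    by rewrite mul0r add0r.
  have s0 : 0 <= s by lra.
  have Ts : T <= s by lra.
  have [h1 h2 h3] := hT s Ts.
  have h4 := row_lower s0 h2 (Re_sq_nsq (y k s)).
  rewrite mulrBr /source.
  have -> : eps k * (N^-1 * (2 * (h k - mu s) * row k s / S s)) =
      - (- (eps k * (N^-1 * (2 * (h k - mu s)))) * (row k s / S s)) by ring.
  have h5 : c * (`|Re (y k s)| / 2) <=
      - (eps k * (N^-1 * (2 * (h k - mu s)))) * (row k s / S s).
    by apply: ler_pM; rewrite ?(ltW c0) ?divr_ge0.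
  have h6 : `|eps k * (b s * Re (y k s))| <= c / 4 * `|Re (y k s)|.
    rewrite (normrM (eps k)) (normrM (b s)); have -> : `|eps k| = 1.
      by case: (eps_sign k) => ->; rewrite ?normrN normr1.
    by rewrite mul1r ler_wpM2r.
  move: h6; rewrite ler_norml => /andP[h6 _].
  have h7 : 0 <= c * `|Re (y k s)| by rewrite mulr_ge0// ltW.
  move: (- (eps k * (N^-1 * (2 * (h k - mu s)))) * (row k s / S s))
    (eps k * (b s * Re (y k s))) `|Re (y k s)| h5 h6 h7 => A B D h5 h6 h7; lra.
have l : eps k * Re (y k t) @[t --> +oo] --> (0 : R).
  rewrite -(mulr0 (eps k)); apply: cvgMr.
  by have [] := proj_lim gamma_lim k k; rewrite (negbTE kj).
have [T' T'0 hT'] := eventually_ge0 (cvgr_gt _ l _ neg).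
have := hT' (Num.max T' t1); rewrite le_max lexx => /(_ isT).
by rewrite ltNge mono// le_max lexx orbT.
Qed.

Lemma imag_part_persist k s t : 0 <= s -> 0 <= t ->
  Im (y k s) = 0 -> Im (y k t) = 0.
Proof.
move=> s0 t0 ys; pose T := Num.max s t.
have := @gronwall_zero R (fun t => Im (y k t) ^+ 2)
  (fun t => 2 * Im (y k t) * (- b t * Im (y k t))) (2 * (4 * hm)) 0 T.
move=> /(_ _ _ _ s t) H; apply/eqP; rewrite -sqrf_eq0; apply/eqP; apply: H.
- move=> r /andP[r0 _]; have [_ d] := diag_ode k r0.
  by apply: is_derive_eq (is_derive_mul d d) _; ring.
- move=> r /andP[r0 _]; have [_ bb] := multiplier_bounds r0.
  have -> : 2 * Im (y k r) * (- b r * Im (y k r)) = - (2 * b r) * Im (y k r) ^+ 2 by ring.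
  rewrite (normrM (- (2 * b r))) (@ger0_norm _ (_ ^+ 2)) ?sqr_ge0// ler_wpM2r ?sqr_ge0//.
  by rewrite normrN (normrM 2) ger0_norm// ler_pM2l.
- by move=> r _; exact: sqr_ge0.
- by rewrite s0 /T le_max lexx.
- by rewrite t0 /T le_max lexx orbT.
- by rewrite ys expr0n.
Qed.

(** If the imaginary part did not vanish, the quotient of the real part by it
    would be driven to infinity at a linear rate, against the sign of the real
    part. *)
Lemma imag_part_offdiag k t : k != j -> 0 <= t -> Im (y k t) = 0.
Proof.
move=> kj t0; apply/eqP; apply: contraT => /eqP yt.
have [c c0 [T1 T10 hT1]] := eventually_contracting kj.
have [T2 T20 hT2] := real_part_sign kj.
pose T := Num.max T1 T2.
have T0 : 0 <= T by rewrite le_max T10.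
have yT : Im (y k T) != 0.
  by apply/eqP => /imag_part_persist; move=> /(_ t T0 t0) /yt.
pose s : R := Num.sg (Im (y k T)).
have wT : 0 < s * Im (y k T) by rewrite /s -normrEsg normr_gt0.
have dw r : T <= r -> is_derive r 1 (fun t => s * Im (y k t)) (- b r * (s * Im (y k r))).
  move=> Tr; have r0 := le_trans T0 Tr.
  apply: is_derive_eq (is_derive_mul (is_derive_cst _ _ _) (diag_ode k r0).2) _.
  by rewrite mul0r add0r mulrCA.
have w0 r : T <= r -> 0 < s * Im (y k r).
  move=> Tr; apply: (@sign_persist R (fun t => s * Im (y k t))
    (fun t => - b t * (s * Im (y k t))) (4 * hm) T r) wT.
  - by move=> u /andP[u1 u2]; exact: dw.
  - move=> u /andP[u1 u2]; rewrite (normrM (- b u)) normrN ler_wpM2r//.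
    exact: (multiplier_bounds (le_trans T0 u1)).2.
  - by rewrite lexx.
  - by rewrite Tr lexx.
have s2 : s ^+ 2 = 1 by rewrite /s sqr_sg yT.
have e2 : eps k ^+ 2 = 1 by case: (eps_sign k) => ->; rewrite ?sqrrN expr1n.
pose r t := eps k * Re (y k t) / (s * Im (y k t)).
pose dr t := - (- (eps k * (N^-1 * (2 * (h k - mu t)))) * (row k t / S t)
   / (s * Im (y k t))).
have drP u : T <= u -> is_derive u 1 r (dr u).
  move=> Tu; have u0 := le_trans T0 Tu.
  have w0u := w0 u Tu.
  have d1 : is_derive u 1 (fun t => eps k * Re (y k t))
      (eps k * (source k u - b u * Re (y k u))).
    apply: is_derive_eq (is_derive_mul (is_derive_cst _ _ _) (diag_ode k u0).1) _.
    by rewrite mul0r add0r.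
  have w1 : s * Im (y k u) != 0 by rewrite gt_eqF.
  apply: is_derive_eq (is_derive_div (g := fun t => s * Im (y k t)) w1 d1 (dw u Tu)) _.
  rewrite /dr /source.
  have S0 : S u != 0 by rewrite gt_eqF// (lt_le_trans ltr01 (S_ge1 u0)).
  move: (mu u) (row k u) (S u) (b u) (Re (y k u)) (s * Im (y k u)) w1 S0 => m rr SS bb yy w w1 S0.
  by field; rewrite w1 S0 /= addrC natr1 pnatr_eq0.
have drB u : T <= u -> dr u <= - (c / 2).
  move=> Tu; have u0 := le_trans T0 Tu.
  have T1u : T1 <= u by apply: le_trans Tu; rewrite le_max lexx.
  have [h1 h2 h3] := hT1 u T1u; have w0u := w0 u Tu.
  rewrite /dr lerN2 ler_pdivlMr//.
  have h4 : (s * Im (y k u)) / 2 <= row k u / S u.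
    apply: le_trans (row_lower u0 h2 (v := s * Im (y k u)) _).
      by rewrite ler_pM2r ?invr_gt0// ler_norm.
    by rewrite exprMn s2 mul1r; exact: Im_sq_nsq.
  rewrite mulrAC -mulrA; apply: ler_pM => //; first exact: ltW.
  by rewrite divr_ge0 ?(ltW w0u).
have r0 : 0 <= r T.
  rewrite /r divr_ge0 ?(ltW wT)// hT2// le_max lexx orbT //.
pose T' := T + 2 * (r T + 1) / c.
have TT' : T <= T'.
  by rewrite /T' lerDl divr_ge0 ?(ltW c0)// mulr_ge0// addr_ge0.
have [u hu e] : exists2 u, T <= u <= T' & r T' - r T = dr u * (T' - T).
  by apply: mvt_seg => // u /andP[Tu _]; exact: drP.
have r'0 : 0 <= r T'.
  rewrite /r divr_ge0 ?(ltW (w0 _ TT'))// hT2//.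
  by apply: le_trans TT'; rewrite le_max lexx orbT.
have dru : dr u <= - (c / 2) by apply: drB; case/andP: hu.
have cT : c / 2 * (T' - T) = r T + 1.
  rewrite /T' addrAC subrr add0r; move: (r T + 1) => q.
  by field; rewrite gt_eqF.
have : r T' - r T <= - (r T + 1).
  by rewrite e -cT -mulNr ler_wpM2r// subr_ge0.
move: (r T) (r T') r'0 => A B; lra.
Qed.

Lemma imag_part k t : 0 <= t -> Im (y k t) = 0.
Proof.
move=> t0; have [->|kj] := eqVneq k j; last exact: imag_part_offdiag.
have := proj_trace (curve_orbit hgamma t0) => /(congr1 (@complex.Im R)).
rewrite Im_sum (bigD1 j)//= big1 ?addr0// => i ij.
exact: imag_part_offdiag.
Qed.

Lemma source_bound k t : 0 <= t -> `|source k t - b t * Re (y k t)|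
  <= (12 * hm) * `|Re (y k t)|.
Proof.
move=> t0; have S1 := S_ge1 t0; have [m3 b4] := multiplier_bounds t0.
have hm0 : 0 <= hm by apply: sumr_ge0.
have rowE : row k t / S t <= `|Re (y k t)|.
  rewrite ler_pdivrMr; last lra.
  rewrite -(@ler_pXn2r _ 2) ?nnegrE ?row_ge0 ?mulr_ge0//; last lra.
  rewrite row_sq// exprMn real_normK ?num_real// /nsq imag_part// expr0n addr0.
  by have := sqr_ge0 (Re (y k t)); rewrite [S t ^+ 2]expr2; nra.
have row0 : 0 <= row k t / S t by rewrite divr_ge0 ?row_ge0//; lra.
apply: le_trans (ler_normB _ _) _.
have -> : 12 * hm * `|Re (y k t)| = 8 * hm * `|Re (y k t)| + 4 * hm * `|Re (y k t)| by ring.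
apply: lerD; last by rewrite (normrM (b t)) ler_wpM2r.
have -> : source k t = N^-1 * ((2 * (h k - mu t)) * (row k t / S t)).
  by rewrite /source; ring.
rewrite normrM ger0_norm ?invr_ge0//.
have N1 : N^-1 <= 1 by rewrite invf_le1 ?ltr0n// ler1n.
apply: le_trans (_ : 1 * `|2 * (h k - mu t) * (row k t / S t)| <= _).
  by apply: ler_wpM2r.
rewrite mul1r normrM (ger0_norm row0) normrM ger0_norm//.
apply: ler_pM => //.
have := ler_normB (h k) (mu t); have := h_le k; lra.
Qed.

Lemma diag_sign_persist k (s : R) : s = 1 \/ s = -1 -> forall t u, 0 <= t -> 0 <= u ->
  0 < s * Re (y k t) -> 0 < s * Re (y k u).
Proof.
move=> hs t u t0 u0; apply: (@sign_persist R (fun t => s * Re (y k t))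
  (fun t => s * (source k t - b t * Re (y k t))) (12 * hm) 0 (Num.max t u)).
- move=> r /andP[r0 _].
  apply: is_derive_eq (is_derive_mul (is_derive_cst _ _ _) (diag_ode k r0).1) _.
  by rewrite mul0r add0r.
- move=> r /andP[r0 _]; rewrite !normrM.
  have -> : `|s| = 1 by case: hs => ->; rewrite ?normrN normr1.
  by rewrite !mul1r; exact: source_bound.
- by rewrite t0 le_max lexx.
- by rewrite u0 le_max lexx orbT.
Qed.

Lemma diag_sign k : 0 <= eps k * Re (y k 0) /\ (k = j -> 0 < Re (y k 0)).
Proof.
have pj : 0 < Re (y j 0).
  have [l _] := proj_lim gamma_lim j j; rewrite eqxx /= in l.
  have [T T0 hT] := eventually_ge0 (cvgr_gt _ l _ ltr01).
  rewrite -[Re _]mul1r; apply: (@diag_sign_persist j 1 (or_introl erefl) T 0) => //.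
  by rewrite mul1r; exact: hT.
have [->|kj] := eqVneq k j; first by rewrite eps_j mul1r ltW.
split=> [|kj']; last by rewrite kj' eqxx in kj.
have [T T0 hT] := real_part_sign kj.
rewrite leNgt; apply/negP => neg.
have : 0 < - eps k * Re (y k T).
  apply: (@diag_sign_persist k (- eps k) _ 0 T) => //.
    by case: (eps_sign k) => ->; rewrite ?opprK; [right|left].
  by rewrite mulNr oppr_gt0.
by rewrite mulNr oppr_gt0 ltNge hT.
Qed.

End Asymptotics.

Section StableModel.
Variables (R : realType) (n : nat).
Local Notation C := R[i]%C.
Local Notation E := 'M[C]_n.+1.
Local Notation orbit := (@orbit_H0 R n).
Variables (j : 'I_n.+1) (eps : 'I_n.+1 -> R).
Hypothesis eps_sign : forall k, eps k = 1 \/ eps k = -1.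

Lemma eps_sq k : eps k * eps k = 1.
Proof. by case: (eps_sign k) => ->; ring. Qed.

(** For rank one, equality of the [k]-th rows and columns of [P P^*] and [P^* P]
    determines the moduli of the entries of [P], and the diagonal determines
    their phases. *)
Lemma moment_model (x : E) : orbit x ->
  (forall k, rowsq x k = colsq x k) ->
  (forall k, Im (proj x k k) = 0) ->
  (forall k, 0 <= eps k * Re (proj x k k)) -> 0 < Re (proj x j j) ->
  model eps j x.
Proof.
move=> hx hrc him hre hj; set P := proj x in him hre hj *.
have S0 : normsq x != 0 by apply/lt0r_neq0; have := normsq_ge1 hx; lra.
have nsq_sym k : nsq (P k j) = nsq (P j k).
  by apply: (mulIf S0); rewrite !nsq_proj// !hrc mulrC.
have real_diag k : P k k = (Re (P k k))%:C%C by apply: complex_ext => //=; exact: him.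
have prod k : P k j * P j k = (Re (P k k) * Re (P j j))%:C%C.
  by rewrite proj_minor// -/P (real_diag k) (real_diag j) real_complexM.
have nsq_kj k : nsq (P k j) = eps k * Re (P k k) * Re (P j j).
  apply: (@pexpIrn _ 2) => //; rewrite ?nnegrE ?nsq_ge0//.
    by rewrite mulr_ge0// ltW.
  rewrite expr2 {2}nsq_sym -nsqM prod nsq_real !exprMn.
  by have -> : eps k ^+ 2 = 1; [rewrite expr2 eps_sq|ring].
have Pjk k : P j k = (eps k)%:C%C * conjc (P k j).
  have [z|nz] := eqVneq (P k j) 0.
    rewrite z conjc0 mulr0; apply/eqP; rewrite -nsq_eq0 -nsq_sym z nsq_eq0.
    exact: eqxx.
  apply: (mulfI nz); rewrite prod mulrCA -nsqE nsq_kj -real_complexM.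
  by congr (_%:C%C); rewrite !mulrA eps_sq mul1r.
pose p := Num.sqrt (Re (P j j)).
have p0 : 0 < p by rewrite sqrtr_gt0.
have pp : p * p = Re (P j j) by rewrite -expr2 sqr_sqrtr// ltW.
have PP k l : P k l * P j j = P k j * P j l by rewrite proj_minor.
exists (fun k => P k j * (p^-1)%:C%C); split.
- have e : (\sum_k eps k * nsq (P k j * (p^-1)%:C%C)) = \sum_k Re (P k k).
    apply: eq_bigr => k _; rewrite nsqM nsq_real nsq_kj -pp.
    have := eps_sq k; move: (eps k) (Re (P k k)) => e r ee.
    rewrite -[RHS]mul1r -ee; field; by rewrite gt_eqF.
  by rewrite e -Re_sum proj_trace.
- by rewrite mulrC Re_real mulr_gt0// invr_gt0.
- by rewrite mulrC Im_real him mulr0.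
- move=> k l; rewrite -/P conjcM conjc_real.
  have j0 : (Re (P j j))%:C%C != 0 :> C by rewrite real_complex_eq0 gt_eqF.
  apply: (mulIf j0); rewrite -real_diag PP Pjk (real_diag j) -pp real_complexM.
  rewrite real_complexV; have p1 : p%:C%C != 0 :> C by rewrite real_complex_eq0 gt_eqF.
  by field.
Qed.

Lemma stable_in_model (h : 'I_n.+1 -> R) (x : E) :
  \sum_i h i = 0 -> (forall k, k != j -> eps k * (h k - h j) < 0) -> eps j = 1 ->
  stable h (crit_pt R j) x -> model eps j x.
Proof.
move=> h_sum eps_h eps_j [gamma [[e e0 hint] <- glim]].
have hgamma t : 0 <= t -> orbit (gamma t) /\
    exists2 G, is_gradient (f1 h) (gamma t) G &
      is_derive t 1 (realify \o gamma) (realify G).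
  by move=> t0; apply: hint => /=; lra.
apply: moment_model.
- by have [] := hgamma 0 (lexx 0).
- by move=> k; apply: (rowsq_colsq h_sum hgamma glim k (lexx 0)).
- by move=> k; apply: (imag_part h_sum hgamma glim eps_sign eps_h k (lexx 0)).
- by move=> k; have [] := diag_sign h_sum hgamma glim eps_sign eps_h eps_j k.
- by have [_ ->] := diag_sign h_sum hgamma glim eps_sign eps_h eps_j j.
Qed.

End StableModel.

(** * The gradient on the model *)

Section ModelGradient.
Variables (R : realType) (n : nat).
Local Notation C := R[i]%C.
Local Notation E := 'M[C]_n.+1.
Local Notation orbit := (@orbit_H0 R n).
Variable h : 'I_n.+1 -> R.
Hypothesis h_sum : \sum_i h i = 0.

Lemma gradient_uniq (x G G' : E) : orbit x ->
  is_gradient (f1 h) x G -> is_gradient (f1 h) x G' -> G = G'.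
Proof.
move=> hx hG hG'.
have tD : tangent_orbit x (G - G').
  rewrite -[- G']scaleN1r; apply: tangent_orbitD; first by case: hG.
  by apply: tangent_orbitZ; case: hG'.
have e : \tr (adjmx (G - G') *m (G - G')) = 0.
  rewrite adjmxB mulmxBl mxtraceB -(gradient_pairing h_sum hx hG tD).
  by rewrite -(gradient_pairing h_sum hx hG' tD) subrr.
by apply/eqP; rewrite -subr_eq0 (mxtrace_adj_eq0 e).
Qed.

Variable eps : 'I_n.+1 -> R.
Hypothesis eps_sign : forall k, eps k = 1 \/ eps k = -1.

Section AtPoint.
Variables (x : E) (q : 'I_n.+1 -> C).
Hypothesis q1 : \sum_k eps k * nsq (q k) = 1.
Hypothesis Pq : forall k l, proj x k l = q k * conjc (q l) * (eps l)%:C%C.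

Lemma model_orbit : orbit x.
Proof.
apply/orbitP; exists (\col_k q k), (\row_l (conjc (q l) * (eps l)%:C%C)); split.
  by apply/matrixP => k l; rewrite Pq !mxE big_ord1 !mxE mulrA.
apply/matrixP => a b; rewrite !ord1 !mxE eqxx /=.
rewrite (_ : 1%:R = (\sum_k eps k * nsq (q k))%:C%C :> C); last by rewrite q1.
rewrite real_sum; apply: eq_bigr => k _.
by rewrite !mxE real_complexM nsqE; ring.
Qed.

Local Notation s := (\sum_k nsq (q k)).

Lemma model_norm_ge1 : 1 <= s.
Proof.
rewrite -q1; apply: ler_sum => k _; have := nsq_ge0 (q k).
by case: (eps_sign k) => -> ?; lra.
Qed.

(** Along the model the gradient multiplies each entry of the projector by a
    real rate, a sum of a row rate and a column rate. *)
Lemma model_gradient (mu c : R) (Om : 'I_n.+1 -> R) :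
  (forall k, Om k = eps k * (h k - mu) - c) ->
  \sum_k eps k * Om k * nsq (q k) = 0 ->
  \sum_k Om k * nsq (q k) = c * s ->
  is_gradient (f1 h) x (\matrix_(k, l) (((Om k + Om l) / s)%:C%C * proj x k l)).
Proof.
move=> OmE Om0 Omc; have s1 := model_norm_ge1.
have s0 : s != 0 by rewrite gt_eqF// (lt_le_trans ltr01).
have ee k : eps k * eps k = 1 by exact: eps_sq.
apply/(gradientP h_sum _ model_orbit); set G := \matrix_(_, _) _.
have GE k l : G k l = ((Om k + Om l) / s)%:C%C * (q k * conjc (q l) * (eps l)%:C%C).
  by rewrite mxE Pq.
have GaE k l : adjmx G k l = ((Om k + Om l) / s)%:C%C * (q k * conjc (q l) * (eps k)%:C%C).
  rewrite adjmxE GE !conjcM conjcK !conjc_real addrC.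
  by congr (_ * _); rewrite [conjc (q l) * _]mulrC.
have rc (a b : R) (k l : 'I_n.+1) : a = b ->
  q k * conjc (q l) * (eps l)%:C%C * a%:C%C = b%:C%C * proj x k l.
  by move=> ->; rewrite Pq mulrC.
have PG k l : (proj x *m G) k l = (Om l / s)%:C%C * proj x k l.
  have F0 : \sum_i eps i * ((Om i + Om l) / s) * nsq (q i) = Om l / s.
    transitivity (((\sum_i eps i * Om i * nsq (q i)) +
        Om l * (\sum_i eps i * nsq (q i))) / s); last by rewrite Om0 q1 add0r mulr1.
    by rewrite mulr_sumr -big_split mulr_suml; apply: eq_bigr => i _ /=; ring.
  rewrite mxE -(rc _ _ k l F0) real_sum mulr_sumr; apply: eq_bigr => i _.
  by rewrite Pq GE !real_complexM nsqE; ring.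
have GP k l : (G *m proj x) k l = (Om k / s)%:C%C * proj x k l.
  have F0 : \sum_i eps i * ((Om k + Om i) / s) * nsq (q i) = Om k / s.
    transitivity (((\sum_i eps i * Om i * nsq (q i)) +
        Om k * (\sum_i eps i * nsq (q i))) / s); last by rewrite Om0 q1 add0r mulr1.
    by rewrite mulr_sumr -big_split mulr_suml; apply: eq_bigr => i _ /=; ring.
  rewrite mxE -(rc _ _ k l F0) real_sum mulr_sumr; apply: eq_bigr => i _.
  by rewrite Pq GE !real_complexM nsqE; ring.
have GaP k l : (adjmx G *m proj x) k l = (h k - mu)%:C%C * proj x k l.
  have F0 : eps k * \sum_i ((Om k + Om i) / s) * nsq (q i) = h k - mu.
    transitivity (eps k * (Om k * s + \sum_i Om i * nsq (q i)) / s).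
      rewrite [Om k * _]mulr_sumr -big_split /= !mulr_sumr mulr_suml.
      by apply: eq_bigr => i _ /=; ring.
    rewrite Omc -mulrDl mulrA mulfK// OmE subrK mulrA ee mul1r //.
  rewrite mxE -(rc _ _ k l F0) real_complexM real_sum !mulr_sumr.
  by apply: eq_bigr => i _; rewrite Pq GaE !real_complexM nsqE; ring.
have PGa k l : (proj x *m adjmx G) k l = (h l - mu)%:C%C * proj x k l.
  have F0 : eps l * \sum_i ((Om i + Om l) / s) * nsq (q i) = h l - mu.
    transitivity (eps l * (Om l * s + \sum_i Om i * nsq (q i)) / s).
      rewrite [Om l * _]mulr_sumr -big_split /= !mulr_sumr mulr_suml.
      by apply: eq_bigr => i _ /=; ring.
    rewrite Omc -mulrDl mulrA mulfK// OmE subrK mulrA ee mul1r //.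
  rewrite mxE -(rc _ _ k l F0) real_complexM real_sum !mulr_sumr.
  apply: eq_bigr => i _; rewrite Pq GaE !real_complexM nsqE.
  have eC : (eps i)%:C%C * (eps i)%:C%C = 1 :> C by rewrite -real_complexM ee.
  have eL : (eps l)%:C%C * (eps l)%:C%C = 1 :> C by rewrite -real_complexM ee.
  move: (eps i)%:C%C (eps l)%:C%C eC eL => a b ea eb.
  transitivity ((a * a) * (q k * conjc (q i) * (((Om i + Om l)%:C%C * (s^-1)%:C%C) *
    (q i * conjc (q l))))); first by ring.
  by rewrite ea -eb; ring.
split; apply/matrixP => k l.
  rewrite mxE PG GP -mulrDl -real_complexD -mulrDl GE -Pq.
  by rewrite [Om l + _]addrC.
rewrite mulmxBl mulmxBr !mxBE diagH_mulmxE mulmx_diagHE GaP PGa !real_complexB.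
by ring.
Qed.

(** The two linear equations for the multiplier and for the rate of the norm
    have this solution because [s >= 1]. *)
Lemma model_rates : exists (mu c : R) (Om : 'I_n.+1 -> R),
  [/\ forall k, Om k = eps k * (h k - mu) - c,
      \sum_k eps k * Om k * nsq (q k) = 0 &
      \sum_k Om k * nsq (q k) = c * s].
Proof.
have s1 := model_norm_ge1.
pose Hs := \sum_k h k * nsq (q k); pose He := \sum_k eps k * h k * nsq (q k).
pose mu := (2 * s * Hs - He) / (2 * s ^+ 2 - 1).
pose c := Hs - mu * s.
have d0 : 2 * s ^+ 2 - 1 != 0.
  by apply/lt0r_neq0; move: s s1 => r r1; nra.
have ee k : eps k * eps k = 1 by exact: eps_sq.
have emu : mu * (2 * s ^+ 2 - 1) = 2 * s * Hs - He by rewrite divfK.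
exists mu, c, (fun k => eps k * (h k - mu) - c); split=> //.
  transitivity (Hs - mu * s - c * (\sum_k eps k * nsq (q k))).
    rewrite /Hs !mulr_sumr -!sumrB; apply: eq_bigr => k _.
    have := ee k; move: (eps k) => e ek.
    transitivity ((e * e) * (h k - mu) * nsq (q k) - c * (e * nsq (q k))); first by ring.
    by rewrite ek; ring.
  by rewrite q1 mulr1 /c subrr.
transitivity (He - mu * (\sum_k eps k * nsq (q k)) - c * s).
  by rewrite /He !mulr_sumr -!sumrB; apply: eq_bigr => k _; ring.
rewrite q1 mulr1; apply/eqP; rewrite subr_eq -mulrDl -subr_eq0 /c.
apply/eqP; move: emu; move: s Hs He mu {c d0 s1} => r a b m emu.
have -> : b - m - (a - m * r + (a - m * r)) * r = m * (2 * r ^+ 2 - 1) - (2 * r * a - b).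
  by ring.
by rewrite emu subrr.
Qed.

End AtPoint.
End ModelGradient.

(** * Explicit trajectories in linearising coordinates *)

Section ExplicitCurve.
Variables (R : realType) (n : nat).
Local Notation C := R[i]%C.
Local Notation E := 'M[C]_n.+1.
Local Notation orbit := (@orbit_H0 R n).
Variable h : 'I_n.+1 -> R.
Hypothesis h_sum : \sum_i h i = 0.
Variables (j : 'I_n.+1) (eps : 'I_n.+1 -> R).
Hypothesis eps_sign : forall k, eps k = 1 \/ eps k = -1.
Hypothesis eps_j : eps j = 1.
Variable zeta : 'I_n.+1 -> C.
Hypothesis zeta_j : zeta j = 1.
Implicit Types (t u : R) (k l : 'I_n.+1).

(** In the coordinates [zeta k = q k / q j] (for [eps k = 1]) and
    [zeta k = |q|^2 q k (q j)^*] (for [eps k = -1]) the gradient flow becomes,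
    after the change of time by [|q|^2], the diagonal linear flow with the
    rates below. The remaining definitions invert these coordinates:
    [snorm] is [|q|^2], found from a quadratic equation for its square, and
    [qj] is the [j]-th entry of [q]. *)
Definition rate k : R := eps k * (h k - h j).
Definition flow_exp k t : R := expR (rate k * t).
Definition sumP t : R := \sum_(k | eps k == 1) nsq (zeta k) * flow_exp k t ^+ 2.
Definition sumN t : R := \sum_(k | eps k != 1) nsq (zeta k) * flow_exp k t ^+ 2.
Definition disc t : R := Num.sqrt (1 + 16 * (sumP t * sumN t)).
Definition snorm t : R := Num.sqrt ((1 + disc t) / 2).
Definition qj t : R := Num.sqrt ((snorm t + 1) / (2 * sumP t)).
Definition scale k t : R :=
  flow_exp k t * (if eps k == 1 then qj t else (snorm t * qj t)^-1).
Definition qflow t k : C := (scale k t)%:C%C * zeta k.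
Definition flow_proj t : E :=
  \matrix_(k, l) (qflow t k * conjc (qflow t l) * (eps l)%:C%C).
Definition flow t : E := n.+1%:R *: flow_proj t - 1%:M.

Lemma sumP_ge1 t : 1 <= sumP t.
Proof.
rewrite /sumP (bigD1 j) ?eps_j ?eqxx//= zeta_j /flow_exp /rate subrr mulr0 mul0r.
rewrite expR0 expr1n mulr1 nsq_real expr1n lerDl.
by apply: sumr_ge0 => k _; rewrite mulr_ge0 ?nsq_ge0 ?sqr_ge0.
Qed.

Lemma sumN_ge0 t : 0 <= sumN t.
Proof. by apply: sumr_ge0 => k _; rewrite mulr_ge0 ?nsq_ge0 ?sqr_ge0. Qed.

Lemma sumPN_ge0 t : 0 <= sumP t * sumN t.
Proof. by rewrite mulr_ge0 ?sumN_ge0 ?(le_trans ler01 (sumP_ge1 t)). Qed.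

Lemma disc_sq t : disc t ^+ 2 = 1 + 16 * (sumP t * sumN t).
Proof. by rewrite sqr_sqrtr//; have := sumPN_ge0 t; lra. Qed.

Lemma disc_ge1 t : 1 <= disc t.
Proof.
rewrite -[1]sqrtr1 ler_sqrt; last by have := sumPN_ge0 t; lra.
by have := sumPN_ge0 t; lra.
Qed.

Lemma snorm_sq t : snorm t ^+ 2 = (1 + disc t) / 2.
Proof. by rewrite sqr_sqrtr//; have := disc_ge1 t; lra. Qed.

Lemma snorm_ge1 t : 1 <= snorm t.
Proof.
rewrite -[1]sqrtr1 ler_sqrt; last by have := disc_ge1 t; lra.
by have := disc_ge1 t; lra.
Qed.

Lemma snorm_gt0 t : 0 < snorm t.
Proof. exact: lt_le_trans ltr01 (snorm_ge1 t). Qed.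

Lemma sumP_gt0 t : 0 < sumP t.
Proof. exact: lt_le_trans ltr01 (sumP_ge1 t). Qed.

Lemma snorm_eq t : snorm t ^+ 2 * (snorm t ^+ 2 - 1) = 4 * (sumP t * sumN t).
Proof.
rewrite snorm_sq; have := disc_sq t; move: (disc t) (sumP t * sumN t) => d m e.
have -> : m = (d ^+ 2 - 1) / 16 by rewrite e; field.
by field.
Qed.

Lemma qj_arg_gt0 t : 0 < (snorm t + 1) / (2 * sumP t).
Proof.
by rewrite divr_gt0// ?mulr_gt0 ?sumP_gt0// ltr_wpDl// ltW ?snorm_gt0.
Qed.

Lemma qj_gt0 t : 0 < qj t.
Proof. by rewrite sqrtr_gt0 qj_arg_gt0. Qed.

Lemma qj_sq t : qj t ^+ 2 = (snorm t + 1) / (2 * sumP t).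
Proof. by rewrite sqr_sqrtr// ltW// qj_arg_gt0. Qed.

Lemma flow_exp_gt0 k t : 0 < flow_exp k t.
Proof. exact: expR_gt0. Qed.

Lemma scale_gt0 k t : 0 < scale k t.
Proof.
rewrite mulr_gt0 ?flow_exp_gt0//; case: ifP => _; first exact: qj_gt0.
by rewrite invr_gt0 mulr_gt0 ?snorm_gt0 ?qj_gt0.
Qed.

Lemma nsq_qflow t k : nsq (qflow t k) = scale k t ^+ 2 * nsq (zeta k).
Proof. by rewrite nsqM nsq_real. Qed.

Lemma sum_qflowP t : \sum_(k | eps k == 1) nsq (qflow t k) = (snorm t + 1) / 2.
Proof.
transitivity (qj t ^+ 2 * sumP t).
  rewrite /sumP mulr_sumr; apply: eq_bigr => k ek.
  by rewrite nsq_qflow /scale ek; ring.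
rewrite qj_sq; have := sumP_gt0 t; move: (sumP t) (snorm t) => a s a0.
by field; rewrite gt_eqF.
Qed.

Lemma sum_qflowN t : \sum_(k | eps k != 1) nsq (qflow t k) = (snorm t - 1) / 2.
Proof.
have s0 := snorm_gt0 t; have q0 := qj_gt0 t; have a0 := sumP_gt0 t.
transitivity ((snorm t * qj t) ^- 2 * sumN t).
  rewrite /sumN mulr_sumr; apply: eq_bigr => k /negbTE ek.
  by rewrite nsq_qflow /scale ek -exprVn; ring.
rewrite exprMn qj_sq; have := snorm_eq t.
move: (snorm t) (sumP t) (sumN t) s0 a0 => s a b s0 a0 e {q0}.
have s1 : s + 1 != 0 by rewrite gt_eqF// addr_gt0.
have -> : b = s ^+ 2 * (s ^+ 2 - 1) / (4 * a) by rewrite e; field; rewrite gt_eqF.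
by field; rewrite s1 !gt_eqF.
Qed.

Lemma eps_neq1 k : eps k != 1 -> eps k = -1.
Proof. by case: (eps_sign k) => -> //; rewrite eqxx. Qed.

Lemma qflow_constraint t : \sum_k eps k * nsq (qflow t k) = 1.
Proof.
rewrite (bigID (fun k => eps k == 1)) /=.
rewrite (eq_bigr (fun k => nsq (qflow t k))); last first.
  by move=> k /eqP ->; rewrite mul1r.
rewrite [X in _ + X](eq_bigr (fun k => - nsq (qflow t k))); last first.
  by move=> k /eps_neq1 ->; rewrite mulN1r.
by rewrite sumrN sum_qflowP sum_qflowN; field.
Qed.

Lemma qflow_norm t : \sum_k nsq (qflow t k) = snorm t.
Proof.
by rewrite (bigID (fun k => eps k == 1)) /= sum_qflowP sum_qflowN; field.
Qed.

Lemma proj_flow t k l :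
  proj (flow t) k l = qflow t k * conjc (qflow t l) * (eps l)%:C%C.
Proof.
have -> : flow_proj t = proj (flow t) -> proj (flow t) k l = flow_proj t k l by move=> ->.
  by rewrite mxE.
by rewrite /proj /flow subrK scalerA mulVf ?pnatr_eq0// scale1r.
Qed.

Lemma scale_j t : scale j t = qj t.
Proof.
by rewrite /scale eps_j eqxx /flow_exp /rate subrr mulr0 mul0r expR0 mul1r.
Qed.

Lemma flow_model t : model eps j (flow t).
Proof.
exists (qflow t); split; [exact: qflow_constraint| | |exact: proj_flow].
  by rewrite /qflow zeta_j mulr1 /= scale_j qj_gt0.
by rewrite /qflow zeta_j mulr1.
Qed.

Lemma flow_orbit t : orbit (flow t).
Proof. exact: model_orbit (qflow_constraint t) (proj_flow t). Qed.

Lemma flow_exp_derive k t :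
  is_derive t 1 (flow_exp k) (rate k * flow_exp k t).
Proof. exact: is_derive_expM. Qed.

Lemma sum_exp_derive (Q : pred 'I_n.+1) t : exists d : R,
  is_derive t 1 (fun u => \sum_(k | Q k) nsq (zeta k) * flow_exp k u ^+ 2) d.
Proof.
pose d k := 2 * rate k * (nsq (zeta k) * flow_exp k t ^+ 2).
exists (\sum_(k | Q k) d k); apply: is_derive_big => k.
have e := flow_exp_derive k t.
apply: is_derive_eq (is_derive_scal (nsq (zeta k)) (is_derive_mul e e)) _.
by rewrite /d; ring.
Qed.

Lemma is_derive_sqrt (f : R -> R) t d : 0 < f t -> is_derive t 1 f d ->
  is_derive t 1 (fun u => Num.sqrt (f u)) ((2 * Num.sqrt (f t))^-1 * d).
Proof. by move=> f0 df; apply: is_derive1_comp => //; exact: is_derive1_sqrt. Qed.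

Lemma is_derive_add (f g : R -> R) t df dg :
  is_derive t 1 f df -> is_derive t 1 g dg ->
  is_derive t 1 (fun u => f u + g u) (df + dg).
Proof. exact: is_deriveD. Qed.

Lemma snorm_qj_derive t : exists ds dq : R,
  is_derive t 1 snorm ds /\ is_derive t 1 qj dq.
Proof.
have [dP hP] := sum_exp_derive (fun k => eps k == 1) t.
have [dN hN] := sum_exp_derive (fun k => eps k != 1) t.
have h1 : is_derive t 1 (fun u => 1 + 16 * (sumP u * sumN u)) _ :=
  is_derive_add (is_derive_cst (1 : R) t 1) (is_derive_scal 16 (is_derive_mul hP hN)).
have p1 : 0 < 1 + 16 * (sumP t * sumN t).
  by rewrite ltr_wpDr// mulr_ge0// sumPN_ge0.
have hd := is_derive_sqrt (f := fun u => 1 + 16 * (sumP u * sumN u)) p1 h1.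
have h2 : is_derive t 1 (fun u => (1 + disc u) / 2) _ :=
  is_derive_mul (is_derive_add (is_derive_cst (1 : R) t 1) hd) (is_derive_cst (2^-1 : R) t 1).
have p2 : 0 < (1 + disc t) / 2.
  by rewrite divr_gt0// ltr_wpDr// (le_trans ler01 (disc_ge1 t)).
have hs := is_derive_sqrt (f := fun u => (1 + disc u) / 2) p2 h2.
have p3 : 2 * sumP t != 0 by rewrite gt_eqF// mulr_gt0// sumP_gt0.
have h3 : is_derive t 1 (fun u => (snorm u + 1) / (2 * sumP u)) _ :=
  is_derive_div (f := fun u => snorm u + 1) (g := fun u => 2 * sumP u) p3
    (is_derive_add hs (is_derive_cst (1 : R) t 1)) (is_derive_scal 2 hP).
have hq := is_derive_sqrt (f := fun u => (snorm u + 1) / (2 * sumP u)) (qj_arg_gt0 t) h3.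
by do 2 eexists; split; [exact: hs|exact: hq].
Qed.

(** The logarithmic derivatives of the entries have the form that the gradient
    requires; the two side conditions are the derivatives of the identities
    [qflow_constraint] and [qflow_norm]. *)
Lemma flow_rates t : exists (mu c : R) (Om : 'I_n.+1 -> R),
  [/\ forall k, Om k = eps k * (h k - mu) - c,
      forall k, is_derive t 1 (scale k) (Om k * scale k t),
      \sum_k eps k * Om k * nsq (qflow t k) = 0 &
      \sum_k Om k * nsq (qflow t k) = c * \sum_k nsq (qflow t k)].
Proof.
have [ds [dq [hs hq]]] := snorm_qj_derive t.
have s0 : snorm t != 0 by rewrite gt_eqF// snorm_gt0.
have q0 : qj t != 0 by rewrite gt_eqF// qj_gt0.
pose o := dq / qj t; pose l := ds / snorm t.
pose Om k := eps k * (h k - (h j - o - l / 2)) - l / 2.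
have dsc k : is_derive t 1 (scale k) (Om k * scale k t).
  rewrite /scale; have [ek|ek] := boolP (eps k == 1).
    apply: is_derive_eq (is_derive_mul (flow_exp_derive k t) hq) _.
    by rewrite /Om /rate (eqP ek) /o; field.
  have sq0 : snorm t * qj t != 0 by rewrite mulf_neq0.
  apply: is_derive_eq (is_derive_mul (flow_exp_derive k t)
    (is_derive_inv (f := fun u => snorm u * qj u) sq0 (is_derive_mul hs hq))) _.
  rewrite /Om /rate (eps_neq1 ek) /o /l; move: (snorm t) (qj t) s0 q0 {sq0 hs hq} => s q s0 q0.
  by field; rewrite s0 q0.
have dn k : is_derive t 1 (fun u => nsq (qflow u k)) (2 * (Om k * nsq (qflow t k))).
  have -> : (fun u => nsq (qflow u k)) =
      fun u => nsq (zeta k) * (scale k u * scale k u).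
    by apply/funext => u; rewrite nsq_qflow; ring.
  apply: is_derive_eq (is_derive_scal (nsq (zeta k)) (is_derive_mul (dsc k) (dsc k))) _.
  by rewrite nsq_qflow; ring.
exists (h j - o - l / 2), (l / 2), Om; split=> //.
  have d1 : is_derive t 1 (fun u => \sum_k eps k * nsq (qflow u k))
      (\sum_k eps k * (2 * (Om k * nsq (qflow t k)))).
    by apply: is_derive_big => k; exact: is_derive_scal (dn k).
  have e : (fun u => \sum_k eps k * nsq (qflow u k)) = cst 1.
    by apply/funext => u; exact: qflow_constraint.
  rewrite e in d1; have [_ d1e] := d1; rewrite derive_cst in d1e.
  have e2 : 2 * (\sum_k eps k * Om k * nsq (qflow t k)) = 0.
    by rewrite [RHS]d1e mulr_sumr; apply: eq_bigr => k _; ring.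
  by move/eqP: e2; rewrite mulf_eq0 pnatr_eq0 /= => /eqP.
have d1 : is_derive t 1 (fun u => \sum_k nsq (qflow u k))
    (\sum_k 2 * (Om k * nsq (qflow t k))) by exact: is_derive_big.
have e : (fun u => \sum_k nsq (qflow u k)) = snorm.
  by apply/funext => u; exact: qflow_norm.
rewrite e in d1; have [_ d1e] := d1; have [_ d2e] := hs.
rewrite d2e -mulr_sumr in d1e.
by rewrite qflow_norm /l d1e; field.
Qed.

Lemma flow_gradient t : exists2 G, is_gradient (f1 h) (flow t) G &
  is_derive t 1 (realify \o flow) (realify ((n.+1%:R * snorm t)%:C%C *: G)).
Proof.
have [mu [c [Om [OmE dsc Om0 Omc]]]] := flow_rates t.
exists (\matrix_(k, l) (((Om k + Om l) / \sum_k nsq (qflow t k))%:C%C * proj (flow t) k l)).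
  exact: (model_gradient h_sum eps_sign (qflow_constraint t) (proj_flow t) OmE Om0 Omc).
apply/realify_is_deriveP => k l.
have dq m : cderive (fun u => qflow u m) t 1 ((Om m)%:C%C * qflow t m).
  apply: cderive_eq (cderiveM (cderive_real (dsc m)) (cderive_cst _ _ _)) _.
  by rewrite mulr0 addr0 real_complexM mulrA.
have -> : (fun u => flow u k l) = fun u =>
    n.+1%:R * (qflow u k * conjc (qflow u l) * (eps l)%:C%C) + - (k == l)%:R.
  by apply/funext => u; rewrite !mxE.
apply: cderive_eq (cderiveD (cderiveZ _ (cderiveM (cderiveM (dq k) (cderiveJ (dq l)))
  (cderive_cst _ _ _))) (cderive_cst _ _ _)) _.
rewrite mxZE [X in _ = _ * X]mxE proj_flow qflow_norm.
rewrite !real_complexM real_complex_nat real_complexV real_complexD (conjcM (Om l)%:C%C)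
  (conjc_real (Om l)).
by field; rewrite real_complex_eq0 gt_eqF// snorm_gt0.
Qed.

End ExplicitCurve.

Section Coordinates.
Variables (R : realType) (n : nat).
Local Notation C := R[i]%C.
Local Notation E := 'M[C]_n.+1.
Variables (j : 'I_n.+1) (eps : 'I_n.+1 -> R).
Hypothesis eps_sign : forall k, eps k = 1 \/ eps k = -1.
Hypothesis eps_j : eps j = 1.

(** The linearising coordinates, read off from the projector: on the model the
    weighted trace is the squared norm of the vector [q]. *)
Definition lincoord (x : E) k : C :=
  if eps k == 1 then proj x k j / proj x j j
  else (\sum_i (eps i)%:C%C * proj x i i) * proj x k j.

Section OnModel.
Variables (x : E) (q : 'I_n.+1 -> C).
Hypothesis q1 : \sum_k eps k * nsq (q k) = 1.
Hypothesis qj_pos : 0 < Re (q j).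
Hypothesis qj_real : Im (q j) = 0.
Hypothesis Pq : forall k l, proj x k l = q k * conjc (q l) * (eps l)%:C%C.
Local Notation s := (\sum_k nsq (q k)).

Lemma q_jE : q j = (Re (q j))%:C%C.
Proof. exact: complex_ext. Qed.

Lemma model_col k : proj x k j = q k * (Re (q j))%:C%C.
Proof. by rewrite Pq eps_j mulr1 {1}q_jE conjc_real. Qed.

Lemma model_diag_j : proj x j j = (Re (q j) ^+ 2)%:C%C.
Proof. by rewrite model_col {1}q_jE -real_complexM expr2. Qed.

Lemma model_wtrace : \sum_i (eps i)%:C%C * proj x i i = s%:C%C.
Proof.
rewrite real_sum; apply: eq_bigr => i _; rewrite Pq mulrCA -real_complexM.
by rewrite eps_sq// mulr1 nsqE.
Qed.

Lemma lincoord_j : lincoord x j = 1.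
Proof.
rewrite /lincoord eps_j eqxx divff// model_diag_j real_complex_eq0.
by rewrite sqrf_eq0 gt_eqF.
Qed.

Lemma lincoordE k : lincoord x k =
  if eps k == 1 then q k / (Re (q j))%:C%C else s%:C%C * (Re (q j))%:C%C * q k.
Proof.
rewrite /lincoord; case: ifP => _.
  rewrite model_diag_j model_col expr2 real_complexM.
  by field; rewrite real_complex_eq0 gt_eqF.
by rewrite model_wtrace model_col; ring.
Qed.

Lemma sum_posneg : \sum_(k | eps k == 1) nsq (q k) = (s + 1) / 2 /\
  \sum_(k | eps k != 1) nsq (q k) = (s - 1) / 2.
Proof.
move: q1; rewrite (bigID (fun k => eps k == 1)) /=.
rewrite (eq_bigr (fun k => nsq (q k))); last by move=> k /eqP ->; rewrite mul1r.
rewrite [X in _ + X](eq_bigr (fun k => - nsq (q k))); last first.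
  by move=> k /(eps_neq1 eps_sign) ->; rewrite mulN1r.
rewrite [X in (X + 1) / 2](bigID (fun k => eps k == 1)) /=.
rewrite [X in (X - 1) / 2](bigID (fun k => eps k == 1)) /= sumrN.
by move: (\sum_(_ | eps _ == 1) _) (\sum_(_ | _ != 1) _) => a b e; lra.
Qed.

Lemma flow_lincoord h : flow h j eps (lincoord x) 0 = x.
Proof.
have s1 : 1 <= s := model_norm_ge1 eps_sign q1.
have s0 : 0 < s := lt_le_trans ltr01 s1.
have [eP eN] := sum_posneg.
have qj0 := qj_pos; set r := Re (q j) in qj0; have r0 : r != 0 by rewrite gt_eqF.
have fe k : flow_exp h j eps k 0 = 1 by rewrite /flow_exp mulr0 expR0.
have hP : sumP h j eps (lincoord x) 0 = (s + 1) / (2 * r ^+ 2).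
  rewrite /sumP; transitivity ((\sum_(k | eps k == 1) nsq (q k)) / r ^+ 2).
    rewrite mulr_suml; apply: eq_bigr => k ek.
    rewrite fe expr1n mulr1 lincoordE ek nsqM -/r -real_complexV nsq_real exprVn //.
  by rewrite eP; field.
have hN : sumN h j eps (lincoord x) 0 = s ^+ 2 * r ^+ 2 * ((s - 1) / 2).
  rewrite /sumN -eN mulr_sumr; apply: eq_bigr => k /negbTE ek.
  by rewrite fe expr1n mulr1 lincoordE ek -/r -real_complexM nsqM nsq_real exprMn.
have hd : disc h j eps (lincoord x) 0 = 2 * s ^+ 2 - 1.
  rewrite /disc hP hN.
  have -> : 1 + 16 * ((s + 1) / (2 * r ^+ 2) * (s ^+ 2 * r ^+ 2 * ((s - 1) / 2))) =
     (2 * s ^+ 2 - 1) ^+ 2 by move: s {eP eN hP hN s0 s1} => S; field.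
  rewrite sqrtr_sqr ger0_norm//; move: s s1 {eP eN hP hN s0} => S S1; nra.
have hs : snorm h j eps (lincoord x) 0 = s.
  rewrite /snorm hd (_ : (1 + (2 * s ^+ 2 - 1)) / 2 = s ^+ 2); last by field.
  by rewrite sqrtr_sqr ger0_norm// ltW.
have hq : qj h j eps (lincoord x) 0 = r.
  rewrite /qj hs hP.
  have -> : (s + 1) / (2 * ((s + 1) / (2 * r ^+ 2))) = r ^+ 2.
    have : s + 1 != 0 by rewrite gt_eqF// addr_gt0.
    by move: s => S S1; field; rewrite ?S1 ?r0.
  by rewrite sqrtr_sqr ger0_norm// ltW.
have hqk k : qflow h j eps (lincoord x) 0 k = q k.
  rewrite /qflow /scale fe mul1r hq hs lincoordE -/r; case: ifP => _.
    by rewrite mulrC divfK// real_complex_eq0.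
  rewrite real_complexV real_complexM mulrA mulVf ?mul1r//.
  by rewrite mulf_neq0// real_complex_eq0// gt_eqF.
apply: proj_inj; apply/matrixP => k l.
by rewrite (proj_flow h j eps (lincoord x)) !hqk Pq.
Qed.

End OnModel.

Lemma lincoord_flow h (zeta : 'I_n.+1 -> C) t k : zeta j = 1 ->
  lincoord (flow h j eps zeta t) k = (flow_exp h j eps k t)%:C%C * zeta k.
Proof.
move=> zj; have q1 := qflow_constraint h eps_sign eps_j zj t.
have Pq := proj_flow h j eps zeta t.
have qjE : qflow h j eps zeta t j = (qj h j eps zeta t)%:C%C.
  by rewrite /qflow zj mulr1 scale_j.
have qj0 := qj_gt0 h eps_j zj t.
have s0 := snorm_gt0 h eps_j zj t.
have p1 : 0 < Re (qflow h j eps zeta t j) by rewrite qjE.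
have p2 : Im (qflow h j eps zeta t j) = 0 by rewrite qjE.
rewrite (lincoordE p1 p2 Pq) (qflow_norm h eps_j zj) qjE /= /qflow /scale.
have q0 : (qj h j eps zeta t)%:C%C != 0 :> C by rewrite real_complex_eq0 gt_eqF.
have ss0 : (snorm h j eps zeta t)%:C%C != 0 :> C by rewrite real_complex_eq0 gt_eqF.
case: (eps k == 1); rewrite !real_complexM ?real_complexV ?real_complexM.
  by field.
by field; rewrite q0.
Qed.

Lemma lincoord_inj x y : model eps j x -> model eps j y ->
  lincoord x =1 lincoord y -> x = y.
Proof.
move=> [q [q1 q2 q3 q4]] [q' [q'1 q'2 q'3 q'4]] /funext e.
rewrite -(flow_lincoord q1 q2 q3 q4 (fun _ => 0)).
by rewrite e (flow_lincoord q'1 q'2 q'3 q'4).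
Qed.

End Coordinates.

Section FlowLimit.
Variables (R : realType) (n : nat).
Local Notation C := R[i]%C.
Local Notation E := 'M[C]_n.+1.
Variable h : 'I_n.+1 -> R.
Hypothesis h_sum : \sum_i h i = 0.
Variables (j : 'I_n.+1) (eps : 'I_n.+1 -> R).
Hypothesis eps_sign : forall k, eps k = 1 \/ eps k = -1.
Hypothesis eps_h : forall k, k != j -> eps k * (h k - h j) < 0.
Hypothesis eps_j : eps j = 1.
Variable zeta : 'I_n.+1 -> C.
Hypothesis zeta_j : zeta j = 1.
Local Notation "x ~> l" := (x @ (+oo : set_system R) --> (l : R)) (at level 70).

Lemma cvg_big_add (I : finType) (Q : pred I) (F : I -> R -> R) (L : I -> R) :
  (forall k, Q k -> F k ~> L k) ->
  (fun t => \sum_(k | Q k) F k t) ~> (\sum_(k | Q k) L k).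
Proof.
move=> c; rewrite unlock; elim: (index_enum _) => [|i s ih] /=.
  exact: cvg_cst.
by case: ifP => // Qi; apply: cvgD (c i Qi) ih.
Qed.

Lemma exp_lim0 (r : R) : r < 0 -> (fun t => expR (r * t)) ~> 0.
Proof.
move=> r0; apply/cvgrPdist_le => e e0.
near=> t.
rewrite sub0r normrN ger0_norm ?expR_ge0//.
have t1 : (e^-1) / (- r) <= t by near: t; apply: nbhs_pinfty_ge; exact: num_real.
have rt : e^-1 <= - r * t by move: t1; rewrite ler_pdivrMr ?oppr_gt0// mulrC.
rewrite -[r * t]opprK expRN -mulNr -[leRHS]invrK lef_pV2 ?posrE ?expR_gt0 ?invr_gt0//.
by apply: le_trans rt _; apply: le_trans (expR_ge1Dx _); rewrite lerDr.
Unshelve. all: by end_near. Qed.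

Lemma flow_exp_lim k : k != j -> flow_exp h j eps k ~> 0.
Proof. by move=> kj; exact: (exp_lim0 (eps_h kj)). Qed.

Lemma flow_exp_j t : flow_exp h j eps j t = 1.
Proof. by rewrite /flow_exp /rate subrr mulr0 mul0r expR0. Qed.

Lemma weighted_exp_lim k :
  (fun t => nsq (zeta k) * flow_exp h j eps k t ^+ 2) ~> (k == j)%:R.
Proof.
have [->|kj] := eqVneq k j.
  under eq_fun do rewrite flow_exp_j zeta_j nsq_real !expr1n mulr1.
  exact: cvg_cst.
rewrite (_ : false%:R = nsq (zeta k) * (0 * 0)); last by rewrite !mulr0.
under eq_fun do rewrite expr2.
by apply: cvgM; [exact: cvg_cst|apply: cvgM; exact: flow_exp_lim].
Qed.

Lemma sumP_lim : sumP h j eps zeta ~> 1.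
Proof.
have c := cvg_big_add (Q := fun k => eps k == 1) (fun k _ => @weighted_exp_lim k).
have e : \sum_(k | eps k == 1) (k == j)%:R = 1 :> R.
  rewrite (bigD1 j) ?eps_j ?eqxx//= big1 ?addr0// => k /andP[_ /negbTE ->] //.
by rewrite e in c.
Qed.

Lemma sumN_lim : sumN h j eps zeta ~> 0.
Proof.
have c := cvg_big_add (Q := fun k => eps k != 1) (fun k _ => @weighted_exp_lim k).
have e : \sum_(k | eps k != 1) (k == j)%:R = 0 :> R.
  by rewrite big1// => k; case: (eqVneq k j) => // ->; rewrite eps_j eqxx.
by rewrite e in c.
Qed.

Lemma sqrt_lim (f : R -> R) (l : R) : f ~> l ->
  (fun t => Num.sqrt (f t)) ~> Num.sqrt l.
Proof. by apply: continuous_cvg; exact: sqrt_continuous. Qed.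

Lemma snorm_lim : snorm h j eps zeta ~> 1.
Proof.
have c1 : disc h j eps zeta ~> Num.sqrt (1 + 16 * (1 * 0)).
  apply: sqrt_lim; apply: cvgD; first exact: cvg_cst.
  apply: cvgM; first exact: cvg_cst.
  by apply: cvgM; [exact: sumP_lim|exact: sumN_lim].
rewrite !mulr0 addr0 sqrtr1 in c1.
have c2 : snorm h j eps zeta ~> Num.sqrt ((1 + 1) / 2).
  apply: sqrt_lim; apply: cvgM; last exact: cvg_cst.
  by apply: cvgD; first exact: cvg_cst.
by rewrite divff ?pnatr_eq0// sqrtr1 in c2.
Qed.

Lemma qj_lim : qj h j eps zeta ~> 1.
Proof.
have c : qj h j eps zeta ~> Num.sqrt ((1 + 1) / (2 * 1)).
  apply: sqrt_lim; apply: cvgM.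
    by apply: cvgD; [exact: snorm_lim|exact: cvg_cst].
  apply: cvgV; first by rewrite mulr1 pnatr_eq0.
  by apply: cvgM; [exact: cvg_cst|exact: sumP_lim].
by rewrite mulr1 divff ?pnatr_eq0// sqrtr1 in c.
Qed.

Lemma scale_lim k : scale h j eps zeta k ~> (k == j)%:R.
Proof.
have [->|kj] := eqVneq k j.
  have -> : scale h j eps zeta j = qj h j eps zeta.
    by apply/funext => t; exact: scale_j.
  exact: qj_lim.
have c (f : R -> R) : f ~> 1 -> (fun t => flow_exp h j eps k t * f t) ~> 0.
  move=> cf; have c0 : (fun t => flow_exp h j eps k t * f t) ~> (0 * 1).
    by apply: cvgM cf; exact: flow_exp_lim.
  by rewrite mul0r in c0.
rewrite /scale; case: (eps k == 1); apply: c; first exact: qj_lim.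
have c2 : (fun t => (snorm h j eps zeta t * qj h j eps zeta t)^-1) ~> (1 * 1)^-1.
  apply: cvgV; first by rewrite mulr1 oner_neq0.
  by apply: cvgM; [exact: snorm_lim|exact: qj_lim].
by rewrite mulr1 invr1 in c2.
Qed.

Lemma flow_entry t k l : flow h j eps zeta t k l =
  (scale h j eps zeta k t * scale h j eps zeta l t)%:C%C *
    (n.+1%:R * (zeta k * conjc (zeta l) * (eps l)%:C%C)) + - (k == l)%:R.
Proof.
rewrite !mxE /qflow conjcM conjc_real real_complexM; congr (_ - _); ring.
Qed.

Lemma flow_lim : flow h j eps zeta t @[t --> +oo] --> crit_pt R j.
Proof.
apply/mx_cvgP => k l.
pose c : C := n.+1%:R * (zeta k * conjc (zeta l) * (eps l)%:C%C).
pose d : C := - (k == l)%:R.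
have cs : (fun t => scale h j eps zeta k t * scale h j eps zeta l t) ~>
    ((k == j)%:R * (l == j)%:R).
  by apply: cvgM; exact: scale_lim.
have e : crit_pt R j k l = ((k == j)%:R * (l == j)%:R : R)%:C%C * c + d.
  rewrite (projK (crit_pt R j)) proj_crit_pt !mxE -/d; congr (_ + _).
  have [kj|_] := eqVneq k j; last by rewrite /= !(mulr0n, mul0r, mulr0).
  have [lj|_] := eqVneq l j; last by rewrite /= !(mulr0n, mul0r, mulr0).
  by rewrite /c kj lj zeta_j eps_j conjc1 /= !mulr1 mul1r.
rewrite e; split.
  under eq_fun do rewrite flow_entry -/c -/d ReD Re_real.
  rewrite ReD Re_real; apply: cvgD; last exact: cvg_cst.
  by apply: cvgM; [exact: cs|exact: cvg_cst].
under eq_fun do rewrite flow_entry -/c -/d ImD Im_real.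
rewrite ImD Im_real; apply: cvgD; last exact: cvg_cst.
by apply: cvgM; [exact: cs|exact: cvg_cst].
Qed.

Lemma snorm_continuous : continuous (snorm h j eps zeta).
Proof.
move=> t; have [ds [dq [[d _] _]]] := snorm_qj_derive h eps_j zeta_j t.
by apply: differentiable_continuous; exact/derivable1_diffP.
Qed.

Lemma flow_stable : stable h (crit_pt R j) (flow h j eps zeta 0).
Proof.
pose f t : R := n.+1%:R * snorm h j eps zeta t.
have N1 : 1 <= n.+1%:R :> R by rewrite ler1n.
have f1 t : 1 <= f t.
  by apply: mulr_ege1 => //; exact: (snorm_ge1 h eps_j zeta_j t).
have cf : continuous f.
  move=> t; apply: cvgM; first exact: cvg_cst.
  exact: snorm_continuous.
have [e e0 [theta [th0 dth thoo]]] := time_change cf f1.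
exists (fun t => flow h j eps zeta (theta t)); split.
- exists e => // t /= et; split; first exact: (flow_orbit h eps_sign eps_j zeta_j).
  have [G hG dG] := flow_gradient h_sum eps_sign eps_j zeta_j (theta t).
  exists G => //; apply/realify_is_deriveP => k l.
  have := (realify_is_deriveP _ _ _ _).1 dG k l.
  have d := dth t et; rewrite mxZE => -[d1 d2].
  have ff : f (theta t) != 0 by rewrite gt_eqF// (lt_le_trans ltr01).
  split.
    apply: is_derive_eq (is_derive1_comp d1 d) _.
    by rewrite Re_real -/(f (theta t)) mulrC mulKf.
  apply: is_derive_eq (is_derive1_comp d2 d) _.
  by rewrite Im_real -/(f (theta t)) mulrC mulKf.
- by rewrite th0.
- apply: (cvg_comp theta (flow h j eps zeta) (G := +oo)); last exact: flow_lim.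
  move=> A [M [_ MA]]; have [T hT] := thoo M.
  by exists T; split; [exact: num_real|move=> t /hT /MA].
Qed.

End FlowLimit.

Section StableEqModel.
Variables (R : realType) (n : nat).
Variable h : 'I_n.+1 -> R.
Hypothesis h_sum : \sum_i h i = 0.
Variables (j : 'I_n.+1) (eps : 'I_n.+1 -> R).
Hypothesis eps_sign : forall k, eps k = 1 \/ eps k = -1.
Hypothesis eps_h : forall k, k != j -> eps k * (h k - h j) < 0.
Hypothesis eps_j : eps j = 1.

Lemma stable_eq_model : stable h (crit_pt R j) = model eps j.
Proof.
apply/seteqP; split=> x; first exact: stable_in_model.
move=> [q [q1 q2 q3 q4]].
rewrite -(flow_lincoord eps_sign eps_j q1 q2 q3 q4 h).
apply: flow_stable => //; exact: lincoord_j q2 q3 q4.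
Qed.

End StableEqModel.

(** * Graphs of unitary twists of the orthogonal complement *)

Section GraphModel.
Variables (R : realType) (n : nat).
Local Notation C := R[i]%C.
Local Notation E := 'M[C]_n.+1.
Local Notation Cn := 'cV[C]_n.+1.

Lemma adjmx_sum (I : finType) p q (F : I -> 'M[C]_(p, q)) :
  adjmx (\sum_i F i) = \sum_i adjmx (F i).
Proof.
apply/matrixP => a b; rewrite adjmxE !summxE conjc_sum.
by apply: eq_bigr => i _; rewrite adjmxE.
Qed.

Lemma mem_R_w0 (V : {vspace Cn}) (w : Cn) :
  w \in R_w0 V <-> forall v, v \in V -> adjmx v *m w = 0.
Proof.
have bigcapP (s : seq Cn) :
    (w \in (\bigcap_(v <- s) lker (linfun (mulmx (adjmx v) : Cn -> 'M[C]_1)))%VS)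
    <-> forall v, v \in s -> adjmx v *m w = 0.
  elim: s => [|v s ih]; first by rewrite big_nil memvf.
  rewrite big_cons memv_cap memv_ker lfunE /=; split.
    move=> /andP[/eqP h1 /ih h2] u; rewrite inE => /orP[/eqP ->//|]; exact: h2.
  move=> hs; apply/andP; split; first by apply/eqP/hs; rewrite mem_head.
  by apply/ih => u us; apply: hs; rewrite inE us orbT.
rewrite /R_w0 bigcapP; split=> hw v.
  move=> /coord_vbasis ->; rewrite adjmx_sum mulmx_suml big1// => i _.
  rewrite adjmxZ.
  rewrite -scalemxAl hw ?scaler0//; apply: mem_nth; rewrite size_tuple; exact: ltn_ord.
by move=> /vbasis_mem; exact: hw.
Qed.

Variables (j : 'I_n.+1) (eps : 'I_n.+1 -> R).
Hypothesis eps_sign : forall k, eps k = 1 \/ eps k = -1.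
Hypothesis eps_j : eps j = 1.
Local Notation D := (diag_mx (\row_k (eps k)%:C%C) : E).
Variable c : C.
Hypothesis c0 : c != 0.
Local Notation m := (c *: D).

Lemma diag_eps_sq : D *m D = 1%:M.
Proof.
apply/matrixP => k l; rewrite mul_diag_mx !mxE; case: eqP => [->|_] /=.
  by rewrite !mulr1n -real_complexM eps_sq.
by rewrite !mulr0n mulr0.
Qed.

Lemma mem_twist (V : {vspace Cn}) (w : Cn) :
  w \in (linfun (mulmx m : Cn -> Cn) @: R_w0 V)%VS <->
  forall v, v \in V -> adjmx v *m D *m w = 0.
Proof.
split=> [/memv_imgP[w' /mem_R_w0 hw' ->] v vV|hw].
  rewrite lfunE /= mulmxA -[_ *m D *m m]mulmxA -scalemxAr diag_eps_sq.
  by rewrite -scalemxAr mulmx1 -scalemxAl hw'// scaler0.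
apply/memv_imgP; exists (c^-1 *: (D *m w)).
  apply/mem_R_w0 => v vV; rewrite -scalemxAr mulmxA hw// scaler0 //.
by rewrite lfunE /= -scalemxAl -scalemxAr scalerA divff// scale1r mulmxA
  diag_eps_sq mul1mx.
Qed.

Lemma Gamma_model :
  Gamma m `&` [set x | -1 < Re (x j j)] = model eps j :> set E.
Proof.
have N0 : n.+1%:R != 0 :> C by rewrite pnatr_eq0.
have Re_jj (x : E) : (-1 < Re (x j j)) = (0 < Re (proj x j j)).
  rewrite proj_mxE eqxx real_invN Re_real ReD pmulr_rgt0 ?invr_gt0 ?ltr0n//=.
  by rewrite -ltrBlDr sub0r.
have formE (v w : Cn) : (adjmx v *m D *m w) 0 0 =
    \sum_k conjc (v k 0) * (eps k)%:C%C * w k 0.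
  rewrite mxE; apply: eq_bigr => k _; rewrite mul_mx_diag mxE adjmxE mxE.
  by [].
have form_vv (v : Cn) : (adjmx v *m D *m v) 0 0 =
    (\sum_k eps k * nsq (v k 0))%:C%C.
  rewrite formE real_sum; apply: eq_bigr => k _.
  by rewrite real_complexM nsqE; ring.
apply/seteqP; split=> x.
  move=> [[V [dimV VW [xV xW]]] /=]; rewrite Re_jj => xj.
  set W := (_ @: _)%VS in VW xW.
  pose v := vpick V.
  have v0 : v != 0 by rewrite vpick0 -dimv_eq0 dimV.
  have vV : v \in V := memv_pick V.
  have spanV u : u \in V -> exists a, u = a *: v.
    have : (<[v]> == V)%VS by rewrite eqEdim -memvE vV dim_vline v0 dimV.
    by move=> /eqP <- /vlineP.
  pose d : R := \sum_k eps k * nsq (v k 0).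
  have mem_W w : (adjmx v *m D *m w) 0 0 = 0 -> w \in W.
    move=> e; apply/mem_twist => u /spanV[a ->].
    have -> : adjmx v *m D *m w = 0 -> adjmx (a *: v) *m D *m w = 0.
      by move=> e'; rewrite adjmxZ -!scalemxAl e' scaler0.
    by [].
    by apply/matrixP => i k; rewrite !ord1 e mxE.
  have d0 : d != 0.
    apply: contra_neq v0 => d0; apply/eqP; rewrite -memv0 -VW memv_cap vV.
    by apply: mem_W; rewrite form_vv -/d d0.
  have Pz (z : Cn) : proj x *m z = ((adjmx v *m D *m z) 0 0 / d%:C%C) *: v.
    set a := _ / _; pose w := z - a *: v.
    have wW : w \in W.
      apply: mem_W; rewrite /w mulmxBr -scalemxAr.
      rewrite mxE [X in _ + X]mxE [X in _ - X]mxE form_vv -/d /a divfK ?subrr//.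
      by rewrite real_complex_eq0.
    have Pw : proj x *m w = 0.
      by rewrite /proj -scalemxAl mulmxDl xW// mul1mx addNr scaler0.
    have Pv : proj x *m v = v.
      rewrite /proj -scalemxAl mulmxDl xV// mul1mx -{2}[v]scale1r -scalerDl natr1.
      by rewrite scalerA mulVf// scale1r.
    by rewrite -[z](subrK (a *: v)) -/w mulmxDr Pw add0r -scalemxAr Pv.
  have Pkl k l : proj x k l = v k 0 * conjc (v l 0) * (eps l)%:C%C / d%:C%C.
    have : (proj x *m (delta_mx l 0 : Cn)) k 0 = proj x k l.
      by rewrite -colE mxE.
    move=> <-; rewrite Pz mxE formE (bigD1 l)//= mxE !eqxx mulr1 big1; last first.
      by move=> i /negbTE il; rewrite mxE il mulr0.
    by rewrite addr0; ring.
  have xjE : Re (proj x j j) = nsq (v j 0) / d.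
    by rewrite Pkl eps_j mulr1 -nsqE -real_complexV -real_complexM.
  have vj0 : nsq (v j 0) != 0.
    by apply/eqP => z; move: xj; rewrite xjE z mul0r ltxx.
  have vjp : 0 < nsq (v j 0) by rewrite lt0r vj0 nsq_ge0.
  have dp : 0 < d by move: xj; rewrite xjE pmulr_rgt0// invr_gt0.
  pose p := Num.sqrt (nsq (v j 0) * d).
  have p0 : 0 < p by rewrite sqrtr_gt0 mulr_gt0.
  have pp : p * p = nsq (v j 0) * d by rewrite -expr2 sqr_sqrtr// ltW// mulr_gt0.
  have p0C : p%:C%C != 0 :> C by rewrite real_complex_eq0 gt_eqF.
  have d0C : d%:C%C != 0 :> C by rewrite real_complex_eq0.
  exists (fun k => (p^-1)%:C%C * (v k 0 * conjc (v j 0))); split.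
  - have e k : eps k * nsq ((p^-1)%:C%C * (v k 0 * conjc (v j 0))) =
        eps k * nsq (v k 0) / d.
      rewrite !nsqM nsq_real nsqJ exprVn expr2 pp; field.
      by rewrite vj0 d0.
    by rewrite (eq_bigr _ (fun k _ => e k)) -mulr_suml divff.
  - by rewrite Re_real -nsqE /= mulr_gt0// invr_gt0.
  - by rewrite Im_real -nsqE /= mulr0.
  - move=> k l; rewrite Pkl !conjcM conjcK conjc_real.
    have e : (p%:C%C * p%:C%C : C) = v j 0 * conjc (v j 0) * d%:C%C.
      by rewrite -real_complexM pp real_complexM nsqE.
    have e2 : (p^-1)%:C%C * (p^-1)%:C%C * (v j 0 * conjc (v j 0)) = d%:C%C^-1 :> C.
      have -> : v j 0 * conjc (v j 0) = p%:C%C * p%:C%C / d%:C%C by rewrite e mulfK.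
      by rewrite real_complexV; field; rewrite p0C d0C.
    by rewrite -e2; ring.
move=> [q [q1 q2 q3 Pq]]; split; last first.
  rewrite /= Re_jj Pq eps_j mulr1 -nsqE /=.
  rewrite lt0r nsq_ge0 andbT nsq_eq0; apply: contraTneq q2 => ->.
  by rewrite ltxx.
pose v : Cn := \col_k q k.
have v0 : v != 0.
  apply: contraTneq q2 => e; have -> : q j = v j 0 by rewrite mxE.
  by rewrite e mxE ltxx.
have Pz (z : Cn) : proj x *m z = (adjmx v *m D *m z) 0 0 *: v.
  apply/matrixP => k l; rewrite !ord1 mxE [in RHS]mxE formE mulr_suml.
  by apply: eq_bigr => i _; rewrite Pq !mxE; ring.
have xz (z : Cn) : x *m z = n.+1%:R *: (proj x *m z) - z.
  by rewrite {1}(projK x) mulmxBl mul1mx scalemxAl.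
exists <[v]>%VS => W.
have xV u : u \in <[v]>%VS -> x *m u = n%:R *: u.
  move=> /vlineP[a ->]; rewrite xz Pz -scalemxAr mxE form_vv.
  have -> : \sum_k eps k * nsq (v k 0) = 1.
    by rewrite -q1; apply: eq_bigr => k _; rewrite mxE.
  by rewrite mulr1 scalerA -scalerA -{2}[a *: v]scale1r -scalerBl -natr1 addrK.
have xW w : w \in W -> x *m w = - w.
  move=> /mem_twist/(_ v (memv_line v)) e.
  by rewrite xz Pz e mxE scale0r scaler0 sub0r.
split=> //; first by rewrite dim_vline v0.
apply/eqP; rewrite -subv0; apply/subvP => u; rewrite memv_cap memv0 => /andP[uV uW].
have : (n.+1%:R : C) *: u = 0.
  by rewrite -natr1 scalerDl scale1r -xV// xW// addNr.
by move/eqP; rewrite scaler_eq0 (negbTE N0).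
Qed.

End GraphModel.

(** * The height on the stable manifold *)

Lemma ivt_seg (R : realType) (f : R -> R) (a b v : R) : a <= b ->
  {within `[a, b], continuous f} -> f a <= v -> v <= f b ->
  exists2 t, a <= t <= b & f t = v.
Proof.
move=> ab cf av vb; have [|t] := IVT ab cf (v := v).
  by rewrite ge_min av le_max vb orbT.
by rewrite in_itv /= => tab e; exists t.
Qed.

Section Height.
Variables (R : realType) (n : nat).
Local Notation C := R[i]%C.
Local Notation E := 'M[C]_n.+1.
Local Notation orbit := (@orbit_H0 R n).
Variable h : 'I_n.+1 -> R.
Hypothesis h_sum : \sum_i h i = 0.
Local Notation N := (n.+1%:R : R).

Lemma fH_proj (x : E) :
  fH h x = (2 * N * N)%:C%C * \sum_k (h k)%:C%C * proj x k k.
Proof.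
have e : \sum_k (h k)%:C%C * x k k =
    n.+1%:R * (\sum_k (h k)%:C%C * proj x k k) - (\sum_k h k)%:C%C.
  rewrite real_sum mulr_sumr -sumrB; apply: eq_bigr => k _.
  rewrite {1}(projK x) mxBE mxZE [1%:M k k]mxE eqxx mulr1n; ring.
by rewrite fHE // e h_sum subr0 mulrA real_2N [in RHS]real_complexM real_complex_nat.
Qed.

Lemma crit_orbit k : orbit (crit_pt R k).
Proof.
apply/orbitP; exists (delta_mx k 0), (delta_mx 0 k); split.
  by rewrite proj_crit_pt mul_delta_mx.
by rewrite mul_delta_mx; apply/matrixP => a b; rewrite !ord1 !mxE eqxx.
Qed.

(** The complex derivative of a linear form. *)
Lemma derive_fH (y v : E) : 'D_v (fH h) y = fH h v.
Proof.
apply: cvg_lim => //; apply: cvg_near_cst.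
near=> t.
rewrite /= fHD // fHZ // addrK /GRing.scale /= mulKf//.
by near: t; exact: nbhs_dnbhs_neq.
Unshelve. all: by end_near. Qed.

Lemma crit_critical k : critical h (crit_pt R k).
Proof.
split=> [|v [A _ ->]]; first exact: crit_orbit.
rewrite derive_fH fHE // -mxtrace_diagH /bracket mulmxBr mxtraceB.
rewrite mulmxA mxtrace_mulC mulmxA.
rewrite (_ : crit_pt R k *m diagH h = diagH h *m crit_pt R k); last exact: diag_mxC.
by rewrite mulmxA subrr mulr0.
Qed.

Lemma height_crit k : height (crit_pt R k) h = h k.
Proof.
rewrite /height (bigD1 k)//= proj_crit_pt mxE !eqxx /= mulr1 big1 ?addr0// => i ik.
by rewrite mxE (negbTE ik) /= mulr0.
Qed.

Lemma fH_crit k : fH h (crit_pt R k) = (2 * N * N * h k)%:C%C.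
Proof.
rewrite fH_proj [in RHS]real_complexM; congr (_ * _).
rewrite (bigD1 k)//= proj_crit_pt mxE !eqxx /= mulr1 big1 ?addr0// => i ik.
by rewrite mxE (negbTE ik) /= mulr0.
Qed.

Variables (j : 'I_n.+1) (eps : 'I_n.+1 -> R).
Hypothesis eps_sign : forall k, eps k = 1 \/ eps k = -1.
Hypothesis eps_h : forall k, k != j -> eps k * (h k - h j) < 0.
Hypothesis eps_j : eps j = 1.

Lemma fH_model (x : E) : model eps j x -> fH h x = (2 * N * N * height x h)%:C%C.
Proof.
move=> [q [_ _ _ Pq]]; rewrite fH_proj [in RHS]real_complexM; congr (_ * _).
rewrite /height real_sum; apply: eq_bigr => k _.
have -> : proj x k k = (nsq (q k) * eps k)%:C%C by rewrite Pq real_complexM nsqE.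
by move: (nsq _ * _) => r; rewrite [in RHS]real_complexM.
Qed.

Lemma height_q (x : E) q :
  (forall k l, proj x k l = q k * conjc (q l) * (eps l)%:C%C) ->
  height x h = \sum_k h k * (eps k * nsq (q k)).
Proof.
move=> Pq; apply: eq_bigr => k _; congr (_ * _).
have -> : proj x k k = (nsq (q k) * eps k)%:C%C by rewrite Pq real_complexM nsqE.
by rewrite /= mulrC.
Qed.

Lemma height_gap (x : E) q : \sum_k eps k * nsq (q k) = 1 ->
  (forall k l, proj x k l = q k * conjc (q l) * (eps l)%:C%C) ->
  h j - height x h = \sum_(k | k != j) - rate h j eps k * nsq (q k).
Proof.
move=> q1 /height_q ->.
rewrite -[h j]mulr1 -q1 mulr_sumr -sumrB (bigD1 j)//= subrr add0r.
by apply: eq_bigr => k _; rewrite /rate; ring.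
Qed.

Lemma rate_lt0 k : k != j -> rate h j eps k < 0.
Proof. exact: eps_h. Qed.

Lemma height_le (x : E) : model eps j x -> height x h <= h j.
Proof.
move=> [q [q1 _ _ Pq]]; rewrite -subr_ge0 (height_gap q1 Pq).
by apply: sumr_ge0 => k kj; rewrite mulr_ge0 ?nsq_ge0// oppr_ge0 ltW// rate_lt0.
Qed.

Lemma crit_model : model eps j (crit_pt R j).
Proof.
exists (fun k => (k == j)%:R); split.
- rewrite (bigD1 j)//= eqxx nsq_real expr1n eps_j mulr1 big1 ?addr0// => k kj.
  by rewrite (negbTE kj) nsq0 mulr0.
- by rewrite eqxx /= ltr01.
- by rewrite eqxx.
- move=> k l; rewrite proj_crit_pt mxE.
  have [_|kj] := eqVneq k j; last by rewrite !mul0r.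
  have [->|lj] := eqVneq l j; last by rewrite conjc0 mulr0 mul0r.
  by rewrite conjc1 eps_j !mulr1.
Qed.

Lemma height_max_crit (x : E) : model eps j x -> height x h = h j ->
  x = crit_pt R j.
Proof.
move=> [q [q1 q2 q3 Pq]] e; have := height_gap q1 Pq; rewrite e subrr => /esym.
move/psumr_eq0P => z.
have z0 k : k != j -> - rate h j eps k * nsq (q k) = 0.
  by apply: z => i ij; rewrite mulr_ge0 ?nsq_ge0// oppr_ge0 ltW// rate_lt0.
have q0 k : k != j -> q k = 0.
  move=> kj; apply/eqP; rewrite -nsq_eq0; move/eqP: (z0 k kj).
  by rewrite mulf_eq0 oppr_eq0 (lt_eqF (rate_lt0 kj)).
have qj1 : q j = 1.
  move: q1; rewrite (bigD1 j)//= eps_j mul1r big1 ?addr0; last first.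
    by move=> i /q0 ->; rewrite nsq0 mulr0.
  rewrite /nsq q3 expr0n addr0 => /eqP; rewrite sqrf_eq1 => /orP[] /eqP r.
    by apply: complex_ext.
  by move: q2; rewrite r ltr0N1.
apply: proj_inj; apply/matrixP => k l; rewrite Pq proj_crit_pt mxE.
have [->|/q0 ->] := eqVneq k j; last by rewrite !mul0r.
have [->|/q0 ->] := eqVneq l j; last by rewrite conjc0 mulr0 mul0r.
by rewrite qj1 conjc1 eps_j !mulr1.
Qed.

Lemma model_nontrivial (x : E) : model eps j x -> x <> crit_pt R j ->
  exists2 k, k != j & lincoord j eps x k != 0.
Proof.
move=> mx xc.
have [[k [kj lk]]|no] := pselect (exists k, k != j /\ lincoord j eps x k != 0).
  by exists k.
case: xc; have [q [q1 q2 q3 Pq]] := mx.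
apply: (lincoord_inj eps_sign eps_j mx crit_model) => k.
have [q' [q'1 q'2 q'3 q'4]] := crit_model.
have [->|kj] := eqVneq k j.
  by rewrite (lincoord_j eps_j q2 q3 Pq) (lincoord_j eps_j q'2 q'3 q'4).
have -> : lincoord j eps x k = 0.
  by apply/eqP; apply: contra_notT no => lk; exists k.
rewrite /lincoord proj_crit_pt !mxE (negbTE kj) /= mul0r mulr0.
by case: ifP.
Qed.

(** Along a nonconstant explicit trajectory the height increases strictly: its
    derivative is a positive multiple of the squared norm of the gradient. *)
Section AlongFlow.
Variable zeta : 'I_n.+1 -> C.
Hypothesis zeta_j : zeta j = 1.
Local Notation F t := (height (flow h j eps zeta t) h).

Lemma height_flow_derive (t : R) : exists2 d : R, is_derive t 1 (fun t : R => F t) d &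
  0 <= d /\ ((exists2 k, k != j & zeta k != 0) -> 0 < d).
Proof.
have [mu [c [Om [OmE dsc Om0 Omc]]]] := flow_rates h eps_sign eps_j zeta_j t.
set q := qflow h j eps zeta t in Om0 Omc.
have q1 : \sum_k eps k * nsq (q k) = 1 := qflow_constraint h eps_sign eps_j zeta_j t.
have Pq : forall k l, proj (flow h j eps zeta t) k l = q k * conjc (q l) * (eps l)%:C%C
  := proj_flow h j eps zeta t.
have hG := model_gradient h_sum eps_sign q1 Pq OmE Om0 Omc.
set G := \matrix_(_, _) _ in hG.
have ho := model_orbit q1 Pq.
have s0 : 0 < \sum_k nsq (q k).
  exact: lt_le_trans ltr01 (model_norm_ge1 eps_sign q1).
pose g2 : R := \sum_k \sum_l nsq (G k l).
have g20 : 0 <= g2 by apply: sumr_ge0 => k _; apply: sumr_ge0 => l _; exact: nsq_ge0.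
exists ((\sum_k nsq (q k)) * g2).
  have d : is_derive t 1 (fun t : R => \sum_k h k * (eps k * nsq (qflow h j eps zeta t k)))
      (\sum_k h k * (eps k * (2 * Om k * nsq (q k)))).
    apply: is_derive_big => k; apply: is_derive_scal; apply: is_derive_scal.
    have -> : (fun u : R => nsq (qflow h j eps zeta u k)) =
        fun u => nsq (zeta k) * (scale h j eps zeta k u * scale h j eps zeta k u).
      by apply/funext => u; rewrite nsq_qflow; ring.
    apply: is_derive_eq (is_derive_scal _ (is_derive_mul (dsc k) (dsc k))) _.
    by rewrite /q nsq_qflow; ring.
  have -> : (fun t : R => F t) =
      (fun t : R => \sum_k h k * (eps k * nsq (qflow h j eps zeta t k))).
    by apply/funext => u; apply: height_q; exact: proj_flow.
  apply: is_derive_eq d _.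
  have := congr1 (@complex.Re R) (gradient_norm h_sum ho hG).
  rewrite /= -/g2 => <-; rewrite Re_sum mulr_sumr; apply: eq_bigr => k _.
  rewrite Re_real mxE Re_real Pq -nsqE -real_complexM /=.
  by field; rewrite gt_eqF.
split=> [|[k kj zk]]; first by rewrite mulr_ge0// ltW.
rewrite mulr_gt0// lt0r g20 andbT; apply/eqP => g0.
have G0 k' l : G k' l = 0.
  apply/eqP; rewrite -nsq_eq0; move/psumr_eq0P: g0.
  move=> /(_ (fun k _ => sumr_ge0 _ (fun l _ => nsq_ge0 _)) k' isT)/psumr_eq0P.
  by move=> /(_ (fun l _ => nsq_ge0 _) l isT) ->.
have qz l : (q l == 0) = (zeta l == 0).
  by rewrite mulf_eq0 real_complex_eq0 gt_eqF// scale_gt0.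
clearbody q.
have OmP k' l : q k' != 0 -> q l != 0 -> Om k' + Om l = 0.
  move=> qk ql; move: (G0 k' l); rewrite mxE => /eqP; rewrite mulf_eq0 Pq.
  rewrite !mulf_eq0 (negbTE qk) conjc_eq0 (negbTE ql) !real_complex_eq0 /=.
  rewrite mulf_eq0 invr_eq0 (gt_eqF s0) orbF.
  by case: (eps_sign l) => ->; rewrite ?oppr_eq0 oner_eq0 orbF => /eqP.
have Om_eq0 l : q l != 0 -> Om l = 0.
  by move=> ql; have := OmP l l ql ql; lra.
have qj0 : q j != 0 by rewrite qz zeta_j oner_neq0.
have qk0 : q k != 0 by rewrite qz.
have c0 : c = 0.
  have /eqP := Omc; rewrite big1; last first.
    move=> l _; have [->|/Om_eq0 ->] := eqVneq (q l) 0; first by rewrite nsq0 mulr0.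
    by rewrite mul0r.
  by rewrite eq_sym mulf_eq0 (gt_eqF s0) orbF => /eqP.
have ek := Om_eq0 k qk0; have ej := Om_eq0 j qj0.
rewrite OmE c0 subr0 in ek; rewrite OmE c0 subr0 eps_j mul1r in ej.
have := rate_lt0 kj; rewrite /rate.
have -> : h k - h j = h k - mu - (h j - mu) by ring.
by rewrite ej subr0 ek ltxx.
Qed.

Lemma height_flow_mono (t u : R) : (exists2 k, k != j & zeta k != 0) ->
  t < u -> F t < F u.
Proof.
move=> hz tu.
have [D hD] : exists D : R -> R, forall t : R, is_derive t 1 (fun t : R => F t) (D t) /\ 0 < D t.
  have ex (s : R) : exists d, is_derive s 1 (fun t : R => F t) d /\ 0 < d.
    by have [d d1 [_ d2]] := height_flow_derive s; exists d; split=> //; exact: d2.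
  by exists (fun s => projT1 (cid (ex s))) => s; exact: (projT2 (cid (ex s))).
have [c _ e] := mvt_seg (ltW tu) (fun s _ => (hD s).1).
by rewrite -subr_gt0 e mulr_gt0 ?subr_gt0//; case: (hD c).
Qed.

Lemma height_flow_continuous (a b : R) : {within `[a, b], continuous (fun t : R => F t)}.
Proof.
have [D hD] : exists D : R -> R, forall t : R, is_derive t 1 (fun t : R => F t) (D t).
  have ex (s : R) : exists d, is_derive s 1 (fun t : R => F t) d.
    by have [d d1 _] := height_flow_derive s; exists d.
  by exists (fun s => projT1 (cid (ex s))) => s; exact: (projT2 (cid (ex s))).
exact: (continuous_on_seg (fun s _ => hD s)).
Qed.

Lemma height_flow_lim : F t @[t --> +oo] --> h j.
Proof. exact: height_lim (flow_lim eps_h eps_j zeta_j). Qed.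

Lemma height_flow_inj (t u : R) : (exists2 k, k != j & zeta k != 0) -> F t = F u -> t = u.
Proof.
have aux (a b : R) : a < b -> a = b -> t = u by move=> ab e; move: ab; rewrite e ltxx.
move=> hz; have [lt|lt|//] := ltgtP t u.
  exact: (aux _ _ (height_flow_mono hz lt)).
move=> e; exact: (aux _ _ (height_flow_mono hz lt) (esym e)).
Qed.

(** A level above all the [h k] smaller than [h j] cuts the stable manifold in
    a set on which the linearising coordinates are bounded, so every
    trajectory, followed backwards, crosses it. *)
Lemma height_flow_reaches (c0 : R) : (exists2 k, k != j & zeta k != 0) ->
  (forall k, h k < h j -> h k < c0) -> c0 < h j -> c0 <= F 0 ->
  exists2 t, t <= 0 & F t = c0.
Proof.
move=> [k kj zk] hc cj cF.
suff [T T0 hT] : exists2 T, T <= 0 & F T <= c0.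
  have [t /andP[_ t0] e] := ivt_seg T0 (@height_flow_continuous T 0) hT cF.
  by exists t.
apply: contrapT => no.
have big t : t <= 0 -> c0 < F t.
  by move=> t0; rewrite ltNge; apply/negP => le; apply: no; exists t.
have wt l : l != j -> 0 < - (eps l * (h l - c0)).
  move=> lj; have := eps_h lj; rewrite oppr_gt0.
  case: (eps_sign l) => ->; rewrite ?mul1r ?mulN1r ?oppr_lt0; last by lra.
  by rewrite !subr_lt0 => /hc.
pose d := h j - c0; have d0 : 0 < d by rewrite subr_gt0.
pose B := \sum_(l | l != j) d / - rate h j eps l.
have B0 : 0 <= B.
  apply: sumr_ge0 => l lj; rewrite divr_ge0 ?(ltW d0)// oppr_ge0 ltW//.
  exact: rate_lt0.
pose K := d / - (eps k * (h k - c0)) + (1 + 2 * B) ^+ 2 * ((1 + B) * B).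
have bound t : t <= 0 -> flow_exp h j eps k t ^+ 2 * nsq (zeta k) <= K.
  move=> t0; set q := qflow h j eps zeta t.
  have q1 : \sum_k eps k * nsq (q k) = 1 := qflow_constraint h eps_sign eps_j zeta_j t.
  have Pq : forall k l, proj (flow h j eps zeta t) k l = q k * conjc (q l) * (eps l)%:C%C
    := proj_flow h j eps zeta t.
  have gap := height_gap q1 Pq; have hq := height_q Pq.
  move: gap hq (big t t0); move: (F t) => f gap hq bt.
  have ql l : l != j -> nsq (q l) <= d / - rate h j eps l.
    move=> lj; rewrite ler_pdivlMr ?oppr_gt0 ?rate_lt0//.
    apply: (@le_trans _ _ (h j - f)); last by rewrite /d; lra.
    rewrite gap (bigD1 l)//= mulrC lerDl.
    apply: sumr_ge0 => i /andP[ij _].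
    by rewrite mulr_ge0 ?nsq_ge0// oppr_ge0 ltW// rate_lt0.
  have qB : \sum_(l | l != j) nsq (q l) <= B by apply: ler_sum.
  have qjE : q j = (qj h j eps zeta t)%:C%C by rewrite /q /qflow zeta_j mulr1 scale_j.
  have qj0 := qj_gt0 h eps_j zeta_j t; set r := qj h j eps zeta t in qjE qj0.
  have nj : nsq (q j) = r ^+ 2 by rewrite qjE nsq_real.
  have rB : r ^+ 2 <= 1 + B.
    move: q1; rewrite (bigD1 j)//= eps_j mul1r nj => e.
    have : - (\sum_(l | l != j) eps l * nsq (q l)) <= B.
      rewrite -sumrN; apply: le_trans qB; apply: ler_sum => l _.
      by have := nsq_ge0 (q l); case: (eps_sign l) => ->; lra.
    by lra.
  have sB : snorm h j eps zeta t <= 1 + 2 * B.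
    rewrite -(qflow_norm h eps_j zeta_j t) -/q (bigD1 j)//= nj; lra.
  have fe := lincoord_flow eps_sign eps_j h t k zeta_j.
  have p1 : 0 < Re (q j) by rewrite qjE.
  have p2 : Im (q j) = 0 by rewrite qjE.
  have feN : flow_exp h j eps k t ^+ 2 * nsq (zeta k) = nsq (lincoord j eps (flow h j eps zeta t) k).
    by rewrite fe nsqM nsq_real.
  rewrite feN (lincoordE eps_sign eps_j p1 p2 Pq) (qflow_norm h eps_j zeta_j t) qjE /=.
  have K1 : 0 <= d / - (eps k * (h k - c0)) by rewrite divr_ge0 ?ltW ?wt.
  have K2 : 0 <= (1 + 2 * B) ^+ 2 * ((1 + B) * B).
    by rewrite mulr_ge0 ?sqr_ge0// mulr_ge0//; lra.
  case: ifP => _.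
    rewrite -real_complexV nsqM nsq_real exprVn.
    apply: le_trans (_ : d / - (eps k * (h k - c0)) <= _); last by rewrite /K; lra.
    rewrite ler_pdivrMr ?exprn_gt0// mulrAC ler_pdivlMr ?wt//.
    have e : f - c0 = \sum_l eps l * (h l - c0) * nsq (q l).
      rewrite hq -[c0 in LHS]mulr1 -q1 mulr_sumr -sumrB.
      by apply: eq_bigr => l _; ring.
    have e2 : f - c0 = d * r ^+ 2 + eps k * (h k - c0) * nsq (q k) +
        \sum_(l | (l != j) && (l != k)) eps l * (h l - c0) * nsq (q l).
      by rewrite e (bigD1 j)//= (bigD1 k)//= eps_j mul1r nj addrA.
    have : \sum_(l | (l != j) && (l != k)) eps l * (h l - c0) * nsq (q l) <= 0.
      apply: sumr_le0 => l /andP[lj _]; apply: mulr_le0_ge0; last exact: nsq_ge0.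
      by have := wt l lj; lra.
    move: (\sum_(_ | _) _) e2 => S; lra.
  rewrite -real_complexM nsqM nsq_real exprMn.
  apply: le_trans (_ : (1 + 2 * B) ^+ 2 * ((1 + B) * B) <= _); last by rewrite /K; lra.
  have i1 : snorm h j eps zeta t ^+ 2 <= (1 + 2 * B) ^+ 2.
    by rewrite lerXn2r ?nnegrE ?(ltW (snorm_gt0 h eps_j zeta_j t))//; lra.
  have i2 : r ^+ 2 * nsq (q k) <= (1 + B) * B.
    apply: ler_pM => //; [exact: sqr_ge0|exact: nsq_ge0|].
    apply: le_trans qB; rewrite (bigD1 k)//= lerDl.
    by apply: sumr_ge0 => l _; exact: nsq_ge0.
  rewrite -mulrA; apply: ler_pM => //; first exact: sqr_ge0.
  by apply: mulr_ge0; [exact: sqr_ge0|exact: nsq_ge0].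
have z0 : 0 < nsq (zeta k) by rewrite lt0r nsq_eq0 zk nsq_ge0.
have r0 := rate_lt0 kj.
have K0 : 0 <= K.
  by apply: le_trans (bound 0 (lexx 0)); rewrite mulr_ge0 ?sqr_ge0 ?ltW.
pose t := K / nsq (zeta k) / rate h j eps k.
have t0 : t <= 0.
  by rewrite /t mulr_ge0_le0 ?divr_ge0 ?(ltW z0)// invr_le0 ltW.
have := bound t t0; apply/negP; rewrite -ltNge.
have e1 : 1 + K / nsq (zeta k) <= flow_exp h j eps k t.
  have <- : rate h j eps k * t = K / nsq (zeta k) by rewrite /t mulrC divfK ?lt_eqF.
  exact: expR_ge1Dx.
have k0 : 0 <= K / nsq (zeta k) by rewrite divr_ge0// ltW.
have e2 : 1 + K / nsq (zeta k) <= flow_exp h j eps k t ^+ 2.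
  by apply: (le_trans e1); rewrite expr2 ler_peMr//; lra.
apply: lt_le_trans (_ : (1 + K / nsq (zeta k)) * nsq (zeta k) <= _).
  by rewrite mulrDl divfK ?gt_eqF// mul1r ltrDr.
by rewrite ler_pM2r.
Qed.

End AlongFlow.
End Height.

Section ComplexLimitOps.
Variables (R : realType) (T : Type) (F : set_system T).
Hypothesis FF : Filter F.
Local Notation C := R[i]%C.
Implicit Types (f g : T -> C) (a b : C).

Lemma ccvgM f g a b : f @ F --> a -> g @ F --> b ->
  (fun t => f t * g t) @ F --> a * b.
Proof.
move=> /(complex_cvgP f a)[f1 f2] /(complex_cvgP g b)[g1 g2].
apply/complex_cvgP; split.
  rewrite ReM; under eq_fun do rewrite ReM.
  by apply: cvgB; apply: cvgM.
rewrite ImM; under eq_fun do rewrite ImM.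
by apply: cvgD; apply: cvgM.
Qed.

Lemma ccvgD f g a b : f @ F --> a -> g @ F --> b ->
  (fun t => f t + g t) @ F --> a + b.
Proof.
move=> /(complex_cvgP f a)[f1 f2] /(complex_cvgP g b)[g1 g2].
apply/complex_cvgP; split.
  rewrite ReD; under eq_fun do rewrite ReD.
  exact: cvgD.
rewrite ImD; under eq_fun do rewrite ImD.
exact: cvgD.
Qed.

Lemma ccvg_cst a : (fun=> a) @ F --> a.
Proof. exact: cvg_cst. Qed.

Lemma nsq_cvg f a : f @ F --> a -> (fun t => nsq (f t)) @ F --> nsq a.
Proof.
move=> /(complex_cvgP f a)[f1 f2]; rewrite /nsq.
by apply: cvgD; apply: cvgM.
Qed.

Lemma ccvgV f a : a != 0 -> f @ F --> a -> (fun t => (f t)^-1) @ F --> a^-1.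
Proof.
move=> a0 fa; have /(complex_cvgP f a)[f1 f2] := fa.
have n0 : nsq a != 0 by rewrite nsq_eq0.
have nV : (fun t => (nsq (f t))^-1) @ F --> (nsq a)^-1 by apply: cvgV => //; exact: nsq_cvg.
apply/complex_cvgP; split.
  rewrite ReV; under eq_fun do rewrite ReV.
  exact: cvgM.
rewrite ImV; under eq_fun do rewrite ImV.
by apply: cvgM => //; exact: cvgN.
Qed.

Lemma rcvg_sum (I : finType) (P : pred I) (f : I -> T -> R) (a : I -> R) :
  (forall i, f i @ F --> a i) ->
  (fun t => \sum_(i | P i) f i t) @ F --> \sum_(i | P i) a i.
Proof.
move=> c; elim: (index_enum _) => [|i s ih].
  by rewrite big_nil; under eq_fun do rewrite big_nil; exact: cvg_cst.
rewrite big_cons; under eq_fun do rewrite big_cons.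
case: (P i); last exact: ih.
exact: (cvgD (c i) ih).
Qed.

Lemma ccvg_sum (I : finType) (P : pred I) (f : I -> T -> C) (a : I -> C) :
  (forall i, f i @ F --> a i) ->
  (fun t => \sum_(i | P i) f i t) @ F --> \sum_(i | P i) a i.
Proof.
move=> c; apply/complex_cvgP; split.
  rewrite Re_sum; under eq_fun do rewrite Re_sum.
  by apply: rcvg_sum => i; case/complex_cvgP: (c i).
rewrite Im_sum; under eq_fun do rewrite Im_sum.
by apply: rcvg_sum => i; case/complex_cvgP: (c i).
Qed.

Lemma entry_cvg p q (M : T -> 'M[C]_(p, q)) (m : 'M[C]_(p, q)) k l :
  M @ F --> m -> (fun t => M t k l) @ F --> m k l.
Proof. by move=> /(mx_cvgP M m)/(_ k l) c; apply/complex_cvgP. Qed.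

Variable n : nat.
Local Notation E := 'M[C]_n.+1.

Lemma proj_cvg (M : T -> E) (m : E) k l :
  M @ F --> m -> (fun t => proj (M t) k l) @ F --> proj m k l.
Proof.
move=> c; rewrite proj_mxE; under eq_fun do rewrite proj_mxE.
apply: ccvgM; first exact: ccvg_cst.
by apply: ccvgD; [exact: entry_cvg|exact: ccvg_cst].
Qed.

Lemma lincoord_cvg (M : T -> E) (m : E) j eps k : proj m j j != 0 ->
  M @ F --> m -> (fun t => lincoord j eps (M t) k) @ F --> lincoord j eps m k.
Proof.
move=> m0 c; rewrite /lincoord; case: (eps k == 1).
  by apply: ccvgM; [|apply: ccvgV => //]; exact: proj_cvg.
apply: ccvgM; last exact: proj_cvg.
by apply: ccvg_sum => i; apply: ccvgM; [exact: ccvg_cst|exact: proj_cvg].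
Qed.

Lemma height_cvg (M : T -> E) (m : E) h :
  M @ F --> m -> (fun t => height (M t) h) @ F --> height m h.
Proof.
have eh (x : E) : height x h = Re (\sum_k (h k)%:C%C * proj x k k).
  by rewrite Re_sum; apply: eq_bigr => k _; rewrite Re_real.
move=> c; rewrite eh; under eq_fun do rewrite eh.
suff /complex_cvgP[] : (fun t => \sum_k (h k)%:C%C * proj (M t) k k) @ F -->
    \sum_k (h k)%:C%C * proj m k k by [].
apply: ccvg_sum => k.
by apply: ccvgM; [exact: ccvg_cst|exact: proj_cvg].
Qed.

End ComplexLimitOps.

Section Within.
Variable R : realType.
Local Notation C := R[i]%C.

Lemma within_map (V W : topologicalType) (A B : set R) (g : R -> V) (f : V -> W) :
  A `<=` B -> {within B, continuous g} ->
  (forall t (F : set_system R), Filter F -> A t -> g @ F --> g t ->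
     (f \o g) @ F --> f (g t)) ->
  {within A, continuous (f \o g)}.
Proof.
move=> AB /subspace_continuousP cg h; apply/subspace_continuousP => t At.
have FA : Filter (within A (nbhs t)) by exact: _.
have c : g @ within A (nbhs t) --> g t.
  move=> U Ug; have c' : nbhs t [set s | B s -> U (g s)] := cg t (AB _ At) U Ug.
  by change (nbhs t [set s | A s -> U (g s)]); apply: filterS c' => s hs /AB/hs.
exact (h t _ FA At c).
Qed.

End Within.

Section Horizontal.
Variables (R : realType) (n : nat).
Local Notation C := R[i]%C.
Local Notation E := 'M[C]_n.+1.
Local Notation orbit := (@orbit_H0 R n).
Variable h : 'I_n.+1 -> R.
Hypothesis h_sum : \sum_i h i = 0.
Local Notation N := (n.+1%:R : R).

(** On the tangent space of the orbit, [fH] is up to a factor the Hermitian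
    product with the gradient; hence a vector orthogonal to the kernel of
    [fH] is a complex multiple of the gradient, and a real one if [fH] takes
    a real value on it. *)
Lemma horizontal_gradient (y u G : E) : orbit y -> ~ critical h y ->
  is_gradient (f1 h) y G -> horizontal h y u -> Im (fH h u) = 0 ->
  exists b : R, u = b%:C%C *: G.
Proof.
move=> hy ncr hG [tu hu] im0; have tG : tangent_orbit y G by case: hG.
have fE v : fH h v = 2 * n.+1%:R * \tr (diagH h *m v) by rewrite fHE // mxtrace_diagH.
have adj0 : adjmx (0 : E) = 0 by apply/matrixP => a b; rewrite adjmxE !mxE conjc0.
pose g2 := \sum_k \sum_l nsq (G k l).
have trG : \tr (diagH h *m G) = g2%:C%C by rewrite mxtrace_diagH (gradient_norm h_sum hy hG).
have g20 : g2 != 0.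
  apply/eqP => g0; apply: ncr; split=> // v tv; rewrite derive_fH// fE.
  have G0 : G = 0 by apply: mxtrace_adj_eq0; rewrite mxtrace_adj_sq -/g2 g0.
  by rewrite (gradient_pairing h_sum hy hG tv) G0 adj0 mul0mx mxtrace0 mulr0.
pose b := Re (\tr (diagH h *m u)) / g2.
have N0 : 2 * N != 0 by rewrite mulf_neq0 ?pnatr_eq0.
have tru : \tr (diagH h *m u) = (b * g2)%:C%C.
  move: im0; rewrite fE real_2N Im_real => /eqP; rewrite mulf_eq0 (negbTE N0) /= => /eqP i0.
  by rewrite /b divfK//; apply: complex_ext.
pose v := u - b%:C%C *: G.
have tv : tangent_orbit y v.
  by apply: tangent_orbitD => //; rewrite -scaleNr; exact: tangent_orbitZ.
have trv : \tr (diagH h *m v) = 0.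
  by rewrite mulmxBr mxtraceB -scalemxAr mxtraceZ tru trG real_complexM subrr.
have fv (c : C) : 'D_(c *: v) (fH h) y = 0.
  by rewrite derive_fH// fE -scalemxAr mxtraceZ trv !mulr0.
have Om_v (c : C) : Omega u (c *: v) = 0.
  by apply: hu => //; exact: tangent_orbitZ.
have uv : \tr (adjmx v *m u) = 0.
  have hv (c : C) : Omega u (c *: v) = 2 * N * Im (conjc c * \tr (adjmx v *m u)).
    rewrite /Omega /herm_tau /tau killingE.
    have -> : \tr (- adjmx (c *: v)) = 0.
      by rewrite raddfN /= mxtrace_adj mxtraceZ (tangent_trace0 tv) mulr0 conjc0 oppr0.
    have -> : \tr (u *m - adjmx (c *: v)) = - \tr (u *m adjmx (c *: v)).
      by rewrite mulmxN raddfN.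
    rewrite mulr0 subr0 mulrN opprK adjmxZ -scalemxAr mxtraceZ.
    by rewrite real_2N Im_real mxtrace_mulC.
  have i1 : Im (\tr (adjmx v *m u)) = 0.
    move/eqP: (Om_v 1); rewrite hv mulf_eq0 (negbTE N0) conjc1 mul1r => /eqP //.
  have i2 : Re (\tr (adjmx v *m u)) = 0.
    move/eqP: (Om_v 'i%C); rewrite hv mulf_eq0 (negbTE N0) ImM /= mul0r add0r.
    by rewrite mulN1r oppr_eq0 => /eqP.
  exact: complex_ext.
suff v0 : v = 0 by exists b; apply/eqP; rewrite -subr_eq0 -/v v0.
apply: mxtrace_adj_eq0.
rewrite {2}/v mulmxBr mxtraceB uv -scalemxAr mxtraceZ.
have -> : \tr (adjmx v *m G) = conjc (\tr (adjmx G *m v)) by rewrite -mxtrace_adjM mxtrace_mulC.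
by rewrite -(gradient_pairing h_sum hy hG tv) trv conjc0 mulr0 subr0.
Qed.

End Horizontal.

Section Transport.
Variables (R : realType) (n : nat).
Local Notation C := R[i]%C.
Local Notation E := 'M[C]_n.+1.
Local Notation N := (n.+1%:R : R).
Variable h : 'I_n.+1 -> R.
Hypothesis h_sum : \sum_i h i = 0.
Variables (j : 'I_n.+1) (eps : 'I_n.+1 -> R).
Hypothesis eps_sign : forall k, eps k = 1 \/ eps k = -1.
Hypothesis eps_h : forall k, k != j -> eps k * (h k - h j) < 0.
Hypothesis eps_j : eps j = 1.
Local Notation lc x k := (lincoord j eps x k).
Local Notation rt k := (rate h j eps k).

Lemma model_j_neq0 (x : E) : model eps j x -> proj x j j != 0.
Proof.
move=> [q [_ q2 q3 Pq]]; rewrite (model_diag_j eps_j q3 Pq) real_complex_eq0.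
by rewrite sqrf_eq0 gt_eqF.
Qed.

Lemma lincoord_model_j (x : E) : model eps j x -> lc x j = 1.
Proof. by move=> [q [_ q2 q3 Pq]]; exact: (lincoord_j eps_j q2 q3 Pq). Qed.

Lemma model_flow0 (x : E) : model eps j x -> flow h j eps (lincoord j eps x) 0 = x.
Proof. by move=> [q [q1 q2 q3 Pq]]; exact: (flow_lincoord eps_sign eps_j q1 q2 q3 Pq). Qed.

(** A curve with a velocity parallel to the gradient linearises in the
    coordinates [lincoord], up to a common time factor. *)
Lemma lincoord_cderive (gamma : R -> E) (t b : R) (G : E) :
  model eps j (gamma t) -> is_gradient (f1 h) (gamma t) G ->
  is_derive t 1 (realify \o gamma) (realify (b%:C%C *: G)) ->
  exists rho : R, forall k, cderive (fun s => lc (gamma s) k) t 1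
    ((rt k * rho)%:C%C * lc (gamma t) k).
Proof.
move=> mx hG dg; have pj0 := model_j_neq0 mx.
have [q [q1 q2 q3 Pq]] := mx.
have [mu [c [Om [OmE Om0 Omc]]]] := model_rates h eps_sign q1.
have hG' := model_gradient h_sum eps_sign q1 Pq OmE Om0 Omc.
have GE := gradient_uniq h_sum (model_orbit q1 Pq) hG hG'.
set s := \sum_k nsq (q k) in Omc hG' GE.
have s0 : s != 0 by rewrite gt_eqF// (lt_le_trans ltr01)// (model_norm_ge1 eps_sign q1).
pose rho : R := N^-1 * b * s^-1; exists rho => k.
have dP k' l : cderive (fun s => proj (gamma s) k' l) t 1
    (((Om k' + Om l) * rho)%:C%C * proj (gamma t) k' l).
  apply: cderive_eq (proj_cderive k' l dg) _.
  have -> : (Om k' + Om l) * rho = N^-1 * (b * ((Om k' + Om l) / s)).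
    by rewrite /rho; ring.
  by rewrite GE mxZE mxE real_invN !real_complexM !mulrA.
have cc k' : Om k' = eps k' * (h k' - mu) - c by exact: OmE.
rewrite /lincoord; case: (eps_sign k) => ek; rewrite ek.
  rewrite eqxx; apply: cderive_eq (cderiveM (dP k j) (cderiveV pj0 (dP j j))) _.
  have -> : rt k * rho = (Om k + Om j) * rho - (Om j + Om j) * rho.
    by rewrite /rate !cc ek eps_j; ring.
  by rewrite real_complexB; field.
have -> : (-1 == 1 :> R) = false by apply/negbTE; rewrite lt_eqF// ltrN10.
have dS : cderive (fun s => \sum_i (eps i)%:C%C * proj (gamma s) i i) t 1
    (((2 * c) * rho)%:C%C * \sum_i (eps i)%:C%C * proj (gamma t) i i).
  apply: cderive_eq (cderive_sum _ (fun i => cderiveZ (eps i)%:C%C (dP i i))) _.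
  rewrite (model_wtrace eps_sign Pq) -/s -real_complexM.
  have -> : 2 * c * rho * s = \sum_i 2 * rho * (Om i * nsq (q i)).
    by rewrite -mulr_sumr Omc; ring.
  rewrite real_sum; apply: eq_bigr => i _; rewrite Pq -nsqE -!real_complexM.
  congr (_%:C%C); transitivity (eps i * eps i * (2 * rho * (Om i * nsq (q i)))); first ring.
  by rewrite eps_sq// mul1r.
apply: cderive_eq (cderiveM dS (dP k j)) _.
have -> : rt k * rho = 2 * c * rho + (Om k + Om j) * rho.
  by rewrite /rate !cc ek eps_j; ring.
by rewrite real_complexD; ring.
Qed.

End Transport.

Section CommonTime.
Variable R : realType.
Local Notation C := R[i]%C.

(** Decoupled linear equations [z_k' = r_k rho z_k] with a common factor
    [rho], about which nothing is known: the logarithm of one nonzero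
    coordinate serves as a time in which all coordinates are exponentials. *)
Lemma common_time (I : Type) (z : I -> R -> C) (r : I -> R) (k0 : I) (b : R) :
  0 <= b -> r k0 != 0 ->
  (forall k, {within `[0, b], continuous (fun t => Re (z k t))}) ->
  (forall k, {within `[0, b], continuous (fun t => Im (z k t))}) ->
  (forall t, 0 < t < b -> exists rho : R, forall k,
     cderive (z k) t 1 ((r k * rho)%:C%C * z k t)) ->
  (forall t, 0 <= t <= b -> z k0 t != 0) ->
  exists th : R, forall k, z k b = (expR (r k * th))%:C%C * z k 0.
Proof.
move=> b0 r0 cR cI dz z0.
pose g t := nsq (z k0 t); have g0 t : 0 <= t <= b -> 0 < g t.
  by move=> tb; rewrite lt0r nsq_eq0 z0// nsq_ge0.
have i0 : (0 : R) <= (0 : R) <= b by rewrite lexx.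
pose th t := (2 * r k0)^-1 * ln ((g 0)^-1 * g t).
have th0 : th 0 = 0 by rewrite /th mulVf ?gt_eqF ?g0// ln1 mulr0.
have cth t : `[0, b]%classic t -> th @ within `[0, b]%classic (nbhs t) --> th t.
  move=> tb; apply: cvgM; first exact: cvg_cst.
  have tb' : 0 <= t <= b by move: tb; rewrite /= in_itv.
  have gt0 : 0 < (g 0)^-1 * g t by rewrite mulr_gt0 ?invr_gt0 ?g0.
  apply: (continuous_cvg _ (continuous_ln gt0)).
  apply: cvgM; first exact: cvg_cst.
  have /subspace_continuousP/(_ t tb) c1 := cR k0.
  have /subspace_continuousP/(_ t tb) c2 := cI k0.
  by rewrite /g /nsq; apply: cvgD; apply: cvgM.
pose e k t := expR (- r k * th t).
have ce k t : `[0, b]%classic t -> e k @ within `[0, b]%classic (nbhs t) --> e k t.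
  move=> tb; apply: (continuous_cvg _ (@continuous_expR R _)).
  by apply: cvgM; [exact: cvg_cst|exact: cth].
have dth t : 0 < t < b -> exists rho : R, is_derive t 1 th rho /\
    forall k, cderive (z k) t 1 ((r k * rho)%:C%C * z k t).
  move=> tb; have [rho hrho] := dz t tb; exists rho; split=> //.
  have tb' : 0 <= t <= b by move: tb => /andP[/ltW -> /ltW ->].
  have gt0 := g0 t tb'; have gi0 := g0 0 i0.
  have [d1 d2] := hrho k0.
  have dn : is_derive t 1 g (2 * (r k0 * rho) * g t).
    apply: is_derive_eq (is_deriveD (is_derive_mul d1 d1) (is_derive_mul d2 d2)) _.
    by rewrite Re_real Im_real /g /nsq; ring.
  have dg : is_derive t 1 (fun s => (g 0)^-1 * g s) (2 * (r k0 * rho) * ((g 0)^-1 * g t)).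
    by apply: is_derive_eq (is_derive_scal _ dn) _; ring.
  have gg : 0 < (g 0)^-1 * g t by rewrite mulr_gt0 ?invr_gt0.
  have dl := @is_derive1_comp R (@ln R) (fun s => (g 0)^-1 * g s) t _ _ (is_derive1_ln gg) dg.
  apply: is_derive_eq (is_derive_scal (2 * r k0)^-1 dl) _.
  move: ((g 0)^-1 * g t) gg => G G0.
  by field; rewrite r0 gt_eqF.
have de k t : 0 < t < b -> cderive (fun s => (e k s)%:C%C * z k s) t 1 0.
  move=> tb; have [rho [drho dk]] := dth t tb.
  have d0 : is_derive t 1 (fun s => - r k * th s) (- r k * rho) := is_derive_scal _ drho.
  have d1 : is_derive t 1 (e k) _ :=
    @is_derive1_comp R (@expR R) (fun s => - r k * th s) t _ _ (is_derive_expR _) d0.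
  apply: cderive_eq (cderiveM (cderive_real d1) (dk k)) _.
  have -> : expR (- r k * th t) * (- r k * rho) = 0 - e k t * (r k * rho).
    by rewrite /e; ring.
  rewrite real_complexB (_ : (0 : R)%:C%C = 0)// [(e k t * _)%:C%C]real_complexM; ring.
exists (th b) => k.
suff : (e k b)%:C%C * z k b = (e k 0)%:C%C * z k 0.
  rewrite /e th0 mulr0 expR0 mul1r => <-.
  by rewrite mulrA -real_complexM -expRD mulNr subrr expR0 mul1r.
apply: complex_ext; rewrite !(Re_real, Im_real).
  apply/esym; apply: (const_on b0 (f := fun t => e k t * Re (z k t))).
    apply/subspace_continuousP => t tb; apply: cvgM; first exact: ce.
    by have /subspace_continuousP/(_ t tb) := cR k.
  move=> t tb; have [d _] := de k t tb.
  have -> : (fun t => e k t * Re (z k t)) = fun s => Re ((e k s)%:C%C * z k s).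
    by apply/funext => s; rewrite Re_real.
  exact: d.
apply/esym; apply: (const_on b0 (f := fun t => e k t * Im (z k t))).
  apply/subspace_continuousP => t tb; apply: cvgM; first exact: ce.
  by have /subspace_continuousP/(_ t tb) := cI k.
move=> t tb; have [_ d] := de k t tb.
have -> : (fun t => e k t * Im (z k t)) = fun s => Im ((e k s)%:C%C * z k s).
  by apply/funext => s; rewrite Im_real.
exact: d.
Qed.

End CommonTime.

Lemma half_lt (R : realType) (r : R) : 0 < r -> r / 2 < r.
Proof. by move=> r0; lra. Qed.

Section TransportFlow.
Variables (R : realType) (n : nat).
Local Notation C := R[i]%C.
Local Notation E := 'M[C]_n.+1.
Variable h : 'I_n.+1 -> R.
Hypothesis h_sum : \sum_i h i = 0.
Variables (j : 'I_n.+1) (eps : 'I_n.+1 -> R).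
Hypothesis eps_sign : forall k, eps k = 1 \/ eps k = -1.
Hypothesis eps_h : forall k, k != j -> eps k * (h k - h j) < 0.
Hypothesis eps_j : eps j = 1.
Local Notation lc x k := (lincoord j eps x k).
Local Notation rt k := (rate h j eps k).
Variable gamma : R -> E.
Hypothesis gamma_model : forall t, 0 <= t < 1 -> model eps j (gamma t).
Hypothesis gamma_crit : forall t, 0 <= t < 1 -> gamma t <> crit_pt R j.
Hypothesis gamma_cont : {within [set t : R | 0 <= t < 1], continuous gamma}.
Hypothesis gamma_ode : forall t, 0 < t < 1 -> exists rho : R, forall k,
  cderive (fun s => lc (gamma s) k) t 1 ((rt k * rho)%:C%C * lc (gamma t) k).

Lemma seg_sub (b : R) : b < 1 -> `[0, b]%classic `<=` [set t : R | 0 <= t < 1].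
Proof. by move=> b1 t; rewrite /= in_itv /= => /andP[-> /le_lt_trans]; apply. Qed.

Lemma lc_within (b : R) k : b < 1 ->
  {within `[0, b], continuous (fun t => Re (lc (gamma t) k))} /\
  {within `[0, b], continuous (fun t => Im (lc (gamma t) k))}.
Proof.
move=> b1; have c (t : R) (F : set_system R) (FF : Filter F) : `[0, b]%classic t ->
    gamma @ F --> gamma t -> (fun s => lc (gamma s) k) @ F --> lc (gamma t) k.
  move=> tb; apply: lincoord_cvg; apply: (model_j_neq0 eps_j).
  exact: gamma_model (seg_sub b1 tb).
split.
  apply: (within_map (f := fun x => Re (lc x k)) (seg_sub b1) gamma_cont).
  by move=> t F FF tb /(c t F FF tb)/complex_cvgP[].
apply: (within_map (f := fun x => Im (lc x k)) (seg_sub b1) gamma_cont).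
by move=> t F FF tb /(c t F FF tb)/complex_cvgP[].
Qed.

Let zeta_j : lc (gamma 0) j = 1.
Proof. by apply: (lincoord_model_j eps_j); apply: gamma_model; rewrite lexx ltr01. Qed.

Lemma flow_of_nonvanishing (b : R) k0 : k0 != j -> 0 <= b < 1 ->
  (forall t, 0 <= t <= b -> lc (gamma t) k0 != 0) ->
  exists th, gamma b = flow h j eps (lincoord j eps (gamma 0)) th.
Proof.
move=> k0j /andP[b0 b1] nv.
have r0 : rt k0 != 0 by rewrite lt_eqF// eps_h.
have ode t : 0 < t < b -> exists rho : R, forall k,
    cderive (fun s => lc (gamma s) k) t 1 ((rt k * rho)%:C%C * lc (gamma t) k).
  by move=> /andP[t0 tb]; apply: gamma_ode; rewrite t0 (lt_trans tb).
have [th hth] := common_time (z := fun k s => lc (gamma s) k) b0 r0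
  (fun k => (lc_within k b1).1) (fun k => (lc_within k b1).2) ode nv.
exists th; apply: (lincoord_inj eps_sign eps_j).
- by apply: gamma_model; rewrite b0.
- exact: (flow_model h eps_sign eps_j zeta_j).
- by move=> k; rewrite hth (lincoord_flow eps_sign eps_j h th k zeta_j).
Qed.

(** A coordinate that vanishes for the first time at time [b] would force the
    trajectory to run through infinite time before [b], that is to approach
    the critical point; but the height of [gamma b] stays below the critical
    one. *)
Lemma nonvanishing (b : R) k0 : k0 != j -> 0 <= b < 1 ->
  lc (gamma 0) k0 != 0 -> lc (gamma b) k0 != 0.
Proof.
move=> k0j /andP[b0 b1] z0; apply/eqP => zb.
pose g t := nsq (lc (gamma t) k0).
have cg : {within `[0, b], continuous g}.
  have [/subspace_continuousP c1 /subspace_continuousP c2] := lc_within k0 b1.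
  apply/subspace_continuousP => t tb; rewrite /g /nsq.
  by apply: cvgD; apply: cvgM; [exact: c1|exact: c1|exact: c2|exact: c2].
have gb : g b = 0 by rewrite /g zb nsq0.
have g00 : 0 < g 0 by rewrite lt0r nsq_eq0 z0 nsq_ge0.
have [c [c0 cb gc gpos]] := first_zero b0 cg (fun t _ => nsq_ge0 _) g00 gb.
have c1 : c < 1 := le_lt_trans cb b1.
have c01 : 0 <= c < 1 by rewrite (ltW c0).
have nontriv : exists2 k, k != j & lc (gamma 0) k != 0 by exists k0.
pose v := height (gamma c) h.
have vj : v < h j.
  rewrite lt_neqAle (height_le eps_h (gamma_model c01)) andbT; apply/eqP => e.
  exact: (gamma_crit c01 (height_max_crit eps_h eps_j (gamma_model c01) e)).
pose F t := height (flow h j eps (lincoord j eps (gamma 0)) t) h.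
have [T FT] : exists T, v < F T.
  have /cvgrPdist_lt/(_ (h j - v)) := height_flow_lim eps_h eps_j zeta_j.
  rewrite subr_gt0 => /(_ vj) /pinfty_ex_gt0[T _]; rewrite -/(F T) => hT.
  by exists T; move: hT; rewrite ltr_norml => /andP[_]; rewrite ltrD2l ltrN2.
have ch : {within `[0, b], continuous (fun t => height (gamma t) h)}.
  apply: (within_map (f := fun x => height x h) (seg_sub b1) gamma_cont).
  by move=> t G FG tb; exact: height_cvg.
have cI : `[0, b]%classic c by rewrite /= in_itv /= (ltW c0).
have e1 : 0 < F T - v by rewrite subr_gt0.
have e2 : 0 < flow_exp h j eps k0 T ^+ 2 * g 0.
  by rewrite mulr_gt0// exprn_gt0// flow_exp_gt0.
have [d1 d10 hd1] := within_dist ch cI e1.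
have [d2 d20 hd2] := within_dist cg cI e2.
pose d := Num.min (c / 2) (Num.min (d1 / 2) (d2 / 2)).
have d0 : 0 < d by rewrite !lt_min !divr_gt0.
have dc : d <= c / 2 by rewrite ge_min lexx.
have dd1 : d <= d1 / 2 by rewrite !ge_min lexx orbT.
have dd2 : d <= d2 / 2 by rewrite !ge_min lexx !orbT.
pose t := c - d.
have t0c : 0 <= t < c.
  by rewrite subr_ge0 (le_trans dc (ltW (half_lt c0))) ltrBlDr ltrDl.
have tI : `[0, b]%classic t.
  rewrite /= in_itv /=; have /andP[-> /ltW tc] := t0c; exact: le_trans cb.
have tc : `|t - c| = d by rewrite /t addrAC subrr add0r normrN gtr0_norm.
have := hd1 t tI; rewrite tc => /(_ (le_lt_trans dd1 _)).
have := hd2 t tI; rewrite tc => /(_ (le_lt_trans dd2 _)).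
move=> /(_ (half_lt d20)) + /(_ (half_lt d10)).
rewrite gc subr0 ger0_norm ?nsq_ge0// => gt /ltr_normlW hlt.
have [| |th eth] := @flow_of_nonvanishing t k0 k0j.
- by have /andP[-> tc'] := t0c; rewrite (lt_trans tc').
- move=> s /andP[s0 st]; rewrite -nsq_eq0; apply: lt0r_neq0.
  have sc : 0 <= s < c by rewrite s0; have /andP[_] := t0c; apply: le_lt_trans.
  exact (gpos s sc).
have gE : g t = flow_exp h j eps k0 th ^+ 2 * g 0.
  by rewrite /g eth (lincoord_flow eps_sign eps_j h th k0 zeta_j) nsqM nsq_real.
move: gt; rewrite gE ltr_pM2r// ltr_pXn2r ?nnegrE ?(ltW (flow_exp_gt0 _ _ _ _ _))//.
rewrite ltr_expR ltr_nM2l ?eps_h// => Tth.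
have := height_flow_mono h_sum eps_sign eps_h eps_j zeta_j nontriv Tth.
rewrite -eth -/(F T) => FTlt; move: hlt; rewrite ltrD2r ltNge => /negP; apply.
exact: ltW.
Qed.

Lemma transport_flow (t : R) : 0 <= t < 1 ->
  exists th, gamma t = flow h j eps (lincoord j eps (gamma 0)) th.
Proof.
move=> t01; have o01 : (0 : R) <= (0 : R) < 1 by rewrite lexx ltr01.
have [k0 k0j z0] := model_nontrivial eps_sign eps_j (gamma_model o01) (gamma_crit o01).
apply: (flow_of_nonvanishing k0j t01) => s /andP[s0 st].
by apply: nonvanishing => //; rewrite s0; have /andP[_] := t01; apply: le_lt_trans.
Qed.

End TransportFlow.

Lemma unit_sphere_nonempty (R : realType) k : (0 < k)%N ->
  exists u : 'rV[R]_k, unit_sphere u.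
Proof.
case: k => // k _; exists (delta_mx 0 0).
rewrite /unit_sphere /= (bigD1 0)//= mxE !eqxx expr1n big1 ?addr0// => i i0.
by rewrite mxE (negbTE i0) andbF expr0n.
Qed.

Lemma flow_expD (R : realType) n (h eps : 'I_n.+1 -> R) j k (a b : R) :
  flow_exp h j eps k (a + b) = flow_exp h j eps k a * flow_exp h j eps k b.
Proof. by rewrite /flow_exp mulrDr expRD. Qed.

Section ThimbleLevels.
Variables (R : realType) (n : nat).
Local Notation C := R[i]%C.
Local Notation E := 'M[C]_n.+1.
Variable h : 'I_n.+1 -> R.
Hypothesis h_sum : \sum_i h i = 0.
Variables (j : 'I_n.+1) (eps : 'I_n.+1 -> R).
Hypothesis eps_sign : forall k, eps k = 1 \/ eps k = -1.
Hypothesis eps_h : forall k, k != j -> eps k * (h k - h j) < 0.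
Hypothesis eps_j : eps j = 1.
Local Notation N := (n.+1%:R : R).
Local Notation K := (2 * N * N).
Local Notation xj := (crit_pt R j).

Variables (alpha : R -> C) (P : 'rV[R]_n.*2 -> R -> E).
Hypothesis n0 : (0 < n)%N.
Hypothesis vp : vanishing_path h xj alpha.
Hypothesis lift : forall u, unit_sphere u -> horizontal_lift h alpha (P u).
Hypothesis P_model : forall u t, unit_sphere u -> 0 <= t < 1 -> model eps j (P u t).

(** Since [fH] is real on the model, the path in the base is real. *)
Definition level (t : R) : R := K^-1 * Re (alpha t).

Let K0 : K != 0. Proof. by rewrite !mulf_neq0 ?pnatr_eq0. Qed.

Lemma fH_transport u t : unit_sphere u -> 0 <= t < 1 -> fH h (P u t) = alpha t.
Proof. by move=> hu ht; have [_ /(_ t ht)[]] := lift hu. Qed.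

Lemma height_transport u t : unit_sphere u -> 0 <= t < 1 ->
  height (P u t) h = level t.
Proof.
move=> hu ht; rewrite /level -(fH_transport hu ht) (fH_model h_sum (P_model hu ht)) /=.
by rewrite mulKf.
Qed.

Lemma level1 : level 1 = h j.
Proof. by rewrite /level; have [_ _ _ _ ->] := vp; rewrite fH_crit//= mulKf. Qed.

Lemma alphaE t : 0 <= t <= 1 -> alpha t = (K * level t)%:C%C.
Proof.
move=> /andP[t0 t1]; have [u hu] : exists u : 'rV[R]_n.*2, unit_sphere u.
  by apply: unit_sphere_nonempty; rewrite double_gt0.
have [t1'|t1'] := ltP t 1.
  have ht : 0 <= t < 1 by rewrite t0.
  by rewrite -(fH_transport hu ht) (fH_model h_sum (P_model hu ht)) (height_transport hu ht).
have -> : t = 1 by apply/eqP; rewrite eq_le t1 t1'.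
by rewrite level1; have [_ _ _ _ ->] := vp; rewrite fH_crit.
Qed.

Lemma level_inj s t : 0 <= s <= 1 -> 0 <= t <= 1 -> level s = level t -> s = t.
Proof.
move=> hs ht e; have [_ _ inj _ _] := vp; apply: inj => //.
by rewrite !alphaE// e.
Qed.

Lemma level_continuous a : 0 <= a -> {within `[a, 1], continuous level}.
Proof.
move=> a0; have [/subspace_continuousP c _ _ _ _] := vp.
have c01 : {within `[0, 1], continuous level}.
  apply/subspace_continuousP => t ht.
  have FF : Filter (within `[0, 1]%classic (nbhs t)) by exact: _.
  have /complex_cvgP[c1 _] := c t ht.
  by apply: cvgM; [exact: cvg_cst|exact: c1].
apply: continuous_subspaceW c01 => t; rewrite /= !in_itv /= => /andP[at_ ->].
by rewrite (le_trans a0).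
Qed.

Lemma transport_noncritical u t : unit_sphere u -> 0 <= t < 1 -> ~ critical h (P u t).
Proof.
by move=> hu ht; have [_ _ _ nc _] := vp; apply: (nc t) => //; exact: fH_transport.
Qed.

Lemma transport_neq_crit u t : unit_sphere u -> 0 <= t < 1 -> P u t <> xj.
Proof.
move=> hu ht e; apply: (transport_noncritical hu ht); rewrite e.
exact: crit_critical.
Qed.

Lemma level0_lt : level 0 < h j.
Proof.
have [u hu] : exists u : 'rV[R]_n.*2, unit_sphere u.
  by apply: unit_sphere_nonempty; rewrite double_gt0.
have h0 : (0 : R) <= (0 : R) < 1 by rewrite lexx ltr01.
rewrite lt_neqAle -{2}(height_transport hu h0) (height_le eps_h (P_model hu h0)) andbT.
apply/eqP; rewrite -level1 => e; have /eqP : (0 : R) = 1.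
  by apply: level_inj e; rewrite ?lexx ?ler01.
by rewrite eq_sym oner_eq0.
Qed.

Lemma level_reaches a v : 0 <= a <= 1 -> level a <= v < h j ->
  exists2 t, a <= t < 1 & level t = v.
Proof.
move=> /andP[a0 a1] /andP[av vj].
have v1 : v <= level 1 by rewrite level1 ltW.
have [t /andP[at_ t1] e] := ivt_seg a1 (level_continuous a0) av v1.
exists t => //; rewrite at_ lt_neqAle t1 andbT.
by apply: contraTneq vj => t1'; rewrite -e t1' level1 ltxx.
Qed.

(** The path avoids the critical values before its end. *)
Lemma level0_gt k : h k < h j -> h k < level 0.
Proof.
move=> hk; rewrite ltNge; apply/negP => le.
have [||t /andP[t0 t1] e] := @level_reaches 0 (h k).
- by rewrite lexx ler01.
- by rewrite le hk.
have [_ _ _ nc _] := vp; apply: (nc t (crit_pt R k)).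
- by rewrite t0.
- by rewrite fH_crit// alphaE ?t0 ?(ltW t1)// e.
- exact: crit_critical.
Qed.

Lemma level_ge t : 0 <= t < 1 -> level 0 <= level t.
Proof.
move=> /andP[t0 t1]; rewrite leNgt; apply/negP => lt.
have [||s /andP[ts s1] e] := @level_reaches t (level 0).
- by rewrite t0 ltW.
- by rewrite (ltW lt) level0_lt.
have s0 : s = 0.
  by apply: level_inj e; rewrite ?lexx ?ler01// (le_trans t0 ts) ltW.
by move: lt; have -> : t = 0; [apply/eqP; rewrite eq_le t0 -{1}s0 ts|rewrite ltxx].
Qed.

Lemma transport_ode u t : unit_sphere u -> 0 < t < 1 -> exists rho : R, forall k,
  cderive (fun s => lincoord j eps (P u s) k) t 1
    ((rate h j eps k * rho)%:C%C * lincoord j eps (P u t) k).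
Proof.
move=> hu ht; have [_ hl /(_ t ht)[v hv dv]] := lift hu.
have ht' : 0 <= t < 1 by move: ht => /andP[/ltW -> ->].
have mx := P_model hu ht'.
have [q [q1 q2 q3 Pq]] := mx.
have [mu [c [Om [OmE Om0 Omc]]]] := model_rates h eps_sign q1.
have hG := model_gradient h_sum eps_sign q1 Pq OmE Om0 Omc.
have im0 : Im (fH h v) = 0.
  have dk k : cderive (fun s => P u s k k) t 1 (v k k).
    have /realify_is_deriveP/(_ k k) := dv; exact.
  have [_ dI] := cderiveZ (2 * n.+1%:R) (cderive_sum xpredT
     (fun k => cderiveZ (h k)%:C%C (dk k))).
  rewrite -fHE// in dI.
  have <- := @derive_val _ _ _ _ _ _ _ dI.
  rewrite (near_eq_derive (g := cst 0)); first exact: derive_cst.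
  near=> s; rewrite -fHE//.
  have hs : 0 <= s < 1.
    apply/andP; split; near: s; move: ht => /andP[t0 t1].
      by apply: filterS (lt_nbhsr t0) => s /ltW.
    exact: lt_nbhsl.
  by rewrite (fH_model h_sum (P_model hu hs)).
have [b vb] := horizontal_gradient h_sum (model_orbit q1 Pq)
  (transport_noncritical hu ht') hG hv im0.
by apply: (lincoord_cderive h_sum eps_sign eps_j mx hG (b := b)); rewrite -vb.
Unshelve. all: by end_near. Qed.

(** If the sphere fills its level set, the thimble fills the part of the
    stable manifold above that level: the trajectory of any point of it,
    followed backwards, meets the level of the sphere. *)
Lemma thimble_fills :
  (forall y, model eps j y -> height y h = level 0 ->
     exists2 u, unit_sphere u & P u 0 = y) ->
  [set y | y = xj \/ exists u t, [/\ unit_sphere u, 0 <= t < 1 & y = P u t]] =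
  [set y | model eps j y /\ level 0 <= height y h].
Proof.
move=> surj; apply/seteqP; split=> y /=.
  move=> [->|[u [t [hu ht ->]]]].
    by split; [exact: crit_model|rewrite height_crit ltW// level0_lt].
  by split; [exact: P_model|rewrite height_transport// level_ge].
move=> [my hy]; have [->|yc] := pselect (y = xj); [by left|right].
pose z := lincoord j eps y; have zj : z j = 1 by exact: (lincoord_model_j eps_j).
have nontriv := model_nontrivial eps_sign eps_j my yc.
have y0 := model_flow0 h eps_sign eps_j my.
have hyj : height y h < h j.
  rewrite lt_neqAle (height_le eps_h my) andbT; apply/eqP => e.
  exact: yc (height_max_crit eps_h eps_j my e).
have hy0 : level 0 <= height (flow h j eps z 0) h by rewrite y0.
have [t t0 ht] := height_flow_reaches h_sum eps_sign eps_h eps_j zj nontriv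
  level0_gt level0_lt hy0.
have [u hu uE] := surj _ (flow_model h eps_sign eps_j zj t) ht.
have [||s /andP[s0 s1] sE] := @level_reaches 0 (height y h).
- by rewrite lexx ler01.
- by rewrite hy.
have hs : 0 <= s < 1 by rewrite s0.
exists u, s; split=> //.
have [th eth] := transport_flow h_sum eps_sign eps_h eps_j (gamma := P u)
  (fun t => P_model hu) (fun t => @transport_neq_crit u t hu)
  (let: And3 c _ _ := lift hu in c) (fun t => transport_ode hu) hs.
have eF : P u s = flow h j eps z (th + t).
  apply: (lincoord_inj eps_sign eps_j); first exact: P_model.
    exact: (flow_model h eps_sign eps_j zj).
  move=> k; rewrite eth uE; have fj : lincoord j eps (flow h j eps z t) j = 1.
    by rewrite (lincoord_flow eps_sign eps_j h t j zj) zj /flow_exp /rate subrr mulr0 mul0r expR0 mulr1.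
  have e2 := lincoord_flow eps_sign eps_j h t k zj.
  have e3 := lincoord_flow eps_sign eps_j h (th + t) k zj.
  apply: etrans (lincoord_flow eps_sign eps_j h th k fj) _.
  apply: etrans (congr1 _ e2) _; apply: etrans _ (esym e3).
  by rewrite flow_expD real_complexM mulrA.
have th0 : th + t = 0.
  apply: (height_flow_inj h_sum eps_sign eps_h eps_j zj nontriv).
  by rewrite -eF y0 height_transport.
by rewrite eF th0 y0.
Qed.

End ThimbleLevels.

(** * Maps of class C^k *)

Section CkClosure.
Variables (R : realType) (V : normedModType R).
Variable A : set V.
Hypothesis oA : open A.

Section Codomain.
Variable W : normedModType R.
Implicit Types f g : V -> W.

Lemma Ck_continuous k f x : Ck_on k A f -> A x -> {for x, continuous f}.
Proof. by case: k => [|k] [c _]; exact: c. Qed.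

Lemma Ck_congr k f g : (forall x, A x -> f x = g x) -> Ck_on k A f -> Ck_on k A g.
Proof.
have near_A f' g' x : (forall x, A x -> f' x = g' x) -> A x ->
    \forall y \near x, f' y = g' y.
  by move=> e Ax; apply: filterS (open_nbhs_nbhs (conj oA Ax)) => y; exact: e.
have cont f' g' x : (forall x, A x -> f' x = g' x) -> A x ->
    {for x, continuous f'} -> {for x, continuous g'}.
  move=> e Ax c; rewrite /prop_for /continuous_at -(e x Ax).
  exact: cvg_trans (near_eq_cvg (near_A _ _ _ e Ax)) c.
elim: k f g => [|k ih] f g e [c d].
  by split=> // x Ax; exact: cont e Ax (c x Ax).
split=> [x Ax|v]; first exact: cont e Ax (c x Ax).
have [d1 d2] := d v; split=> [x Ax|].
  exact: near_eq_derivable (near_A _ _ _ e Ax) (d1 x Ax).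
apply: ih d2 => x Ax; exact: near_eq_derive (near_A _ _ _ e Ax).
Qed.

Lemma Ck_pred k f : Ck_on k.+1 A f -> Ck_on k A f.
Proof.
elim: k f => [|k ih] f [c d]; first by split.
by split=> // v; have [d1 d2] := d v; split=> //; exact: ih.
Qed.

Lemma Ck_cst k (w : W) : Ck_on k A (fun=> w).
Proof.
elim: k w => [|k ih] w; first by split=> // x _; exact: cvg_cst.
split=> [x _|v]; first exact: cvg_cst.
split=> [x _|]; first exact: derivable_cst.
have e : (fun x : V => 'D_v (fun=> w) x) = fun=> 0 by apply/funext => x; exact: derive_cst.
by change (Ck_on k A (fun x : V => 'D_v (fun=> w) x)); rewrite e; exact: ih.
Qed.

Lemma CkD k f g : Ck_on k A f -> Ck_on k A g -> Ck_on k A (fun x => f x + g x).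
Proof.
elim: k f g => [|k ih] f g [cf df] [cg dg].
  by split=> // x Ax; apply: cvgD; [exact: cf|exact: cg].
split=> [x Ax|v]; first by apply: cvgD; [exact: cf|exact: cg].
have [f1 f2] := df v; have [g1 g2] := dg v; split=> [x Ax|].
  by apply: derivableD; [exact: f1|exact: g1].
apply: (Ck_congr (f := fun x => 'D_v f x + 'D_v g x)); last exact: ih.
by move=> x Ax; apply/esym; apply: deriveD; [exact: f1|exact: g1].
Qed.

End Codomain.

Implicit Types f g : V -> R.

Lemma CkM k f g : Ck_on k A f -> Ck_on k A g -> Ck_on k A (fun x => f x * g x).
Proof.
elim: k f g => [|k ih] f g hf hg; have [cf df] := hf; have [cg dg] := hg.
  by split=> // x Ax; apply: cvgM; [exact: cf|exact: cg].
split=> [x Ax|v]; first by apply: cvgM; [exact: cf|exact: cg].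
have [f1 f2] := df v; have [g1 g2] := dg v.
have D x : A x -> is_derive x v (fun x => f x * g x) ('D_v f x * g x + f x * 'D_v g x).
  move=> Ax; apply: is_derive_mul; apply/derivableP; [exact: f1|exact: g1].
split=> [x Ax|]; first by have [] := D x Ax.
apply: (Ck_congr (f := fun x => 'D_v f x * g x + f x * 'D_v g x)).
  by move=> x Ax; apply/esym; have [] := D x Ax.
by apply: CkD; apply: ih => //; exact: Ck_pred.
Qed.

Lemma CkV k f : (forall x, A x -> f x != 0) -> Ck_on k A f ->
  Ck_on k A (fun x => (f x)^-1).
Proof.
move=> f0; elim: k => [|k ih] hf; have [cf df] := hf.
  by split=> // x Ax; apply: cvgV; [exact: f0|exact: cf].
split=> [x Ax|v]; first by apply: cvgV; [exact: f0|exact: cf].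
have [f1 f2] := df v.
have D x : A x -> is_derive x v (fun x => (f x)^-1) ((-1 * 'D_v f x) * ((f x)^-1 * (f x)^-1)).
  move=> Ax; have := is_derive_inv (f0 x Ax) (derivableP (f1 x Ax)).
  by move=> d; apply: is_derive_eq d _; field; exact: f0.
split=> [x Ax|]; first by have [] := D x Ax.
apply: (Ck_congr (f := fun x => (-1 * 'D_v f x) * ((f x)^-1 * (f x)^-1))).
  by move=> x Ax; apply/esym; have [] := D x Ax.
have ihf := ih (Ck_pred hf).
by apply: CkM; apply: CkM => //; exact: Ck_cst.
Qed.

Lemma Ck_sum k (I : finType) (P : pred I) (F : I -> V -> R) :
  (forall i, Ck_on k A (F i)) -> Ck_on k A (fun x => \sum_(i | P i) F i x).
Proof.
move=> c; elim: (index_enum _) => [|i s ih].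
  by under eq_fun do rewrite big_nil; exact: Ck_cst.
under eq_fun do rewrite big_cons.
by case: (P i) => //; exact: CkD.
Qed.

Lemma Ck_pair (W1 W2 : normedModType R) k (f : V -> W1) (g : V -> W2) :
  Ck_on k A f -> Ck_on k A g -> Ck_on k A (fun x => (f x, g x)).
Proof.
elim: k f g => [|k ih] f g [cf df] [cg dg].
  by split=> // x Ax; apply: cvg_pair; [exact: cf|exact: cg].
split=> [x Ax|v]; first by apply: cvg_pair; [exact: cf|exact: cg].
have [f1 f2] := df v; have [g1 g2] := dg v.
have D x : A x -> is_derive x v (fun x => (f x, g x)) ('D_v f x, 'D_v g x).
  by move=> Ax; apply/is_derive_pairP; split; apply/derivableP; [exact: f1|exact: g1].
split=> [x Ax|]; first by have [] := D x Ax.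
apply: (Ck_congr (f := fun x => ('D_v f x, 'D_v g x))); last exact: ih.
by move=> x Ax; apply/esym; have [] := D x Ax.
Qed.

End CkClosure.

Section MatrixLimits.
Variables (R : realType) (T : Type) (F : set_system T).

Lemma real_mx_cvg {FF : Filter F} p q (f : T -> 'M[R]_(p, q)) (w : 'M[R]_(p, q)) :
  (forall i j, f t i j @[t --> F] --> w i j) -> f @ F --> w.
Proof.
move=> h; apply/cvg_ballP => e e0; rewrite near_simpl.
apply: filterS (_ : F [set t | forall i j, ball (w i j) e (f t i j)]).
  by move=> t ht; split.
apply: filter_forall => i; apply: filter_forall => j.
by have /cvg_ballP/(_ e e0) := h i j; rewrite near_simpl.
Qed.

End MatrixLimits.

Section CkMatrix.
Variables (R : realType) (V : normedModType R) (A : set V).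
Hypothesis oA : open A.

Lemma Ck_mx k p q (M : V -> 'M[R]_(p, q)) :
  (forall i j, Ck_on k A (fun x => M x i j)) -> Ck_on k A M.
Proof.
elim: k M => [|k ih] M h.
  by split=> // x Ax; apply: real_mx_cvg => i j; have [c _] := h i j; exact: c.
split=> [x Ax|v].
  by apply: real_mx_cvg => i j; have [c _] := h i j; exact: c.
have D x : A x -> is_derive x v M (\matrix_(i, j) 'D_v (fun x => M x i j) x).
  move=> Ax; apply/is_derive_mxP => i j; rewrite mxE; apply/derivableP.
  by have [_ /(_ v)[d _]] := h i j; exact: d.
split=> [x Ax|]; first by have [] := D x Ax.
apply: (Ck_congr oA (f := fun x => \matrix_(i, j) 'D_v (fun x => M x i j) x)).
  by move=> x Ax; apply/esym; have [] := D x Ax.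
apply: ih => i j; under eq_fun do rewrite mxE.
by have [_ /(_ v)[_]] := h i j.
Qed.

End CkMatrix.

Section CkCoordinate.
Variables (R : realType) (m : nat) (A : set 'rV[R]_m).

Lemma is_derive_coord (w c : 'rV[R]_m) i : is_derive w c (fun u : 'rV[R]_m => u 0 i) (c 0 i).
Proof. exact: (is_derive_mxP _ _ _ _).1 (is_derive_id w c) 0 i. Qed.

Lemma Ck_coord k i : Ck_on k A (fun u : 'rV[R]_m => u 0 i).
Proof.
have c x : {for x, continuous (fun u : 'rV[R]_m => u 0 i)} by exact: coord_continuous.
case: k => [|k]; first by split.
split=> [x _|v]; first exact: c.
split=> [x _|]; first by have [] := is_derive_coord x v i.
have e : (fun x : 'rV[R]_m => 'D_v (fun u : 'rV[R]_m => u 0 i) x) = fun=> v 0 i.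
  by apply/funext => x; have [] := is_derive_coord x v i.
change (Ck_on k A (fun x : 'rV[R]_m => 'D_v (fun u : 'rV[R]_m => u 0 i) x)).
by rewrite e; exact: Ck_cst.
Qed.

End CkCoordinate.

(** * Affine coordinates on the stable manifold *)

Section AffineChart.
Variables (R : realType) (n : nat).
Local Notation C := R[i]%C.
Local Notation E := 'M[C]_n.+1.
Local Notation V := 'rV[R]_n.*2.
Variables (h : 'I_n.+1 -> R) (j : 'I_n.+1) (eps : 'I_n.+1 -> R).
Hypothesis eps_sign : forall k, eps k = 1 \/ eps k = -1.
Hypothesis eps_h : forall k, k != j -> eps k * (h k - h j) < 0.
Hypothesis eps_j : eps j = 1.
Variable c0 : R.
Hypothesis c0_lt : c0 < h j.
Hypothesis c0_gt : forall k, h k < h j -> h k < c0.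

Definition re_idx (i : 'I_n) : 'I_n.*2 := cast_ord (addnn n) (lshift n i).
Definition im_idx (i : 'I_n) : 'I_n.*2 := cast_ord (addnn n) (rshift n i).

Lemma sum_re_im (F : 'I_n.*2 -> R) :
  \sum_m F m = \sum_i (F (re_idx i) + F (im_idx i)).
Proof.
rewrite (reindex (cast_ord (addnn n))) /=; first by rewrite big_split_ord big_split.
exists (cast_ord (esym (addnn n))) => m _; first by rewrite cast_ordK.
by rewrite cast_ordKV.
Qed.

Lemma idx_split (m : 'I_n.*2) : exists i, m = re_idx i \/ m = im_idx i.
Proof.
rewrite -(cast_ordKV (addnn n) m); case: (splitP (cast_ord (esym (addnn n)) m)) => i e.
  by exists i; left; congr cast_ord; apply: val_inj.
by exists i; right; congr cast_ord; apply: val_inj.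
Qed.

Definition weight k : R := - (eps k * (h k - c0)).

Lemma weight_gt0 k : k != j -> 0 < weight k.
Proof.
move=> kj; have := eps_h kj; rewrite /weight oppr_gt0.
case: (eps_sign k) => ->; rewrite ?mul1r ?mulN1r.
  by rewrite !subr_lt0 => /c0_gt.
by move: c0_lt => c e; lra.
Qed.

(** The semi-axes of the ellipsoid [height >= c0]. *)
Definition axis (i : 'I_n) : R := Num.sqrt ((h j - c0) / weight (lift j i)).

Lemma lift_neq i : lift j i != j.
Proof. by rewrite eq_sym neq_lift. Qed.

Lemma axis_arg_gt0 i : 0 < (h j - c0) / weight (lift j i).
Proof. by rewrite divr_gt0 ?subr_gt0// weight_gt0// lift_neq. Qed.

Lemma axis_gt0 i : 0 < axis i.
Proof. by rewrite sqrtr_gt0 axis_arg_gt0. Qed.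

Lemma axis_sq i : weight (lift j i) * axis i ^+ 2 = h j - c0.
Proof.
rewrite sqr_sqrtr; last exact/ltW/axis_arg_gt0.
by rewrite mulrC divfK// gt_eqF// weight_gt0// lift_neq.
Qed.

(** Homogeneous coordinates of the line, normalised by 1 in position [j]. *)
Definition homog (w : V) (k : 'I_n.+1) : C :=
  if unlift j k is Some i then (axis i)%:C%C * (w 0 (re_idx i) +i* w 0 (im_idx i))%C
  else 1.

Lemma homog_j w : homog w j = 1.
Proof. by rewrite /homog unlift_none. Qed.

Lemma homog_lift w i :
  homog w (lift j i) = (axis i)%:C%C * (w 0 (re_idx i) +i* w 0 (im_idx i))%C.
Proof. by rewrite /homog liftK. Qed.

Definition den (w : V) : R := \sum_k eps k * nsq (homog w k).

Definition chart (w : V) : E := n.+1%:R *: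
  (\matrix_(k, l) (homog w k * conjc (homog w l) * (eps l / den w)%:C%C)) - 1%:M.

Definition chart_dom : set V := [set w | 0 < den w].

Lemma proj_chart w k l :
  proj (chart w) k l = homog w k * conjc (homog w l) * (eps l / den w)%:C%C.
Proof. by rewrite /proj /chart subrK scalerA mulVf ?pnatr_eq0// scale1r mxE. Qed.

Lemma chart_q w k l : chart_dom w ->
  let q k := (Num.sqrt (den w)^-1)%:C%C * homog w k in
  proj (chart w) k l = q k * conjc (q l) * (eps l)%:C%C.
Proof.
move=> d0 q; rewrite proj_chart /q conjcM conjc_real.
have -> : eps l / den w = Num.sqrt (den w)^-1 * Num.sqrt (den w)^-1 * eps l.
  by rewrite -expr2 sqr_sqrtr ?invr_ge0 ?(ltW d0)// mulrC.
by rewrite !real_complexM; ring.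
Qed.

Lemma chart_q_constraint w : chart_dom w ->
  \sum_k eps k * nsq ((Num.sqrt (den w)^-1)%:C%C * homog w k) = 1.
Proof.
move=> d0; transitivity ((den w)^-1 * den w); last by rewrite mulVf// gt_eqF.
rewrite mulr_sumr; apply: eq_bigr => k _.
rewrite nsqM nsq_real sqr_sqrtr ?invr_ge0 ?(ltW d0)//; ring.
Qed.

Lemma chart_model w : chart_dom w -> model eps j (chart w).
Proof.
move=> d0; exists (fun k => (Num.sqrt (den w)^-1)%:C%C * homog w k); split.
- exact: chart_q_constraint.
- by rewrite homog_j mulr1 /= sqrtr_gt0 invr_gt0.
- by rewrite homog_j mulr1.
- by move=> k l; exact: chart_q.
Qed.

Definition sqnorm (w : V) : R := \sum_m w 0 m ^+ 2.

(** The height is, up to a positive factor, a quadratic form of index zero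
    minus a constant; this is where the semi-axes come from. *)
Lemma den_height w :
  \sum_k eps k * (h k - c0) * nsq (homog w k) = (h j - c0) * (1 - sqnorm w).
Proof.
rewrite /sqnorm sum_re_im (bigD1_ord j)//= homog_j eps_j mul1r nsq_real expr1n mulr1.
rewrite mulrBr mulr1 mulr_sumr -sumrN; congr (_ + _); apply: eq_bigr => i _.
rewrite homog_lift nsqM nsq_real mulrA.
have -> : eps (lift j i) * (h (lift j i) - c0) * axis i ^+ 2 = - (h j - c0).
  by rewrite -(axis_sq i) /weight; ring.
by rewrite /nsq /= mulNr.
Qed.

Lemma height_chart w : chart_dom w ->
  height (chart w) h - c0 = (h j - c0) * (1 - sqnorm w) / den w.
Proof.
move=> d0; have q1 := chart_q_constraint d0.
rewrite (height_q h (fun k l => chart_q k l d0)) -den_height.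
rewrite -[c0 in LHS]mulr1 -[in LHS]q1 mulr_sumr -sumrB mulr_suml; apply: eq_bigr => k _.
rewrite nsqM nsq_real sqr_sqrtr ?invr_ge0 ?(ltW d0)//; ring.
Qed.

Lemma unit_ball_dom w : unit_ball w -> chart_dom w.
Proof.
rewrite /unit_ball /= -/(sqnorm w) => w1.
have e : (h j - c0) * den w = (h j - c0) * (1 - sqnorm w) +
    \sum_k - rate h j eps k * nsq (homog w k).
  rewrite -den_height -big_split /= /den mulr_sumr; apply: eq_bigr => k _.
  by rewrite /rate; ring.
have j0 : 0 < h j - c0 by rewrite subr_gt0.
have rg k : 0 <= - rate h j eps k * nsq (homog w k).
  have [->|kj] := eqVneq k j; first by rewrite /rate subrr mulr0 oppr0 mul0r.
  by rewrite mulr_ge0 ?nsq_ge0// oppr_ge0 ltW// eps_h.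
have S0 : 0 <= \sum_k - rate h j eps k * nsq (homog w k) by apply: sumr_ge0.
have w0 : 0 <= (h j - c0) * (1 - sqnorm w) by rewrite mulr_ge0 ?subr_ge0// ltW.
rewrite /chart_dom /= -(pmulr_rgt0 _ j0) e lt0r addr_ge0// andbT.
apply/negP; rewrite paddr_eq0// => /andP[/eqP w0' /eqP /psumr_eq0P z].
have a0 k : k != j -> nsq (homog w k) = 0.
  move=> kj; have /eqP := z (fun k _ => rg k) k isT.
  by rewrite mulf_eq0 oppr_eq0 (lt_eqF (eps_h kj)) => /eqP.
have d1 : den w = 1.
  rewrite /den (bigD1 j)//= homog_j eps_j nsq_real expr1n mulr1 big1 ?addr0//.
  by move=> k /a0 ->; rewrite mulr0.
have : \sum_k - rate h j eps k * nsq (homog w k) = 0.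
  apply: big1 => k _; have [->|kj] := eqVneq k j; last by rewrite a0// mulr0.
  by rewrite /rate subrr mulr0 oppr0 mul0r.
by move=> s0; move: e; rewrite d1 mulr1 s0 addr0 w0' => e; move: j0; rewrite e ltxx.
Qed.

(** The inverse of the chart reads the ratios of the entries of column [j]. *)
Definition cochart (x : E) : V := \row_m
  match fintype.split (cast_ord (esym (addnn n)) m) with
  | inl i => Re (proj x (lift j i) j / proj x j j) / axis i
  | inr i => Im (proj x (lift j i) j / proj x j j) / axis i
  end.

Lemma cochart_re x i :
  cochart x 0 (re_idx i) = Re (proj x (lift j i) j / proj x j j) / axis i.
Proof. by rewrite mxE /re_idx cast_ordK (unsplitK (inl i)). Qed.

Lemma cochart_im x i :
  cochart x 0 (im_idx i) = Im (proj x (lift j i) j / proj x j j) / axis i.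
Proof. by rewrite mxE /im_idx cast_ordK (unsplitK (inr i)). Qed.

Lemma homog_cochart x : model eps j x -> forall k,
  homog (cochart x) k = proj x k j / proj x j j.
Proof.
move=> mx k; have [i ->|->] := unliftP j k; last first.
  by rewrite homog_j divff// (model_j_neq0 eps_j mx).
rewrite homog_lift cochart_re cochart_im.
have a0 : axis i != 0 by rewrite gt_eqF// axis_gt0.
by apply: complex_ext; rewrite ?Re_real ?Im_real /= mulrC divfK.
Qed.

Lemma chart_proj_ratio w k : chart_dom w ->
  proj (chart w) k j / proj (chart w) j j = homog w k.
Proof.
move=> d0; rewrite !proj_chart homog_j mul1r conjc1 mulr1 mul1r mulfK//.
by rewrite real_complex_eq0 mulf_neq0 ?invr_eq0 ?eps_j ?oner_eq0// gt_eqF.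
Qed.

Lemma chartK w : chart_dom w -> cochart (chart w) = w.
Proof.
move=> d0; apply/rowP => m.
have [i [->|->]] := idx_split m; rewrite ?cochart_re ?cochart_im chart_proj_ratio// homog_lift.
  by rewrite Re_real /= mulrC mulKf// gt_eqF// axis_gt0.
by rewrite Im_real /= mulrC mulKf// gt_eqF// axis_gt0.
Qed.

Lemma cochartK x : model eps j x -> chart_dom (cochart x) /\ chart (cochart x) = x.
Proof.
move=> mx; have hc := homog_cochart mx; have [q [q1 q2 q3 Pq]] := mx.
have qE := q_jE q3; pose r := Re (q j); have r0 : r != 0 by rewrite gt_eqF.
have rc0 : r%:C%C != 0 :> C by rewrite real_complex_eq0.
have aE k : homog (cochart x) k = q k / r%:C%C.
  rewrite hc (model_diag_j eps_j q3 Pq) (model_col eps_j q3 Pq) -/r expr2 real_complexM.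
  by field.
have dE : den (cochart x) = (r ^+ 2)^-1.
  rewrite -[RHS]mulr1 -q1 mulr_sumr; apply: eq_bigr => k _.
  by rewrite aE nsqM -real_complexV nsq_real exprVn; ring.
have d0 : chart_dom (cochart x) by rewrite /chart_dom /= dE invr_gt0 exprn_gt0.
split=> //; apply: proj_inj; apply/matrixP => k l.
rewrite proj_chart !aE dE invrK Pq conjcM -real_complexV conjc_real.
by rewrite expr2 !real_complexM real_complexV; field.
Qed.

(** Above the level [c0] the stable manifold is the image of the unit ball,
    and the level itself that of the unit sphere. *)
Lemma chart_unit_ball :
  [set x | model eps j x /\ c0 <= height x h] = chart @` @unit_ball R n.*2.
Proof.
apply/seteqP; split=> x /=.
  move=> [mx hx]; have [d0 xE] := cochartK mx; exists (cochart x) => //.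
  move: hx; rewrite -subr_ge0 -{1}xE height_chart// pmulr_lge0 ?invr_gt0//.
  by rewrite pmulr_rge0 ?subr_gt0// subr_ge0.
move=> [w w1 <-]; have d0 := unit_ball_dom w1; split; first exact: chart_model.
rewrite -subr_ge0 height_chart// divr_ge0 ?(ltW d0)//.
by rewrite mulr_ge0 ?subr_ge0// ltW.
Qed.

Lemma cochart_unit_sphere x : model eps j x -> height x h = c0 ->
  unit_sphere (cochart x).
Proof.
move=> mx hx; have [d0 xE] := cochartK mx.
have /eqP := height_chart d0; rewrite xE hx subrr eq_sym mulf_eq0 invr_eq0.
rewrite (gt_eqF d0) orbF mulf_eq0 subr_eq0 (gt_eqF c0_lt) /= subr_eq0.
by move=> /eqP e; rewrite /unit_sphere /= -/(sqnorm _) -e.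
Qed.

End AffineChart.

Section ComplexCk.
Variables (R : realType) (V : normedModType R) (A : set V).
Hypothesis oA : open A.
Local Notation C := R[i]%C.
Implicit Types z w : V -> C.

Definition cCk k z := Ck_on k A (fun x => Re (z x)) /\ Ck_on k A (fun x => Im (z x)).

Lemma cCk_real k (f : V -> R) : Ck_on k A f -> cCk k (fun x => (f x)%:C%C).
Proof. by move=> hf; split=> //; exact: Ck_cst. Qed.

Lemma cCkM k z w : cCk k z -> cCk k w -> cCk k (fun x => z x * w x).
Proof.
move=> [z1 z2] [w1 w2]; split.
  under eq_fun do rewrite ReM -mulN1r.
  by apply: CkD => //; [|apply: CkM => //; [exact: Ck_cst|]]; apply: CkM.
under eq_fun do rewrite ImM.
by apply: CkD => //; apply: CkM.
Qed.

Lemma cCkD k z w : cCk k z -> cCk k w -> cCk k (fun x => z x + w x).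
Proof.
move=> [z1 z2] [w1 w2]; split.
  by under eq_fun do rewrite ReD; exact: CkD.
by under eq_fun do rewrite ImD; exact: CkD.
Qed.

Lemma cCkJ k z : cCk k z -> cCk k (fun x => conjc (z x)).
Proof.
move=> [z1 z2]; split; first by under eq_fun do rewrite ReJ.
under eq_fun do rewrite ImJ -mulN1r.
by apply: CkM => //; exact: Ck_cst.
Qed.

Lemma nsq_Ck k z : cCk k z -> Ck_on k A (fun x => nsq (z x)).
Proof. by move=> [z1 z2]; rewrite /nsq; apply: CkD => //; apply: CkM. Qed.

End ComplexCk.

Lemma cderive_uniq (R : realType) (V : normedModType R) (z : V -> R[i]%C) a v d d' :
  cderive z a v d -> cderive z a v d' -> d = d'.
Proof.
move=> [[_ d1] [_ d2]] [[_ e1] [_ e2]].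
by apply: complex_ext; [rewrite -d1 -e1|rewrite -d2 -e2].
Qed.

Section ChartEmbedding.
Variables (R : realType) (n : nat).
Local Notation C := R[i]%C.
Local Notation E := 'M[C]_n.+1.
Local Notation V := 'rV[R]_n.*2.
Variables (h : 'I_n.+1 -> R) (j : 'I_n.+1) (eps : 'I_n.+1 -> R).
Hypothesis eps_sign : forall k, eps k = 1 \/ eps k = -1.
Hypothesis eps_h : forall k, k != j -> eps k * (h k - h j) < 0.
Hypothesis eps_j : eps j = 1.
Variable c0 : R.
Hypothesis c0_lt : c0 < h j.
Hypothesis c0_gt : forall k, h k < h j -> h k < c0.
Local Notation homog := (homog h j eps c0).
Local Notation den := (den h j eps c0).
Local Notation chart := (chart h j eps c0).
Local Notation cochart := (cochart h j eps c0).
Local Notation dom := (chart_dom h j eps c0).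

Lemma homog_Ck (A : set V) k l : open A -> cCk A k (fun w => homog w l).
Proof.
move=> oA; rewrite /homog; case: (unlift j l) => [i|]; last by split; exact: Ck_cst.
apply: cCkM => //; first by apply: cCk_real; exact: Ck_cst.
by split; exact: Ck_coord.
Qed.

Lemma den_Ck (A : set V) k : open A -> Ck_on k A den.
Proof.
move=> oA; apply: Ck_sum => // l; apply: CkM => //; first exact: Ck_cst.
by apply: nsq_Ck => //; exact: homog_Ck.
Qed.

Lemma open_chart_dom : open dom.
Proof.
rewrite (_ : dom = den @^-1` [set r | 0 < r])//; apply: open_comp; last exact: open_gt.
move=> w _; exact: (Ck_continuous (den_Ck 0 openT) I).
Qed.

Lemma chart_smooth : smooth_on dom (realify \o chart).
Proof.
move=> k; have oW := open_chart_dom.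
have c a b : cCk dom k (fun w => chart w a b).
  have e w : chart w a b = (n.+1%:R : R)%:C%C *
      (homog w a * conjc (homog w b) * (eps b / den w)%:C%C) + (- (a == b)%:R : R)%:C%C.
    rewrite /chart mxBE mxZE !mxE real_complex_nat; congr (_ + _).
    by case: (a == b); apply: complex_ext => //=; rewrite ?oppr0.
  under eq_fun do rewrite e.
  apply: cCkD => //; last by apply: cCk_real; exact: Ck_cst.
  apply: cCkM => //; first by apply: cCk_real; exact: Ck_cst.
  apply: cCkM => //.
    by apply: cCkM => //; [|apply: cCkJ => //]; exact: homog_Ck.
  apply: cCk_real; apply: CkM => //; first exact: Ck_cst.
  by apply: CkV => //; [move=> x /lt0r_neq0|exact: den_Ck].
apply: Ck_pair => //; apply: Ck_mx => // a b.
  by under eq_fun do rewrite mxE; exact: (c a b).1.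
by under eq_fun do rewrite mxE; exact: (c a b).2.
Qed.

Lemma homog_cderive w c i : cderive (fun w => homog w (lift j i)) w c
  ((axis h j eps c0 i)%:C%C * (c 0 (re_idx i) +i* c 0 (im_idx i))%C).
Proof.
under eq_fun do rewrite homog_lift.
by apply: cderiveZ; split; exact: is_derive_coord.
Qed.

Lemma chart_immersion w c : dom w -> 'D_c (realify \o chart) w = 0 -> c = 0.
Proof.
move=> dw D0; have [_ /(_ c)[/(_ w dw) /derivableP + _]] := chart_smooth 1.
rewrite D0 => dch.
have r0 : realify (0 : E) = 0 by congr pair; apply/matrixP => a b; rewrite !mxE.
have dP k l : cderive (fun w => proj (chart w) k l) w c 0.
  move: dch; rewrite -r0 => /realify_is_deriveP/(_ k l); rewrite mxE => d.
  under eq_fun do rewrite proj_mxE.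
  apply: cderive_eq (cderiveZ _ (cderiveD d (cderive_cst _ _ _))) _.
  by rewrite addr0 mulr0.
have pj0 : proj (chart w) j j != 0.
  exact: (model_j_neq0 eps_j (chart_model dw)).
have hz i : (c 0 (re_idx i) +i* c 0 (im_idx i))%C = 0.
  have d1 := cderiveM (homog_cderive w c i) (dP j j).
  have e : (fun u : V => homog u (lift j i) * proj (chart u) j j) =
      fun u => proj (chart u) (lift j i) j.
    by apply/funext => u; rewrite !proj_chart homog_j; ring.
  rewrite e in d1.
  have /eqP := cderive_uniq d1 (dP (lift j i) j).
  rewrite mulr0 addr0 !mulf_eq0 (negbTE pj0) orbF real_complex_eq0 gt_eqF; last first.
    exact: (axis_gt0 eps_sign eps_h c0_lt c0_gt).
  by move=> /eqP.
apply/rowP => m; rewrite mxE.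
by have [i [->|->]] := idx_split m; case: (hz i).
Qed.

Lemma cochart_cvg (T : Type) (F : set_system T) {FF : Filter F} (M : T -> E) (x : E) :
  proj x j j != 0 -> M @ F --> x -> (fun t => cochart (M t)) @ F --> cochart x.
Proof.
move=> p0 cM; pose r (x : E) l := proj x l j / proj x j j.
have cr l : (fun t => r (M t) l) @ F --> r x l.
  by apply: ccvgM; [|apply: ccvgV => //]; exact: proj_cvg cM.
apply: real_mx_cvg => i0 m; rewrite ord1.
have congr_cvg (f g : E -> R) : f =1 g ->
    (fun t => g (M t)) @ F --> g x -> (fun t => f (M t)) @ F --> f x.
  by move=> /funext ->.
have [i [->|->]] := idx_split m.
  apply: (congr_cvg (fun x => cochart x 0 (re_idx i))
    (fun x => Re (r x (lift j i)) / axis h j eps c0 i)).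
    by move=> x'; exact: cochart_re.
  by apply: cvgM; [have /complex_cvgP[] := cr (lift j i)|exact: cvg_cst].
apply: (congr_cvg (fun x => cochart x 0 (im_idx i))
    (fun x => Im (r x (lift j i)) / axis h j eps c0 i)).
  by move=> x'; exact: cochart_im.
by apply: cvgM; [have /complex_cvgP[] := cr (lift j i)|exact: cvg_cst].
Qed.

Lemma cochart_continuous : {within chart @` dom, continuous cochart}.
Proof.
apply/subspace_continuousP => _ [w dw <-].
have FF : Filter (within (chart @` dom) (nbhs (chart w))) by exact: _.
have p0 := model_j_neq0 eps_j (chart_model dw).
have ci : (id : E -> E) @ within (chart @` dom) (nbhs (chart w)) --> chart w.
  exact: cvg_within.
exact (cochart_cvg p0 ci).
Qed.

Lemma superlevel_closed_ball :
  closed_ball_of_dim n.*2 [set x | model eps j x /\ c0 <= height x h].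
Proof.
exists dom, chart; split.
- split.
  + exact: open_chart_dom.
  + exact: chart_smooth.
  + exact: chart_immersion.
  + exists cochart; split; last exact: cochart_continuous.
    by move=> w; rewrite inE => dw; exact: (chartK eps_sign eps_h eps_j c0_lt c0_gt dw).
- by move=> w; exact: (unit_ball_dom eps_sign eps_h eps_j c0_lt c0_gt).
- exact: (chart_unit_ball eps_sign eps_h eps_j c0_lt c0_gt).
Qed.

End ChartEmbedding.

(** * Derivatives of maps of class C^1 along curves *)

Section QuotientAtZero.
Variable R : realType.
Implicit Types (f : R -> R) (d : R).

Lemma is_derive0P f d :
  is_derive (0 : R) 1 f d <-> (fun s => s^-1 * (f s - f 0)) @ 0^' --> d.
Proof.
have e : (fun h : R => h^-1 *: ((f \o shift (0 : R)) (h *: (1 : R)) - f 0)) =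
    fun s => s^-1 * (f s - f 0).
  by apply/funext => s; rewrite /= addr0 /GRing.scale /= mulr1.
split=> [[df <-]|c].
  by move: df; rewrite /derivable /derive e.
apply: DeriveDef; first by rewrite /derivable e; apply/cvg_ex; exists d.
by rewrite /derive e; apply/cvg_lim.
Qed.

Lemma is_derive0_continuous f d : is_derive (0 : R) 1 f d -> f @ (0 : R) --> f 0.
Proof.
by move=> [df _]; apply: differentiable_continuous; apply/derivable1_diffP.
Qed.

Lemma max_derive_eq0 f d : is_derive (0 : R) 1 f d -> (forall s, f s <= f 0) -> d = 0.
Proof.
move=> /is_derive0P/cvgrPdist_lt c hm.
have [->//|d0] := eqVneq d 0; have nd : 0 < `|d| by rewrite normr_gt0.
have /nbhs_ballP[r /= r0 hr] := c _ nd.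
have pt (s : R) : `|s| < r -> s != 0 -> `|d - s^-1 * (f s - f 0)| < `|d|.
  by move=> sr s0; apply: hr => //; rewrite /ball /= sub0r normrN.
have r2 : 0 < r / 2 by rewrite divr_gt0.
have lr : r / 2 < r by rewrite ltr_pdivrMr// ltr_pMr// ltr1n.
have le_inv (s : R) : 0 < s -> s^-1 * (f s - f 0) <= 0.
  by move=> s0; rewrite pmulr_rle0 ?invr_gt0// subr_le0.
have ge_inv (s : R) : s < 0 -> 0 <= s^-1 * (f s - f 0).
  by move=> s0; rewrite nmulr_rge0 ?invr_lt0// subr_le0.
have [dp|dn] : 0 < d \/ d < 0 by case: (ltgtP d 0) d0 => // h _; [right|left].
  have := pt (r / 2); rewrite (gtr0_norm r2) => /(_ lr (lt0r_neq0 r2)).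
  have := le_inv _ r2; move: (_^-1 * _) => q q0; rewrite (gtr0_norm dp).
  by rewrite gtr0_norm ?subr_gt0 ?(le_lt_trans q0)// => e; exfalso; lra.
have rn : - (r / 2) < 0 by rewrite oppr_lt0.
have := pt (- (r / 2)); rewrite normrN (gtr0_norm r2) => /(_ lr (ltr0_neq0 rn)).
have := ge_inv _ rn; move: (_^-1 * _) => q q0; rewrite (ltr0_norm dn).
by rewrite ltr0_norm ?subr_lt0 ?(lt_le_trans dn)// => e; exfalso; lra.
Qed.

Lemma mean_value0 f (df : R -> R) (b : R) :
  (forall t : R, `|t| <= `|b| -> is_derive t 1 f (df t)) ->
  exists2 x, `|x| <= `|b| & f b - f 0 = b * df x.
Proof.
move=> hd; have [b0|b0] := leP 0 b.
  have [|x /andP[x0 xb] e] := @mvt_seg R f df 0 b b0.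
    by move=> t /andP[t0 tb]; apply: hd; rewrite !ger0_norm.
  by exists x; rewrite ?ger0_norm// e subr0 mulrC.
have [|x /andP[bx x0] e] := @mvt_seg R f df b 0 (ltW b0).
  move=> t /andP[bt t0]; apply: hd.
  by rewrite (ler0_norm t0) (ltr0_norm b0) lerN2.
exists x; first by rewrite (ler0_norm x0) (ltr0_norm b0) lerN2.
by rewrite -opprB e sub0r mulrN opprK mulrC.
Qed.

End QuotientAtZero.

Section AlongCurves.
Variables (R : realType) (V : normedModType R).

Lemma line_derive (f : V -> R) (p w : V) (t : R) : derivable f (p + t *: w) w ->
  is_derive t 1 (fun s => f (p + s *: w)) ('D_w f (p + t *: w)).
Proof.
move=> df; have e : (fun h : R => h^-1 *: (((fun s : R => f (p + s *: w)) \o shift t) (h *: (1 : R)) -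
      f (p + t *: w))) =
    fun h : R => h^-1 *: ((f \o shift (p + t *: w)) (h *: w) - f (p + t *: w)).
  apply/funext => s; congr (_ *: (f _ - _)).
  by rewrite /= [s *: 1]mulr1 scalerDl addrCA.
apply: DeriveDef; first by rewrite /derivable e.
by rewrite {1}/derive e.
Qed.

Variables (A : set V) (f : V -> R) (u v w : V).
Hypothesis oA : open A.
Hypothesis fC1 : Ck_on 1 A f.
Hypothesis Au : A u.
Variables (a b : R -> R) (a' b' : R).
Hypothesis a0 : a 0 = 0.
Hypothesis b0 : b 0 = 0.
Hypothesis da : is_derive (0 : R) 1 a a'.
Hypothesis db : is_derive (0 : R) 1 b b'.

(** The two-variable chain rule: the increment in the direction [w] is
    evaluated by the mean value theorem, and continuity of the partial
    derivative ['D_w f] makes its value converge. *)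
Lemma curve_derive :
  is_derive (0 : R) 1 (fun s => f (u + a s *: v + b s *: w)) (a' * 'D_v f u + b' * 'D_w f u).
Proof.
have [cf dv] := fC1; have [dvv _] := dv v; have [dww [cw _]] := dv w.
pose D := 'D_w f u.
pose h1 s := f (u + a s *: v + b s *: w) - f (u + a s *: v).
have d2 : is_derive (0 : R) 1 (fun s => f (u + a s *: v)) (a' * 'D_v f u).
  have dl : is_derive (a 0) 1 (fun s => f (u + s *: v)) ('D_v f u).
    have := @line_derive f u v (a 0); rewrite a0 scale0r addr0; apply.
    exact: dvv.
  have dc := @is_derive1_comp R (fun s => f (u + s *: v)) a 0 _ _ dl da.
  by apply: is_derive_eq dc _; rewrite mulrC.
suff d1 : is_derive (0 : R) 1 h1 (b' * D).
  have -> : (fun s => f (u + a s *: v + b s *: w)) = (fun s => f (u + a s *: v) + h1 s).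
    by apply/funext => s; rewrite /h1 [RHS]addrC subrK.
  exact: is_deriveD d2 d1.
have h10 : h1 0 = 0 by rewrite /h1 a0 b0 !scale0r !addr0 subrr.
pose g s := if b s == 0 then D else h1 s / b s.
have h1E s : h1 s = b s * g s.
  rewrite /g; case: eqVneq => [bs|bs]; last by rewrite mulrC divfK.
  by rewrite bs mul0r /h1 bs scale0r addr0 subrr.
have cg : g @ (0 : R) --> D.
  apply/cvgrPdist_lt => e e0.
  have cD : 'D_w f x @[x --> u] --> D := cw u Au.
  have hU : nbhs u [set x | A x /\ `|D - 'D_w f x| < e].
    by apply: filterI; [exact: open_nbhs_nbhs|move/cvgrPdist_lt: cD => /(_ e e0)].
  have /nbhs_ballP[r /= r0 hr] := hU.
  pose M := `|v| + `|w| + 1; have M0 : 0 < M by rewrite ltr_wpDl ?addr_ge0.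
  have rM : 0 < r / M by rewrite divr_gt0.
  have ca := is_derive0_continuous da; have cb := is_derive0_continuous db.
  rewrite a0 in ca; rewrite b0 in cb.
  move/cvgrPdist_lt/(_ _ rM): ca => na; move/cvgrPdist_lt/(_ _ rM): cb => nb.
  near=> s.
  have as_ : `|a s| < r / M by rewrite -normrN -sub0r; near: s.
  have bs : `|b s| < r / M by rewrite -normrN -sub0r; near: s.
  have inU (t : R) : `|t| <= `|b s| -> A (u + a s *: v + t *: w) /\
      `|D - 'D_w f (u + a s *: v + t *: w)| < e.
    move=> tb; apply: hr; rewrite -ball_normE /= -addrA opprD addrA subrr sub0r normrN.
    apply: le_lt_trans (ler_normD _ _) _; rewrite !normrZ.
    apply: (@le_lt_trans _ _ (r / M * `|v| + r / M * `|w|)).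
      apply: lerD; apply: ler_wpM2r => //; first exact: ltW.
      exact: le_trans tb (ltW bs).
    by rewrite -mulrDr -[ltRHS](divfK (lt0r_neq0 M0)) ltr_pM2l// ltrDl.
  have hd (t : R) : `|t| <= `|b s| -> is_derive t 1 (fun s' => f (u + a s *: v + s' *: w))
      ('D_w f (u + a s *: v + t *: w)).
    by move=> /inU[tA _]; apply: line_derive; exact: dww.
  have [x xb ex] := mean_value0 hd.
  rewrite /g; case: eqVneq => [_|bs0]; first by rewrite subrr normr0.
  have -> : h1 s / b s = 'D_w f (u + a s *: v + x *: w).
    apply/(mulIf bs0); rewrite divfK// [RHS]mulrC -ex /h1.
    by rewrite scale0r addr0.
  by have [] := inU x xb.
apply/is_derive0P; rewrite h10.
have -> : (fun s => s^-1 * (h1 s - 0)) = fun s => (s^-1 * (b s - b 0)) * g s.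
  by apply/funext => s; rewrite subr0 h1E b0 subr0 mulrA.
apply: cvgM; first exact/is_derive0P.
exact: cvg_within_filter cg.
Unshelve. all: by end_near. Qed.

End AlongCurves.

Section CkComponents.
Variables (R : realType) (V : normedModType R) (A : set V).
Hypothesis oA : open A.

Lemma Ck_fst (W1 W2 : normedModType R) k (F : V -> W1 * W2) :
  Ck_on k A F -> Ck_on k A (fun x => (F x).1).
Proof.
have c1 (G : V -> W1 * W2) x : {for x, continuous G} -> {for x, continuous (fun x => (G x).1)}.
  by move=> c; apply: (cvg_comp _ _ c); exact: cvg_fst.
elim: k F => [|k ih] F [c d]; first by split=> // x Ax; exact: c1 (c x Ax).
split=> [x Ax|v]; first exact: c1 (c x Ax).
have [d1 d2] := d v.
have D x : A x -> is_derive x v (fun x => (F x).1) ('D_v F x).1.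
  by move=> Ax; have /is_derive_pairP[] := derivableP (d1 x Ax).
split=> [x Ax|]; first by have [] := D x Ax.
apply: (Ck_congr oA (f := fun x => ('D_v F x).1)); last exact: ih.
by move=> x Ax; apply/esym; have [] := D x Ax.
Qed.

Lemma Ck_snd (W1 W2 : normedModType R) k (F : V -> W1 * W2) :
  Ck_on k A F -> Ck_on k A (fun x => (F x).2).
Proof.
have c1 (G : V -> W1 * W2) x : {for x, continuous G} -> {for x, continuous (fun x => (G x).2)}.
  by move=> c; apply: (cvg_comp _ _ c); exact: cvg_snd.
elim: k F => [|k ih] F [c d]; first by split=> // x Ax; exact: c1 (c x Ax).
split=> [x Ax|v]; first exact: c1 (c x Ax).
have [d1 d2] := d v.
have D x : A x -> is_derive x v (fun x => (F x).2) ('D_v F x).2.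
  by move=> Ax; have /is_derive_pairP[] := derivableP (d1 x Ax).
split=> [x Ax|]; first by have [] := D x Ax.
apply: (Ck_congr oA (f := fun x => ('D_v F x).2)); last exact: ih.
by move=> x Ax; apply/esym; have [] := D x Ax.
Qed.

Lemma Ck_entry k p q (M : V -> 'M[R]_(p, q)) i j :
  Ck_on k A M -> Ck_on k A (fun x => M x i j).
Proof.
have c1 (G : V -> 'M[R]_(p, q)) x : {for x, continuous G} ->
    {for x, continuous (fun x => G x i j)}.
  move=> c; apply: (@continuous_cvg _ _ _ (nbhs x) _ G (fun M : 'M[R]_(p, q) => M i j) (G x)) => //.
  exact: coord_continuous.
elim: k M => [|k ih] M [c d]; first by split=> // x Ax; exact: c1 (c x Ax).
split=> [x Ax|v]; first exact: c1 (c x Ax).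
have [d1 d2] := d v.
have D x : A x -> is_derive x v (fun x => M x i j) ('D_v M x i j).
  by move=> Ax; have /is_derive_mxP := derivableP (d1 x Ax); apply.
split=> [x Ax|]; first by have [] := D x Ax.
apply: (Ck_congr oA (f := fun x => 'D_v M x i j)); last exact: ih.
by move=> x Ax; apply/esym; have [] := D x Ax.
Qed.

Variables (p q : nat) (Phi : V -> 'M[R[i]%C]_(p, q)).
Hypothesis sm : smooth_on A (realify \o Phi).
Local Notation T u c := ('D_c (realify \o Phi) u).

Lemma smooth_curve u v w (a b : R -> R) (a' b' : R) : A u -> a 0 = 0 -> b 0 = 0 ->
  is_derive (0 : R) 1 a a' -> is_derive (0 : R) 1 b b' ->
  is_derive (0 : R) 1 (fun s => realify (Phi (u + a s *: v + b s *: w)))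
    (a' *: T u v + b' *: T u w).
Proof.
move=> Au a0 b0 da db; have sm1 := sm 1.
have df c : is_derive u c (realify \o Phi) (T u c).
  by apply: derivableP; have [_ /(_ c)[d _]] := sm1; exact: d.
move: (df v) (df w); move: (T u v) (T u w) => tv tw dv dw.
have r1 := Ck_fst sm1; have r2 := Ck_snd sm1.
have [/is_derive_mxP v1 /is_derive_mxP v2] := (is_derive_pairP _ _ _ _).1 dv.
have [/is_derive_mxP w1 /is_derive_mxP w2] := (is_derive_pairP _ _ _ _).1 dw.
apply/is_derive_pairP; split; apply/is_derive_mxP => k l.
  have d := curve_derive v w oA (Ck_entry k l r1) Au a0 b0 da db.
  have [_ ev] := v1 k l; have [_ ew] := w1 k l; rewrite ev ew in d.
  by apply: is_derive_eq d _; rewrite !mxE.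
have d := curve_derive v w oA (Ck_entry k l r2) Au a0 b0 da db.
have [_ ev] := v2 k l; have [_ ew] := w2 k l; rewrite ev ew in d.
by apply: is_derive_eq d _; rewrite !mxE.
Qed.

Lemma derive_linear u v w (a b : R) : A u ->
  T u (a *: v + b *: w) = a *: T u v + b *: T u w.
Proof.
move=> Au; have lin (c : R) : is_derive (0 : R) 1 (fun s : R => s * c) c.
  apply: is_derive_eq (is_derive_mul (is_derive_id _ _) (is_derive_cst c _ _)) _.
  by rewrite mulr0 addr0 mul1r.
have d1 := @smooth_curve u v w (fun s => s * a) (fun s => s * b) a b
  Au (mul0r a) (mul0r b) (lin a) (lin b).
have d2 := @smooth_curve u (a *: v + b *: w) 0 (fun s => s * 1) (fun s => s * 0) 1 0
  Au (mul0r 1) (mul0r 0) (lin 1) (lin 0).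
have e : (fun s : R => realify (Phi (u + (s * a) *: v + (s * b) *: w))) =
    fun s => realify (Phi (u + (s * 1) *: (a *: v + b *: w) + (s * 0) *: 0)).
  apply/funext => s; congr (realify (Phi _)).
  by rewrite mulr1 mulr0 scaler0 addr0 scalerDr !scalerA addrA.
rewrite e in d1; have [_ e1] := d1; have [_ e2] := d2.
by rewrite -e1 e2 scale1r scale0r addr0.
Qed.

End CkComponents.

Section SphereGeometry.
Variables (R : realType) (m : nat).
Implicit Types u y w c : 'rV[R]_m.

Lemma mul_trE u c : c *m u^T = (\sum_i u 0 i * c 0 i)%:M.
Proof.
apply/matrixP => a b; rewrite !ord1 !mxE eqxx mulr1n.
by apply: eq_bigr => i _; rewrite mxE mulrC.
Qed.

(** Two vectors orthogonal to the image of a hyperplane under an injective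
    linear map are proportional, by a count of dimensions. *)
Lemma orth_parallel u y w (J : 'M[R]_m) : w != 0 ->
  (forall c, c *m u^T = 0 -> c *m J = 0 -> c = 0) ->
  (forall c, c *m u^T = 0 -> c *m J *m y^T = 0 /\ c *m J *m w^T = 0) ->
  exists a, y = a *: w.
Proof.
move=> w0 inj orth; pose K := kermx u^T; pose Y := col_mx y w.
have rowK i : row i K *m u^T = 0 by rewrite -row_mul mulmx_ker row0.
have KJY : K *m J *m Y^T = 0.
  apply/row_matrixP => i; rewrite row0 row_mul row_mul tr_col_mx mul_mx_row.
  by have [-> ->] := orth _ (rowK i); rewrite row_mx0.
have cap0 : (K :&: kermx J)%MS = 0.
  apply/row_matrixP => i; rewrite row0; apply: inj.
    by apply/sub_kermxP; apply: submx_trans (row_sub i _) (capmxSl _ _).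
  by apply/sub_kermxP; apply: submx_trans (row_sub i _) (capmxSr _ _).
have rKJ : \rank (K *m J) = \rank K.
  by rewrite -(mxrank_mul_ker K J) cap0 mxrank0 addn0.
have rK : (m - 1 <= \rank K)%N by rewrite mxrank_ker leq_sub2l// rank_leq_col.
have := mulmx0_rank_max KJY; rewrite rKJ mxrank_tr => rY.
have m0 : (0 < m)%N.
  rewrite lt0n; apply: contra_neq w0 => m_0; apply/rowP => i.
  by have := leq_ltn_trans (leq0n i) (ltn_ord i); rewrite lt0n => /eqP /(_ m_0).
have rY1 : (\rank Y <= 1)%N.
  rewrite -(leq_add2l (m - 1)) subnK//; apply: leq_trans rY; exact: leq_add.
have wY : (w <= Y)%MS by rewrite /Y -addsmxE addsmxSr.
have rw : \rank w = 1%N by rewrite rank_rV w0.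
have Yw : (Y <= w)%MS.
  have rwY := mxrankS wY; rewrite rw in rwY.
  by rewrite -(mxrank_leqif_sup wY) rw eqn_leq rY1 rwY.
by apply/sub_rVP; apply: submx_trans Yw; rewrite /Y -addsmxE addsmxSl.
Qed.

Lemma sqsum_continuous : continuous (fun u => \sum_i u 0 i ^+ 2).
Proof.
move=> u; have c : Ck_on 0 [set: 'rV[R]_m] (fun u : 'rV[R]_m => \sum_i u 0 i * u 0 i).
  apply: (Ck_sum openT) => i; apply: (CkM openT); exact: Ck_coord.
exact: (Ck_continuous c I).
Qed.

Lemma unit_sphere_compact : compact (@unit_sphere R m).
Proof.
have box : compact [set v : 'rV[R]_m | forall i, v ord0 i \in `[(-1 : R), (1 : R)]].
  by apply: (@rV_compact _ _ (fun=> `[(-1 : R), (1 : R)]%classic)) => i; exact: segment_compact.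
apply: subclosed_compact box _ => [|u hu i].
  have -> : @unit_sphere R m = (fun u => \sum_i u 0 i ^+ 2) @^-1` [set 1] by [].
  by apply: closed_comp => [u _|]; [exact: sqsum_continuous|exact: closed_eq].
have : u ord0 i ^+ 2 <= 1.
  rewrite -hu (bigD1 i)//= lerDl; apply: sumr_ge0 => k _; exact: sqr_ge0.
rewrite in_itv /= -ler_norml => e; move: e.
by rewrite -[leLHS]ger0_norm ?sqr_ge0// normrX expr_le1.
Qed.

Lemma linear_rowE (f : 'rV[R]_m -> 'rV[R]_m) c :
  (forall a b v w, f (a *: v + b *: w) = a *: f v + b *: f w) ->
  f c = c *m \matrix_i f (delta_mx 0 i).
Proof.
move=> lf; have f0 : f 0 = 0.
  by have := lf 0 0 0 0; rewrite !scale0r addr0.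
have fD : {morph f : v w / v + w}.
  by move=> v w; have := lf 1 1 v w; rewrite !scale1r.
have fZ a v : f (a *: v) = a *: f v.
  by have := lf a 0 v 0; rewrite !scale0r !addr0.
rewrite {1}(row_sum_delta c) (big_morph f fD f0) mulmx_sum_row.
by apply: eq_bigr => i _; rewrite fZ rowK.
Qed.

End SphereGeometry.

(** * Spheres in a level set *)

Section ChartRates.
Variables (R : realType) (n : nat).
Local Notation C := R[i]%C.
Local Notation E := 'M[C]_n.+1.
Local Notation V := 'rV[R]_n.*2.
Variables (h : 'I_n.+1 -> R) (j : 'I_n.+1) (eps : 'I_n.+1 -> R).
Hypothesis eps_sign : forall k, eps k = 1 \/ eps k = -1.
Hypothesis eps_h : forall k, k != j -> eps k * (h k - h j) < 0.
Hypothesis eps_j : eps j = 1.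
Variable c0 : R.
Hypothesis c0_lt : c0 < h j.
Hypothesis c0_gt : forall k, h k < h j -> h k < c0.
Local Notation cochart := (cochart h j eps c0).
Local Notation axis := (axis h j eps c0).

Definition complexify (p : 'M[R]_n.+1 * 'M[R]_n.+1) : E :=
  \matrix_(k, l) (p.1 k l +i* p.2 k l)%C.

Lemma complexifyK p : realify (complexify p) = p.
Proof. by case: p => a b; congr pair; apply/matrixP => k l; rewrite !mxE. Qed.

Definition ratio (x : E) l : C := proj x l j / proj x j j.

(** The derivative of [ratio] at [x] in the direction [X]. *)
Definition ratio_rate (x X : E) l : C :=
  (n.+1%:R^-1 * X l j) * (proj x j j)^-1 +
  proj x l j * (- (n.+1%:R^-1 * X j j) / proj x j j ^+ 2).

Lemma ratio_cderive (g : R -> E) X l : proj (g 0) j j != 0 ->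
  is_derive (0 : R) 1 (realify \o g) (realify X) ->
  cderive (fun s => ratio (g s) l) (0 : R) 1 (ratio_rate (g 0) X l).
Proof.
move=> p0 d; exact: cderiveM (proj_cderive l j d) (cderiveV p0 (proj_cderive j j d)).
Qed.

Lemma ratio_rate_j x X : proj x j j != 0 -> ratio_rate x X j = 0.
Proof. by rewrite /ratio_rate; move: (_^-1 * _) (proj x j j) => d p p0; field. Qed.

Definition cochart_rate (x X : E) : V := \row_m
  match fintype.split (cast_ord (esym (addnn n)) m) with
  | inl i => (axis i)^-1 * Re (ratio_rate x X (lift j i))
  | inr i => (axis i)^-1 * Im (ratio_rate x X (lift j i))
  end.

Lemma cochart_rate_re x X i : cochart_rate x X 0 (re_idx i) =
  (axis i)^-1 * Re (ratio_rate x X (lift j i)).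
Proof. by rewrite [LHS]mxE /re_idx cast_ordK (unsplitK (inl i)). Qed.

Lemma cochart_rate_im x X i : cochart_rate x X 0 (im_idx i) =
  (axis i)^-1 * Im (ratio_rate x X (lift j i)).
Proof. by rewrite [LHS]mxE /im_idx cast_ordK (unsplitK (inr i)). Qed.

Lemma cochart_derive (g : R -> E) X m : proj (g 0) j j != 0 ->
  is_derive (0 : R) 1 (realify \o g) (realify X) ->
  is_derive (0 : R) 1 (fun s => cochart (g s) 0 m) (cochart_rate (g 0) X 0 m).
Proof.
move=> p0 d; have [i [->|->]] := idx_split m.
  have -> : (fun s => cochart (g s) 0 (re_idx i)) =
      fun s => (axis i)^-1 * Re (ratio (g s) (lift j i)).
    by apply/funext => s; rewrite cochart_re mulrC.
  by rewrite cochart_rate_re; apply: is_derive_scal; exact: (ratio_cderive _ p0 d).1.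
have -> : (fun s => cochart (g s) 0 (im_idx i)) =
    fun s => (axis i)^-1 * Im (ratio (g s) (lift j i)).
  by apply/funext => s; rewrite cochart_im mulrC.
by rewrite cochart_rate_im; apply: is_derive_scal; exact: (ratio_cderive _ p0 d).2.
Qed.

Lemma cochart_rate_linear x (a b : R) p q :
  cochart_rate x (complexify (a *: p + b *: q)) =
  a *: cochart_rate x (complexify p) + b *: cochart_rate x (complexify q).
Proof.
have e k l : complexify (a *: p + b *: q) k l =
    a%:C%C * complexify p k l + b%:C%C * complexify q k l.
  by rewrite !mxE; apply: complex_ext; rewrite ?(ReD, ImD, Re_real, Im_real).
have re l : ratio_rate x (complexify (a *: p + b *: q)) l =
    a%:C%C * ratio_rate x (complexify p) l + b%:C%C * ratio_rate x (complexify q) l.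
  by rewrite /ratio_rate !e; ring.
apply/rowP => m; rewrite [RHS]mxE [in RHS]mxE [X in _ = _ + X]mxE.
have [i [->|->]] := idx_split m; rewrite ?cochart_rate_re ?cochart_rate_im re.
  by rewrite ReD !Re_real; ring.
by rewrite ImD !Im_real; ring.
Qed.

Lemma proj_ratio x k l : model eps j x ->
  proj x k l = ratio x k * conjc (ratio x l) *
    (eps l / \sum_m eps m * nsq (ratio x m))%:C%C.
Proof.
move=> mx; have [d0 xE] := cochartK eps_sign eps_h eps_j c0_lt c0_gt mx.
have hE := homog_cochart eps_sign eps_h eps_j c0_lt c0_gt mx.
rewrite -[in LHS]xE proj_chart !hE; congr (_ * (_ / _)%:C%C).
by apply: eq_bigr => m _; rewrite hE.
Qed.

Lemma ratio_den_neq0 x : model eps j x -> \sum_m eps m * nsq (ratio x m) != 0.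
Proof.
move=> mx; have [d0 _] := cochartK eps_sign eps_h eps_j c0_lt c0_gt mx.
have hE := homog_cochart eps_sign eps_h eps_j c0_lt c0_gt mx.
have -> : \sum_m eps m * nsq (ratio x m) = den h j eps c0 (cochart x).
  by apply: eq_bigr => m _; rewrite hE.
exact: lt0r_neq0.
Qed.

(** A curve in the model whose affine coordinates are stationary is
    stationary. *)
Lemma cochart_rate_inj (g : R -> E) X : (forall s, model eps j (g s)) ->
  is_derive (0 : R) 1 (realify \o g) (realify X) ->
  cochart_rate (g 0) X = 0 -> X = 0.
Proof.
move=> gm d z; have p0 := model_j_neq0 eps_j (gm 0).
have rz l : ratio_rate (g 0) X l = 0.
  have [i ->|->] := unliftP j l; last exact: ratio_rate_j.
  have a0 : (axis i)^-1 != 0.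
    by rewrite invr_eq0 gt_eqF// (axis_gt0 eps_sign eps_h c0_lt c0_gt).
  apply: complex_ext.
    have /rowP/(_ (re_idx i)) := z; rewrite cochart_rate_re mxE => /eqP.
    by rewrite mulf_eq0 (negbTE a0) => /eqP.
  have /rowP/(_ (im_idx i)) := z; rewrite cochart_rate_im mxE => /eqP.
  by rewrite mulf_eq0 (negbTE a0) => /eqP.
have dr l : cderive (fun s => ratio (g s) l) (0 : R) 1 0.
  by rewrite -(rz l); exact: ratio_cderive.
have dden : is_derive (0 : R) 1 (fun s => \sum_m eps m * nsq (ratio (g s) m)) (0 : R).
  apply: is_derive_eq (is_derive_big _ (fun m => is_derive_scal (eps m)
    (is_derive_nsq (dr m)))) _.
  by rewrite big1// => m _; rewrite mul0r mulr0 mulr0.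
have dinv := is_derive_inv (ratio_den_neq0 (gm 0)) dden.
apply/matrixP => k l; rewrite [RHS]mxE.
have dP : cderive (fun s => proj (g s) k l) (0 : R) 1 0.
  have -> : (fun s => proj (g s) k l) = fun s => ratio (g s) k * conjc (ratio (g s) l) *
      (eps l * (\sum_m eps m * nsq (ratio (g s) m))^-1)%:C%C.
    by apply/funext => s; exact: proj_ratio.
  have dc : is_derive (0 : R) 1
      (fun s => eps l * (\sum_m eps m * nsq (ratio (g s) m))^-1) (0 : R).
    by apply: is_derive_eq (is_derive_scal (eps l) dinv) _; rewrite !(oppr0, mul0r, mulr0).
  apply: cderive_eq (cderiveM (cderiveM (dr k) (cderiveJ (dr l))) (cderive_real dc)) _.
  by rewrite conjc0 (_ : (0 : R)%:C%C = 0)// !(mul0r, mulr0, addr0).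
have /eqP := cderive_uniq (proj_cderive k l d) dP.
by rewrite mulf_eq0 invr_eq0 pnatr_eq0 => /eqP.
Qed.

End ChartRates.

Lemma great_circle (R : realType) m (u c : 'rV[R]_m) (r s : R) :
  unit_sphere u -> \sum_i u 0 i * c 0 i = 0 -> r != 0 -> \sum_i c 0 i ^+ 2 = r ^+ 2 ->
  unit_sphere (u + (cos (r * s) - 1) *: u + (r^-1 * sin (r * s)) *: c).
Proof.
move=> hu uc r0 cr; rewrite /unit_sphere /=.
transitivity (\sum_i (cos (r * s) ^+ 2 * u 0 i ^+ 2 +
    2 * cos (r * s) * (r^-1 * sin (r * s)) * (u 0 i * c 0 i) +
    (r^-1 * sin (r * s)) ^+ 2 * c 0 i ^+ 2)).
  by apply: eq_bigr => i _; rewrite !mxE; ring.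
rewrite !big_split /= -!mulr_sumr hu uc cr mulr1 mulr0 addr0 exprMn mulrAC -exprMn.
by rewrite mulVf// expr1n mul1r cos2Dsin2.
Qed.

Lemma antipode (R : realType) m (v w : 'rV[R]_m) : unit_sphere v -> unit_sphere w ->
  \sum_i v 0 i * w 0 i <= -1 -> w = - v.
Proof.
rewrite /unit_sphere /= => hv hw vw.
have le : \sum_i (v 0 i + w 0 i) ^+ 2 <= 0.
  have -> : \sum_i (v 0 i + w 0 i) ^+ 2 =
      \sum_i v 0 i ^+ 2 + 2 * (\sum_i v 0 i * w 0 i) + \sum_i w 0 i ^+ 2.
    by rewrite mulr_sumr -!big_split /=; apply: eq_bigr => i _; ring.
  by rewrite hv hw; move: (\sum_i _) vw => q; lra.
have /psumr_eq0P e : \sum_i (v 0 i + w 0 i) ^+ 2 = 0.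
  by apply/eqP; rewrite eq_le le sumr_ge0// => i _; exact: sqr_ge0.
apply/rowP => i; rewrite mxE; apply/eqP; rewrite -addr_eq0 addrC -sqrf_eq0.
by rewrite e// => k _; exact: sqr_ge0.
Qed.

Lemma unit_sphere_neqN (R : realType) m (u : 'rV[R]_m) : unit_sphere u -> u <> - u.
Proof.
rewrite /unit_sphere /= => hu /rowP e; move/eqP: hu; rewrite big1 ?(eq_sym 0) ?oner_eq0// => i _.
by have := e i; rewrite mxE => ei; have -> : u 0 i = 0; [lra|rewrite expr0n].
Qed.

Section SphereSurjective.
Variables (R : realType) (n : nat).
Local Notation C := R[i]%C.
Local Notation E := 'M[C]_n.+1.
Local Notation V := 'rV[R]_n.*2.
Variables (h : 'I_n.+1 -> R) (j : 'I_n.+1) (eps : 'I_n.+1 -> R).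
Hypothesis eps_sign : forall k, eps k = 1 \/ eps k = -1.
Hypothesis eps_h : forall k, k != j -> eps k * (h k - h j) < 0.
Hypothesis eps_j : eps j = 1.
Variable c0 : R.
Hypothesis c0_lt : c0 < h j.
Hypothesis c0_gt : forall k, h k < h j -> h k < c0.
Hypothesis n0 : (0 < n)%N.
Local Notation cochart := (cochart h j eps c0).
Local Notation cochart_rate := (cochart_rate h j eps c0).

Variable sigma : V -> E.
Hypothesis sigma_emb : embedded_sphere sigma.
Hypothesis sigma_model : forall u, unit_sphere u -> model eps j (sigma u).
Hypothesis sigma_height : forall u, unit_sphere u -> height (sigma u) h = c0.
Local Notation T u c := ('D_c (realify \o sigma) u).
Local Notation X u c := (complexify (T u c)).

Let z (u : V) := cochart (sigma u).

Let z_sphere (u : V) : unit_sphere u -> unit_sphere (z u).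
Proof.
move=> hu; apply: (cochart_unit_sphere eps_sign eps_h eps_j c0_lt c0_gt).
  exact: sigma_model.
exact: sigma_height.
Qed.

Lemma curve_on_sphere (u c : V) : unit_sphere u -> \sum_i u 0 i * c 0 i = 0 -> c != 0 ->
  exists g : R -> E, [/\ g 0 = sigma u,
    forall s, exists2 u', unit_sphere u' & g s = sigma u' &
    is_derive (0 : R) 1 (realify \o g) (realify (X u c))].
Proof.
move=> hu uc cn; have [W [oW SW smW _ _]] := sigma_emb.
pose r := Num.sqrt (\sum_i c 0 i ^+ 2).
have S0 : 0 < \sum_i c 0 i ^+ 2.
  rewrite lt0r sumr_ge0 ?andbT => [|i _]; last exact: sqr_ge0.
  apply: contra_neq cn => /psumr_eq0P e; apply/rowP => i; rewrite mxE.
  by apply/eqP; rewrite -sqrf_eq0 e// => k _; exact: sqr_ge0.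
have r0 : 0 < r by rewrite sqrtr_gt0.
have r2 : \sum_i c 0 i ^+ 2 = r ^+ 2 by rewrite sqr_sqrtr// ltW.
pose a s := cos (r * s) - 1; pose b s := r^-1 * sin (r * s).
have dr : is_derive (0 : R) 1 (fun s : R => r * s) r.
  by apply: is_derive_eq (is_derive_scal r (is_derive_id (0 : R) 1)) _; rewrite mulr1.
have da : is_derive (0 : R) 1 a (0 : R).
  have d1 := @is_derive1_comp R (@cos R) (fun s => r * s) 0 _ _ (is_derive_cos _) dr.
  apply: is_derive_eq (is_deriveB d1 (is_derive_cst (1 : R) _ _)) _.
  by rewrite mulr0 sin0 oppr0 mul0r addr0.
have db : is_derive (0 : R) 1 b (1 : R).
  have d1 := @is_derive1_comp R (@sin R) (fun s => r * s) 0 _ _ (is_derive_sin _) dr.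
  apply: is_derive_eq (is_derive_scal r^-1 d1) _.
  by rewrite mulr0 cos0 mul1r mulVf// gt_eqF.
have a0 : a 0 = 0 by rewrite /a mulr0 cos0 subrr.
have b0 : b 0 = 0 by rewrite /b mulr0 sin0 mulr0.
exists (fun s => sigma (u + a s *: u + b s *: c)); split.
- by rewrite a0 b0 !scale0r !addr0.
- move=> s; exists (u + a s *: u + b s *: c) => //.
  exact: (great_circle s hu uc (lt0r_neq0 r0) r2).
- have := smooth_curve oW smW u c (SW u hu) a0 b0 da db.
  by rewrite scale0r add0r scale1r complexifyK.
Qed.

Lemma z_continuous : {within @unit_sphere R n.*2, continuous z}.
Proof.
have [W [oW SW smW _ _]] := sigma_emb.
apply/subspace_continuousP => u hu.
pose F := within (@unit_sphere R n.*2) (nbhs u).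
have FF : Filter F by exact: _.
have cs : sigma @ F --> sigma u.
  apply/mx_cvgP => k l; split; apply: cvg_within_filter.
    have := Ck_continuous (Ck_entry oW k l (Ck_fst oW (smW 0%N))) (SW u hu).
    by rewrite /prop_for /continuous_at /= mxE; under eq_fun do rewrite mxE.
  have := Ck_continuous (Ck_entry oW k l (Ck_snd oW (smW 0%N))) (SW u hu).
  by rewrite /prop_for /continuous_at /= mxE; under eq_fun do rewrite mxE.
exact (cochart_cvg (model_j_neq0 eps_j (sigma_model hu)) cs).
Qed.

(** For a point [y] of the level, the function [<y, .>] on the sphere has a
    maximum; there the image of the tangent space of the sphere is orthogonal
    to [y] and to the position vector, so these are proportional. *)
Lemma sphere_max_parallel (y : V) : exists u, [/\ unit_sphere u,
  forall u', unit_sphere u' -> \sum_m y 0 m * z u' 0 m <= \sum_m y 0 m * z u 0 m &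
  exists a, y = a *: z u].
Proof.
have [W [oW SW smW _ imm]] := sigma_emb.
pose f (u : V) := \sum_m y 0 m * z u 0 m.
have S0 : @unit_sphere R n.*2 !=set0 by apply: unit_sphere_nonempty; rewrite double_gt0.
have cf : {within @unit_sphere R n.*2, continuous f}.
  have /subspace_continuousP cz := z_continuous.
  apply/subspace_continuousP => u hu.
  apply: rcvg_sum => m; apply: cvgM; first exact: cvg_cst.
  exact: (@continuous_cvg _ _ _ (within (@unit_sphere R n.*2) (nbhs u)) _ z
    (fun M : V => M 0 m) _ (@coord_continuous _ _ _ 0 m _) (cz u hu)).
have [u + umax] := EVT_max_rV S0 (@unit_sphere_compact R _) cf; rewrite inE => hu.
have fmax (u' : V) : unit_sphere u' -> f u' <= f u by move=> hu'; apply: umax; rewrite inE.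
exists u; split=> //.
pose dz (c : V) := cochart_rate (sigma u) (X u c).
have dzl (a b : R) (v w : V) : dz (a *: v + b *: w) = a *: dz v + b *: dz w.
  by rewrite /dz (derive_linear oW smW) ?cochart_rate_linear//; exact: SW.
pose J := \matrix_i dz (delta_mx 0 i).
have dzJ (c : V) : c *m J = dz c by rewrite [RHS](linear_rowE _ dzl).
have pj0 := model_j_neq0 eps_j (sigma_model hu).
have orth (c : V) : c *m u^T = 0 -> \sum_i u 0 i * c 0 i = 0.
  by rewrite mul_trE => /matrixP/(_ 0 0); rewrite !mxE mulr1n.
have zdz (v c : V) : c *m J *m v^T = (\sum_m v 0 m * dz c 0 m)%:M by rewrite dzJ mul_trE.
have curve (c : V) : \sum_i u 0 i * c 0 i = 0 -> c != 0 ->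
    exists g : R -> E, [/\ g 0 = sigma u,
      forall s, exists2 u', unit_sphere u' & g s = sigma u' &
      forall m, is_derive (0 : R) 1 (fun s => cochart (g s) 0 m) (dz c 0 m)].
  move=> uc cn; have [g [g0 gs dg]] := curve_on_sphere hu uc cn.
  exists g; split=> // m; rewrite /dz -g0.
  have p0 : proj (g 0) j j != 0 by rewrite g0.
  exact (cochart_derive h eps c0 m p0 dg).
have zu := z_sphere hu.
apply: (@orth_parallel R _ u y (z u) J).
- apply: contra_eqN zu => /eqP ->.
  by rewrite big1 ?(eq_sym 0) ?oner_neq0// => i _; rewrite mxE expr0n.
- move=> c uc cJ; apply/eqP; apply/negPn/negP => cn; have oc := orth c uc.
  have [g [g0 gs dg]] := curve_on_sphere hu oc cn.
  have X0 : X u c = 0.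
    apply: (cochart_rate_inj eps_sign eps_h eps_j c0_lt c0_gt _ dg).
      by move=> s; have [u' hu' ->] := gs s; exact: sigma_model.
    by rewrite g0 -/(dz c) -dzJ.
  have T0 : T u c = 0.
    rewrite -[LHS]complexifyK X0.
    by congr pair; apply/matrixP => k l; rewrite !mxE.
  by move/eqP: cn; apply; exact: imm hu oc T0.
- move=> c uc; rewrite !zdz; have oc := orth c uc.
  have [->|cn] := eqVneq c 0.
    have -> : dz 0 = 0 by have := dzl 0 0 0 0; rewrite !scale0r addr0.
    have z0 m : (0 : V) 0 m = 0 by rewrite mxE.
    by split; rewrite big1 ?raddf0// => m _; rewrite z0 mulr0.
  have [g [g0 gs dg]] := curve c oc cn; split.
    have df : is_derive (0 : R) 1 (fun s => \sum_m y 0 m * cochart (g s) 0 m)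
        (\sum_m y 0 m * dz c 0 m).
      by apply: is_derive_big => m; apply: is_derive_scal.
    have d0 : \sum_m y 0 m * dz c 0 m = 0.
      apply: (max_derive_eq0 df) => s.
      by rewrite g0; have [u' hu' ->] := gs s; exact: fmax.
    by rewrite d0 raddf0.
  have dn : is_derive (0 : R) 1 (fun s => \sum_m cochart (g s) 0 m * cochart (g s) 0 m)
      (2 * \sum_m z u 0 m * dz c 0 m).
    rewrite mulr_sumr; apply: is_derive_big => m.
    by apply: is_derive_eq (is_derive_mul (dg m) (dg m)) _; rewrite g0 /z; ring.
  have e : (fun s => \sum_m cochart (g s) 0 m * cochart (g s) 0 m) = fun=> 1.
    by apply/funext => s; have [u' hu' ->] := gs s; exact: z_sphere.
  have : 2 * (\sum_m z u 0 m * dz c 0 m) = 0.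
    by rewrite e in dn; have [_ <-] := dn; exact: derive_cst.
  by move/eqP; rewrite mulf_eq0 pnatr_eq0 => /eqP ->; rewrite raddf0.
Qed.

(** A maximum at the antipode of [y] would make the map constant. *)
Lemma sphere_surjective y : model eps j y -> height y h = c0 ->
  exists2 u, unit_sphere u & sigma u = y.
Proof.
move=> my hy; have [_ [_ _ _ inj _]] := sigma_emb.
pose w := cochart y.
have hw : unit_sphere w by exact: (cochart_unit_sphere eps_sign eps_h eps_j c0_lt c0_gt).
have [u [hu umax [a wa]]] := sphere_max_parallel w.
have zu := z_sphere hu.
have back x x' : model eps j x -> model eps j x' -> cochart x = cochart x' -> x = x'.
  move=> mx mx' e.
  have [_ <-] := cochartK eps_sign eps_h eps_j c0_lt c0_gt mx.
  by have [_ <-] := cochartK eps_sign eps_h eps_j c0_lt c0_gt mx'; rewrite e.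
have sc m : (a *: z u) 0 m = a * z u 0 m by rewrite mxE.
have a2 : a ^+ 2 = 1.
  rewrite -hw wa -[LHS]mulr1 -zu mulr_sumr.
  by apply: eq_bigr => m _; rewrite sc exprMn.
exists u; first exact: hu.
apply: (back _ _ (sigma_model hu) my).
move/eqP: a2; rewrite sqrf_eq1 => /orP[] /eqP a1.
  by rewrite -/(z u) -/w wa a1 scale1r.
have fu : \sum_m w 0 m * z u 0 m = -1.
  rewrite wa -zu -sumrN; apply: eq_bigr => m _; rewrite sc a1 mulN1r mulNr expr2 //.
have const (u' : V) : unit_sphere u' -> z u' = - w.
  move=> hu'; apply: (antipode hw (z_sphere hu')).
  by rewrite -fu; exact: umax.
have huN : unit_sphere (- u).
  by rewrite /unit_sphere /= -[RHS]hu; apply: eq_bigr => m _; rewrite mxE sqrrN.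
have eN : sigma u = sigma (- u).
  by apply: back; [exact: sigma_model|exact: sigma_model|rewrite -!/(z _) !const].
case: (unit_sphere_neqN hu (inj _ _ (mem_set hu) (mem_set huN) eN)).
Qed.

End SphereSurjective.

(** * Reversing the sign of H *)

Lemma ReN (R : realType) (z : R[i]%C) : Re (- z) = - Re z.
Proof. by case: z. Qed.

Lemma ImN (R : realType) (z : R[i]%C) : Im (- z) = - Im z.
Proof. by case: z. Qed.


Section Reversal.
Variables (R : realType) (n : nat).
Local Notation C := R[i]%C.
Local Notation E := 'M[C]_n.+1.
Implicit Types (h : 'I_n.+1 -> R) (x y : E).
Local Notation opp h := (fun k => - h k).

Lemma sumN0 h : \sum_i h i = 0 -> \sum_i - h i = 0.
Proof. by rewrite sumrN => ->; rewrite oppr0. Qed.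

Lemma fHN h x : \sum_i h i = 0 -> fH (opp h) x = - fH h x.
Proof.
move=> hs; rewrite !fHE ?sumN0// -mulrN -sumrN; congr (_ * _); apply: eq_bigr => k _.
by rewrite -mulNr; congr (_ * _); apply: complex_ext => //=; rewrite oppr0.
Qed.

Lemma oppK h : opp (opp h) = h.
Proof. by apply/funext => k; rewrite opprK. Qed.

Lemma gradientN h x G : \sum_i h i = 0 -> is_gradient (f1 h) x G -> is_gradient (f1 (opp h)) x (- G).
Proof.
move=> hs [tG dG]; split=> [|v tv].
  by rewrite -scaleN1r; exact: tangent_orbitZ.
have t0 := tangent_trace0 tv.
have e : (fun s : R => f1 (opp h) (x + s%:C%C *: v)) = fun s => -1 * f1 h (x + s%:C%C *: v).
  by apply/funext => s; rewrite /f1 fHN// mulN1r; case: (fH h _).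
rewrite e; apply: is_derive_eq (is_derive_scal (-1) (dG v tv)) _.
have aN : adjmx (- G) = - adjmx G by apply/matrixP => a b; rewrite !(adjmxE, mxE) raddfN.
by rewrite !metricE// aN mulNmx raddfN /= ReN mulN1r mulrN.
Qed.

Lemma integral_curveN h (I J : set R) (gamma : R -> E) : \sum_i h i = 0 -> (forall t, J t -> I (- t)) ->
  integral_curve h I gamma -> integral_curve (opp h) J (fun t => gamma (- t)).
Proof.
move=> hs IJ hI t /IJ /hI[ho [G hG dG]]; split=> //; exists (- G); first exact: gradientN.
have /realify_is_deriveP d := dG; apply/realify_is_deriveP => k l.
have dm (f : R -> R) (f' : R) : is_derive (- t) 1 f f' ->
    is_derive t 1 (fun s => f (- s)) (- f').
  move=> df; have dN : is_derive t 1 (fun s : R => - s) (-1 : R) := is_deriveN (is_derive_id t 1).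
  have dc := @is_derive1_comp R f (fun s => - s) t _ _ df dN.
  by apply: is_derive_eq dc _; rewrite mulrN1.
have [d1 d2] := d k l; rewrite mxE.
by split; [rewrite ReN; exact: dm d1|rewrite ImN; exact: dm d2].
Qed.

(** The unstable manifold is a stable manifold for the opposite function, by
    reversal of time. *)
Lemma unstable_stableN h x : \sum_i h i = 0 -> unstable h x = stable (opp h) x.
Proof.
move=> hs; apply/seteqP; split.
  move=> y [gamma [hI g0 gl]]; have [e e0 hI'] := hI.
  exists (fun t => gamma (- t)); split.
  - exists e => //; apply: (@integral_curveN h _ _ gamma hs _ hI') => t /=.
    by rewrite ltrNl.
  - by rewrite oppr0.
  - exact/cvgNy_compNP.
move=> y [gamma [hI g0 gl]]; have [e e0 hI'] := hI.
exists (fun t => gamma (- t)); split.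
- exists e => //; rewrite -[h](oppK h).
  apply: (@integral_curveN (opp h) _ _ gamma (sumN0 hs) _ hI') => t /=.
  by rewrite ltrN2.
- by rewrite oppr0.
- apply/cvgNy_compNP; rewrite (_ : _ \o _ = gamma)//.
  by apply/funext => t; rewrite /= opprK.
Qed.

Lemma criticalN h y : \sum_i h i = 0 -> critical (opp h) y -> critical h y.
Proof.
move=> hs [ho hc]; split; first exact: ho.
move=> v tv; rewrite (derive_fH hs); apply: oppr_inj; rewrite oppr0 -(fHN v hs).
by rewrite -(derive_fH (sumN0 hs) y v); exact: hc.
Qed.

Lemma horizontalN h y u : \sum_i h i = 0 -> horizontal h y u -> horizontal (opp h) y u.
Proof.
move=> hs [tu hu]; split; first exact: tu.
move=> v tv; rewrite (derive_fH (sumN0 hs)) (fHN v hs) => e; apply: hu => //.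
by rewrite (derive_fH hs); apply: oppr_inj; rewrite oppr0.
Qed.

Lemma open_itv01 : open [set t : R | 0 < t < 1].
Proof.
have -> : [set t : R | 0 < t < 1] = `]0, 1[%classic.
  by apply/seteqP; split=> t /=; rewrite in_itv.
exact: itv_open.
Qed.

Let neg1 : R[i]%C := (-1 : R)%:C%C.

Let neg1_neq0 : neg1 != 0.
Proof. by rewrite real_complex_eq0 oppr_eq0 oner_neq0. Qed.

Let fHN1 h x : \sum_i h i = 0 -> fH (opp h) x = neg1 * fH h x.
Proof.
move=> hs; rewrite fHN// -mulN1r; congr (_ * _).
by apply: complex_ext => //=; rewrite oppr0.
Qed.

Lemma vanishing_pathN h x (alpha : R -> C) : \sum_i h i = 0 ->
  vanishing_path h x alpha -> vanishing_path (opp h) x (fun t => neg1 * alpha t).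
Proof.
move=> hs [c [s1 s2] inj nc a1]; split.
- apply/subspace_continuousP => t ht.
  have /subspace_continuousP/(_ t ht) c1 := c.
  have FF : Filter (within `[0, 1]%classic (nbhs t)) by exact: _.
  exact (ccvgM FF (@ccvg_cst R _ _ FF neg1) c1).
- split=> k.
    have -> : (fun t => Re (neg1 * alpha t)) = fun t => -1 * Re (alpha t).
      by apply/funext => t; exact: Re_real.
    by apply: (CkM open_itv01); [exact: Ck_cst|exact: s1].
  have -> : (fun t => Im (neg1 * alpha t)) = fun t => -1 * Im (alpha t).
    by apply/funext => t; exact: Im_real.
  by apply: (CkM open_itv01); [exact: Ck_cst|exact: s2].
- by move=> s t hs' ht /(mulfI neg1_neq0); exact: inj.
- move=> t y ht; rewrite (fHN1 y hs) => /(mulfI neg1_neq0) e cr.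
  exact: (nc t y ht e (criticalN hs cr)).
- by rewrite a1 fHN1.
Qed.

Lemma thimbleN h x D : \sum_i h i = 0 -> thimble h x D -> thimble (opp h) x D.
Proof.
move=> hs [alpha [sigma [P [vp es Pl nb DE]]]].
exists (fun t => neg1 * alpha t), sigma, P.
split; [exact: (vanishing_pathN hs vp)|exact: es| |exact: nb|exact: DE].
move=> u hu; have [P0 [c ha hd]] := Pl u hu.
split; [exact: P0|split; [exact: c| |]] => t ht.
  have [ho e] := ha t ht; split; first exact: ho.
  by rewrite (fHN1 _ hs) e.
have [v hv dv] := hd t ht; exists v; [exact: (horizontalN hs hv)|exact: dv].
Qed.

End Reversal.

(** * Stable manifolds and thimbles *)

Section Assembly.
Variables (R : realType) (n : nat).
Local Notation C := R[i]%C.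
Local Notation E := 'M[C]_n.+1.
Variable h : 'I_n.+1 -> R.
Hypothesis h_sum : \sum_i h i = 0.
Variables (j : 'I_n.+1) (eps : 'I_n.+1 -> R).
Hypothesis eps_sign : forall k, eps k = 1 \/ eps k = -1.
Hypothesis eps_h : forall k, k != j -> eps k * (h k - h j) < 0.
Hypothesis eps_j : eps j = 1.
Hypothesis n0 : (0 < n)%N.

Lemma thimble_closed_ball (D : set E) : thimble h (crit_pt R j) D ->
  D `<=` model eps j -> closed_ball_of_dim n.*2 D.
Proof.
move=> [alpha [sigma [P [vp es Pl _ DE]]]] Dm.
have lift u : unit_sphere u -> horizontal_lift h alpha (P u).
  by move=> /Pl[].
have Pm u t : unit_sphere u -> 0 <= t < 1 -> model eps j (P u t).
  by move=> hu ht; apply: Dm; rewrite DE; right; exists u, t.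
have o01 : (0 : R) <= (0 : R) < 1 by rewrite lexx ltr01.
have sm u : unit_sphere u -> model eps j (sigma u).
  by move=> hu; have [<- _] := Pl u hu; exact: Pm.
have sh u : unit_sphere u -> height (sigma u) h = level n alpha 0.
  move=> hu; have [<- _] := Pl u hu; exact: (height_transport h_sum lift Pm hu o01).
have lt0 := level0_lt h_sum eps_h n0 vp lift Pm.
have gt0 := level0_gt h_sum n0 vp lift Pm.
have surj y : model eps j y -> height y h = level n alpha 0 ->
    exists2 u, unit_sphere u & P u 0 = y.
  move=> my hy; have [u hu <-] := sphere_surjective eps_sign eps_h eps_j lt0 gt0 n0 es sm sh my hy.
  by exists u => //; have [] := Pl u hu.
rewrite DE (thimble_fills h_sum eps_sign eps_h eps_j n0 vp lift Pm surj).
exact: (superlevel_closed_ball eps_sign eps_h eps_j lt0 gt0).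
Qed.

Lemma stable_open_in_graph (c : C) : c != 0 ->
  let m := c *: diag_mx (\row_k (eps k)%:C%C) in
  relatively_open (Gamma m) (stable h (crit_pt R j)) /\
  stable h (crit_pt R j) `<=` Gamma m.
Proof.
move=> c0 m; rewrite (stable_eq_model h_sum eps_sign eps_h eps_j).
have GE : Gamma m `&` [set x : E | -1 < Re (x j j)] = model eps j by exact: Gamma_model.
split; last by rewrite -GE => x [].
exists [set x : E | -1 < Re (x j j)]; split; last by rewrite GE.
have -> : [set x : E | -1 < Re (x j j)] = (fun x : E => Re (x j j)) @^-1` [set r | -1 < r].
  by [].
apply: open_comp; last exact: open_gt.
move=> x _; suff /complex_cvgP[] : (fun y : E => y j j) @ x --> x j j by [].
have FF : Filter (nbhs x) by exact: _.
have ci : (id : E -> E) @ nbhs x --> x by exact: cvg_id.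
exact (entry_cvg FF ci).
Qed.

End Assembly.

(** The signs of the diagonal matrix attached to position [j]. *)
Definition step_sign (R : realType) n (j : 'I_n.+1) (s : R) (k : 'I_n.+1) : R :=
  if (k < j)%N then s else if k == j then 1 else - s.

Section StepSign.
Variables (R : realType) (n : nat) (j : 'I_n.+1) (s : R).
Hypothesis s_sign : s = 1 \/ s = -1.
Local Notation eps := (step_sign j s).

Lemma step_sign_sign k : eps k = 1 \/ eps k = -1.
Proof.
rewrite /step_sign; case: ifP => _ //; case: ifP => _; first by left.
by case: s_sign => ->; rewrite ?opprK; [right|left].
Qed.

Lemma step_sign_j : eps j = 1.
Proof. by rewrite /step_sign ltnn eqxx. Qed.

Lemma step_sign_h (h : 'I_n.+1 -> R) : (forall i k : 'I_n.+1, (i < k)%N -> h k < h i) ->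
  forall k, k != j -> eps k * (- s * h k - - s * h j) < 0.
Proof.
move=> hd k kj; rewrite /step_sign (negbTE kj).
have ss : s * s = 1 by case: s_sign => ->; rewrite ?mulrNN mulr1.
case: ltnP => [kj'|jk].
  have -> : s * (- s * h k - - s * h j) = - (s * s) * (h k - h j) by ring.
  by rewrite ss mulN1r oppr_lt0 subr_gt0 hd.
have jk' : (j < k)%N by rewrite ltn_neqAle jk andbT eq_sym.
have -> : - s * (- s * h k - - s * h j) = (s * s) * (h k - h j) by ring.
by rewrite ss mul1r subr_lt0 hd.
Qed.

Lemma m_mx_step : exists2 c : R[i]%C, c != 0 &
  m_mx s%:C%C j = c *: diag_mx (\row_k (eps k)%:C%C).
Proof.
have ss : s * s = 1 by case: s_sign => ->; rewrite ?mulrNN mulr1.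
have s0 : s%:C%C != 0 :> R[i]%C.
  by rewrite real_complex_eq0; case: s_sign => ->; rewrite ?oppr_eq0 oner_neq0.
exists (- s%:C%C * (-1) ^+ j.+1 * s%:C%C).
  by rewrite !mulf_neq0 ?oppr_eq0// signr_eq0.
rewrite /m_mx -[RHS]scalerA; congr (_ *: _); apply/matrixP => a b; rewrite !mxE.
case: (a == b); rewrite ?mulr0n ?mulr0// !mulr1n /step_sign.
case: ifP => _; first by rewrite -real_complexM ss.
case: ifP => _; first by rewrite mulr1.
rewrite -real_complexM mulrN ss.
by apply: complex_ext => //=; rewrite oppr0.
Qed.

End StepSign.

Theorem theorem29 (R : realType) (n : nat) (n_ge2 : (2 <= n)%N)
    (n_even : ~~ odd n) (h : 'I_n.+1 -> R)
    (h_decr : forall i k : 'I_n.+1, (i < k)%N -> h k < h i)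
    (h_sum : \sum_i h i = 0) (j : 'I_n.+1) :
  [/\ relatively_open (Gamma (m_mx (-1) j)) (stable h (crit_pt R j)),
      relatively_open (Gamma (m_mx 1 j)) (unstable h (crit_pt R j)),
      (forall D, stable_real_thimble h (crit_pt R j) D ->
         closed_ball_of_dim n.*2 D /\ D `<=` Gamma (m_mx (-1) j)) &
      (forall D, unstable_real_thimble h (crit_pt R j) D ->
         closed_ball_of_dim n.*2 D /\ D `<=` Gamma (m_mx 1 j))].
Proof.
have n0 : (0 < n)%N by apply: leq_trans n_ge2.
(* [stable] is the case s = -1 of a statement about the function [- s h];
   [unstable] is its case s = 1, after reversal of time. *)
have key (s : R) : s = 1 \/ s = -1 ->
    [/\ relatively_open (Gamma (m_mx s%:C%C j)) (stable (fun k => - s * h k) (crit_pt R j)),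
      stable (fun k => - s * h k) (crit_pt R j) `<=` Gamma (m_mx s%:C%C j) &
      forall D, thimble (fun k => - s * h k) (crit_pt R j) D ->
        D `<=` stable (fun k => - s * h k) (crit_pt R j) -> closed_ball_of_dim n.*2 D].
  move=> hs; have es := step_sign_sign j hs; have ej := step_sign_j j s.
  have eh := @step_sign_h R n j s hs h h_decr.
  have sum0 : \sum_k - s * h k = 0 by rewrite -mulr_sumr h_sum mulr0.
  have [c c0 mE] := m_mx_step j hs.
  have [op sub] := stable_open_in_graph sum0 es eh ej c0.
  split; [by rewrite mE|by rewrite mE|move=> D tD Ds].
  apply: (thimble_closed_ball sum0 es eh ej n0 tD).
  by rewrite -(stable_eq_model sum0 es eh ej).
have [open1 sub1 ball1] := key (-1) (or_intror erefl).
have [open2 sub2 ball2] := key 1 (or_introl erefl).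
have e1 : (fun k => - (-1) * h k) = h by apply/funext => k; rewrite opprK mul1r.
have e2 : (fun k => - 1 * h k) = (fun k => - h k) by apply/funext => k; rewrite mulN1r.
have m1 : (-1 : R)%:C%C = -1 :> R[i] by apply: complex_ext => //=; rewrite oppr0.
rewrite e1 m1 in open1 sub1 ball1; rewrite e2 in open2 sub2 ball2.
rewrite -(unstable_stableN (crit_pt R j) h_sum) in open2 sub2 ball2.
split; [exact: open1|exact: open2| |] => D [tD _ Ds _].
  by split; [exact: ball1|exact: subset_trans Ds sub1].
by split; [exact (ball2 D (thimbleN h_sum tD) Ds)|exact: subset_trans Ds sub2].
Qed.
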